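(* Let $\{B^H(t),t\in[0,1]\}$ be a $d$-dimensional fractional Brownian motion with Hurst index $H\in(0,1)$, let $f\in C^H(\mathbf{I})$, and let $F\subseteq\mathbb{R}^d$ and $E\subset\mathbf{I}$ be compact sets such that $0<\dim(E)\le\overline{\dim}_M(E)<Hd$. Then for any $0<\beta<\dim(E)\le\overline{\dim}_M(E)<\beta'<Hd$, $$\mathtt{c}_1^{-1}\,\mathcal{C}^{d-\beta/H}(F)\le\mathbb{P}\{(B^H+f)(E)\cap F\ne\emptyset\}\le\mathtt{c}_1\,\mathcal{H}^{d-\beta'/H}(F),$$ where $\mathtt{c}_1$ is a positive constant depending only on $E$, $F$, $H$, $\mathrm{K}_f$, $\beta$ and $\beta'$.
   Context: $\mathbf{I}=[a,b]$ with fixed $0<a<b\le 1$. A real fractional Brownian motion $B_0^H$ is a centered Gaussian process with continuous paths and covariance $\frac12(|t|^{2H}+|s|^{2H}-|t-s|^{2H})$; $B^H$ has $d$ independent copies of $B_0^H$ as components and is defined on a complete probability space $(\Omega,\mathcal{F},\mathbb{P})$. $C^H(\mathbf{I})$ is the space of $H$-Hölder functions $f:\mathbf{I}\to\mathbb{R}^d$, with norm $\|f\|_H=\sup_{s\in\mathbf{I}}\|f(s)\|+\sup_{s\ne t}\|f(t)-f(s)\|/|t-s|^H$; $\mathrm{K}_f$ denotes $\|f\|_H$. $\dim$ is the Euclidean Hausdorff dimension and $\overline{\dim}_M$ the Euclidean upper Minkowski (box) dimension. For $\beta>0$, $\mathcal{H}^\beta$ is the Euclidean Hausdorff measure $\mathcal{H}^\beta(G)=\lim_{\delta\to0}\inf\{\sum_n(2r_n)^\beta: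 G\subseteq\bigcup_n B(r_n),\ r_n\le\delta\}$ (open balls $B(r_n)$ of radius $r_n$), and $\mathcal{C}^\beta(G)=\big[\inf_{\mu\in\mathcal{P}(G)}\iint\|u-v\|^{-\beta}\mu(du)\mu(dv)\big]^{-1}$, with $\mathcal{P}(G)$ the probability measures carried by $G$ ($0^{-\beta}=\infty$, $1/\infty=0$, $\inf\emptyset=\infty$). *)

(* Defs.v *)
From HB Require Import structures.
From mathcomp Require Import all_boot all_order all_algebra.
From mathcomp Require Import all_classical all_reals all_analysis.

Set Implicit Arguments.
Unset Strict Implicit.
Unset Printing Implicit Defensive.

Import Order.TTheory GRing.Theory Num.Theory.
Import numFieldNormedType.Exports.

Local Open Scope classical_set_scope.
Local Open Scope ring_scope.

(* The library's norm on ['rV[R]_d] is the sup norm; it induces the same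
   topology as the Euclidean norm, which all quantities below use. *)
Definition euclid_norm (R : realType) (d : nat) (x : 'rV[R]_d) : R :=
  Num.sqrt (\sum_(i < d) x ord0 i ^+ 2).

Definition euclid_dist (R : realType) (d : nat) (x y : 'rV[R]_d) : R := euclid_norm (x - y).

Definition abs_dist (R : realType) (x y : R) : R := `|x - y|.

Definition oball (R : realType) (T : Type) (dist : T -> T -> R) (x : T) (r : R)
  : set T := [set y | dist x y < r].

(* A ball of radius 0 is empty and [0 `^ beta = 0] for [beta > 0], so allowing
   null radii lets finite covers be written as sequences. *)
Definition hausdorff_delta (R : realType) (T : Type) (dist : T -> T -> R)
    (beta delta : R) (G : set T) : \bar R :=
  ereal_inf [set (\sum_(0 <= n <oo) ((2 * r n) `^ beta)%:E)%E
            | r in [set r : nat -> R | (forall n, 0 <= r n <= delta) /\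
                exists x : nat -> T, G `<=` \bigcup_n oball dist (x n) (r n)]].

Definition hausdorff_measure (R : realType) (T : Type) (dist : T -> T -> R)
    (beta : R) (G : set T) : \bar R :=
  lim (hausdorff_delta dist beta delta G @[delta --> (0 : R)^'+]).

Definition hausdorff_dim (R : realType) (T : Type) (dist : T -> T -> R)
    (G : set T) : \bar R :=
  ereal_inf [set beta%:E | beta in
    [set beta : R | 0 < beta /\ hausdorff_measure dist beta G = 0%E]].

Definition covering_number (R : realType) (T : Type) (dist : T -> T -> R)
    (G : set T) (r : R) : \bar R :=
  ereal_inf [set (n%:R : R)%:E | n in
    [set n : nat | exists x : 'I_n -> T, G `<=` \bigcup_i oball dist (x i) r]].

Definition upper_minkowski_dim (R : realType) (T : Type) (dist : T -> T -> R)
    (G : set T) : \bar R :=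
  limf_esup (fun r : R => (lne (covering_number dist G r) / (ln r^-1)%:E)%E)
            (0 : R)^'+.

Definition borelRn (R : realType) (d : nat) :=
  g_sigma_algebraType (@open 'rV[R]_d).

Definition riesz_kernel (R : realType) (d : nat) (beta : R) (u v : 'rV[R]_d)
  : \bar R := if u == v then +oo%E else (euclid_norm (u - v) `^ (- beta))%:E.

Definition energy (R : realType) (d : nat) (beta : R)
    (mu : probability (borelRn R d) R) : \bar R :=
  (\int[mu]_v \int[mu]_u riesz_kernel beta u v)%E.

(* The library conventions [0^-1 = +oo], [+oo^-1 = 0] and
   [ereal_inf set0 = +oo] are the required ones. *)
Definition capacity (R : realType) (d : nat) (beta : R) (G : set 'rV[R]_d)
  : \bar R :=
  ((ereal_inf [set energy beta mu | mu in
      [set mu : probability (borelRn R d) R | mu.-negligible (~` G)]])^-1)%E.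

Definition holder_space (R : realType) (d : nat) (I : set R) (H : R)
    (f : R -> 'rV[R]_d) : Prop :=
  exists M : R, forall s t : R, I s -> I t ->
    euclid_norm (f t - f s) <= M * `|t - s| `^ H.

Definition holder_norm (R : realType) (d : nat) (I : set R) (H : R)
    (f : R -> 'rV[R]_d) : \bar R :=
  (ereal_sup [set (euclid_norm (f s))%:E | s in I] +
   ereal_sup [set (euclid_norm (f p.2 - f p.1) / `|p.2 - p.1| `^ H)%:E | p in
     [set p : R * R | [/\ I p.1, I p.2 & p.1 != p.2]]])%E.

(* [normal_prob m 0] is the uniform law on [0, 1], hence the separate treatment
   of the degenerate case. *)
Definition gaussian_law (R : realType) (m s : R) (A : set R) : \bar R :=
  if s == 0 then \d_m A else normal_prob m s A.

Definition gaussian_rv (R : realType) (disp : measure_display)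
    (Omega : measurableType disp) (P : probability Omega R) (X : Omega -> R)
  : Prop :=
  measurable_fun setT X /\
  exists m s : R, forall A : set R, measurable A ->
    P (X @^-1` A) = gaussian_law m s A.

Definition gaussian_process (R : realType) (disp : measure_display)
    (Omega : measurableType disp) (P : probability Omega R) (J : set R)
    (X : R -> Omega -> R) : Prop :=
  forall (n : nat) (t c : 'I_n -> R), (forall i, J (t i)) ->
    gaussian_rv P (fun w => \sum_(i < n) c i * X (t i) w).

(* Processes are indexed by all of [R], but only their values at times in
   [0, 1] are constrained. *)
Definition real_fbm (R : realType) (disp : measure_display)
    (Omega : measurableType disp) (P : probability Omega R) (H : R)
    (X : R -> Omega -> R) : Prop :=
  [/\ gaussian_process P `[0, 1] X,
      forall t, t \in `[0, 1] -> ('E_P[X t] = 0)%E,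
      forall s t, s \in `[0, 1] -> t \in `[0, 1] ->
        covariance P (X s) (X t) =
        (2^-1 * (`|t| `^ (2 * H) + `|s| `^ (2 * H) - `|t - s| `^ (2 * H)))%:E
    & forall w, {within `[0, 1], continuous (fun t => X t w)}].

Definition process_sigma (R : realType) (disp : measure_display)
    (Omega : measurableType disp) (J : set R) (X : R -> Omega -> R)
  : set (set Omega) :=
  <<s \bigcup_(t in J) preimage_set_system setT (X t) measurable >>.

(* Every sigma-algebra contains [setT], so the product rule over the full
   family gives it over all subfamilies. *)
Definition independent_processes (R : realType) (disp : measure_display)
    (Omega : measurableType disp) (P : probability Omega R) (J : set R)
    (d : nat) (X : 'I_d -> R -> Omega -> R) : Prop :=
  forall A : 'I_d -> set Omega,
    (forall i, process_sigma J (X i) (A i)) ->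
    P (\bigcap_i A i) = (\prod_(i < d) P (A i))%E.

Definition fbm (R : realType) (disp : measure_display)
    (Omega : measurableType disp) (P : probability Omega R) (d : nat) (H : R)
    (B : R -> Omega -> 'rV[R]_d) : Prop :=
  (forall i : 'I_d, real_fbm P H (fun t w => B t w ord0 i)) /\
  independent_processes P `[0, 1] (fun (i : 'I_d) t w => B t w ord0 i).

(* Main.v *)
Require Import Defs.
From HB Require Import structures.
From mathcomp Require Import all_boot all_order all_algebra.
From mathcomp Require Import all_classical all_reals all_analysis.
From mathcomp Require Import measurable_realfun finmap ring lra.

Set Implicit Arguments.
Unset Strict Implicit.
Unset Printing Implicit Defensive.

Import Order.TTheory GRing.Theory Num.Theory.
Import numFieldNormedType.Exports.

Local Open Scope classical_set_scope.
Local Open Scope ring_scope.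

(* Lower bound. A Frostman measure on [E] and a measure [mu] on [F] of finite
   energy [r] weight the pairs (time, point). At scale [e] the weighted number of
   pairs [(t, x)] with [B t + f t] in the cube of side [2 * e] around [x] has mean
   at least of order [e ^+ d] and second moment at most of order
   [e ^+ (2 * d) * r], because two times [s], [t] contribute a factor
   [max(|t - s|^H, |x - y|)^(-d)], of which [beta] is spent on Frostman's measure
   and [d - beta / H] on the energy; the Hölder drift [f] costs only a constant
   factor. By Cauchy-Schwarz such a pair exists with probability at least of order
   [1 / r]; compactness lets [e] tend to 0.

   Upper bound. At scale [r ^ (1 / H)] the set [E] is covered by at most
   [r ^ (- beta1 / H)] intervals, with [beta1 < beta']. Over such an interval a
   coordinate of [B + f] moves by more than [r ^ (1 - eps)] with negligible
   probability (dyadic chaining with high Gaussian moments), and at its left end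
   it is within [r ^ (1 - eps)] of a given point with probability of order
   [r ^ (1 - eps)]. By independence of the coordinates a ball of radius [r] is hit
   with probability of order [r ^ (d - beta' / H)]; sum over a cover of [F]. *)

(** * Gaussian integrals *)

(** The process is known only through the laws of linear combinations of its values, so no joint
    density is at hand. Independence of two uncorrelated combinations is therefore shown only as far
    as Gaussian kernels see it: products of cosines reduce to cosines of linear combinations,
    averaging over the frequency turns cosines into kernels, and kernels dominate indicators of
    intervals. The uncorrelated pair comes from regressing [X s] on [X t]; the residual variance
    stays comparable to |t - s|^(2H) because all times are at least [a > 0].

    Both measures of the lower bound become finitely many weighted points, so the second moment
    method runs over a finite family of events. The decay in |x - y| is taken from the one
    coordinate where the points are farthest apart, raised to the power [d].

    Strict gaps between exponents are used on both sides: [beta < beta1] makes a sum over dyadic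
    scales geometric, and [beta' - beta1] pays for the loss r^(-eps) in each of the [d] coordinates.
    All constants are fixed before the probability space, [B] and [f]. *)

Lemma gauss_integrable (R : realType) (c : R) : 0 < c ->
  (@lebesgue_measure R).-integrable setT (fun x => (expR (- x ^+ 2 / c))%:E).
Proof.
move=> c0; pose s := Num.sqrt (c / 2).
have s0 : s != 0 by rewrite gt_eqF// sqrtr_gt0 divr_gt0.
have := integrableZl measurableT (normal_peak s)^-1 (integrable_normal_pdf 0 s).
apply: eq_integrable => // x _.
rewrite normal_pdfE//= -EFinM mulrA mulVf ?mul1r; last by rewrite gt_eqF// normal_peak_gt0.
rewrite /normal_fun subr0 sqr_sqrtr; last by rewrite divr_ge0// ltW.
by congr (expR (_ / _))%:E; rewrite -mulr_natr divfK.
Qed.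

(** The fundamental theorem on [[-n, n]] gives [F n - F (-n)], and dominated convergence lets [n]
    grow. This plays the part of integration by parts in the Gaussian computations below. *)
Lemma integral_derivative0 (R : realType) (F f : R -> R) :
  (@lebesgue_measure R).-integrable setT (EFin \o f) ->
  continuous f ->
  (forall x : R, is_derive x 1 F (f x)) ->
  F x @[x --> +oo] --> 0 -> F x @[x --> -oo] --> 0 ->
  (\int[@lebesgue_measure R]_x (f x)%:E = 0)%E.
Proof.
move=> intf cf dF Fy FNy.
pose fn (n : nat) (x : R) := ((f \_ `[- n%:R, n%:R]) x)%:E.
have mf : measurable_fun setT f.
  by apply: continuous_measurable_fun.
have mfn n : measurable_fun setT (fn n).
  apply/measurable_EFinP/(measurable_restrictT _ _).1 => //.
  exact: measurable_funTS.
have f_f : {ae @lebesgue_measure R, forall x, setT x ->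
    fn n x @[n --> \oo] --> (EFin \o f) x}.
  apply: aeW => x _ /=; apply: cvg_near_cst.
  near=> n; rewrite /fn patchE mem_set//= in_itv/= -ler_norml.
  by near: n; exact: nbhs_infty_ger.
have absf : {ae @lebesgue_measure R, forall x (n : nat), setT x ->
    (`|fn n x| <= (`|f x|)%:E)%E}.
  apply: aeW => x n _; rewrite /fn lee_fin patchE.
  by case: ifPn => // _; rewrite normr0.
have [_ _ h] := @dominated_convergence _ _ _ (@lebesgue_measure R) setT measurableT
  fn (EFin \o f) _ mfn (measurableT_comp (@EFin_measurable _ _) mf) f_f
  (integrable_abse intf) absf.
move: h.
suff -> : (fun n => (\int[@lebesgue_measure R]_x fn n x)%E) =
    (fun n => (F n%:R - F (- n%:R))%:E).
  move=> /cvg_lim <- //; apply/cvg_lim => //.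
  apply: cvg_EFin; first exact: nearW.
  rewrite -[X in _ --> X](subr0 0); apply: cvgB.
    exact: (cvg_comp _ _ (@cvgr_idn R) Fy).
  apply: (cvg_comp _ _ _ FNy); apply/cvgNry.
  rewrite [X in X @ _](_ : _ = (fun n : nat => n%:R)); first exact: cvgr_idn.
  by apply/funext => k /=; rewrite -[LHS]/(- - _) opprK.
apply/funext => n.
(* The fundamental theorem is applied on a nondegenerate interval, so [n = 0] is treated apart. *)
have [->|n0] := eqVneq n 0%N.
  rewrite oppr0 subrr /fn.
  have -> : (fun x => ((f \_ `[-0, 0]) x)%:E) = (fun x => (EFin \o f) x) \_ [set 0].
    by apply/funext => x; rewrite oppr0 set_itv1 restrict_EFin.
  by rewrite -integral_mkcond integral_set1.
have -> : (fn n) = (EFin \o f) \_ `[- n%:R, n%:R].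
  by apply/funext => x; rewrite restrict_EFin.
rewrite -integral_mkcond (@continuous_FTC2 _ f F)//.
- by rewrite gtrN// ltr0n lt0n.
- exact: continuous_subspaceT.
- split=> [x _||].
  + by have [] := dF x.
  + apply: cvg_at_right_filter; apply: differentiable_continuous.
    by apply/derivable1_diffP; have [] := dF (- n%:R).
  + apply: cvg_at_left_filter; apply: differentiable_continuous.
    by apply/derivable1_diffP; have [] := dF n%:R.
- by move=> x _; rewrite derive1E; have [_ ->] := dF x.
Unshelve. all: end_near. Qed.

Lemma is_derive_cosM (R : realType) (x c p t : R) :
  is_derive t 1 (fun t => cos (t * x + p) * c) (- (x * sin (t * x + p) * c)).
Proof.
have h : is_derive t 1 (fun t => t * x + p) x.
  by apply: is_derive_eq; rewrite /GRing.scale/=; ring.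
have h2 := @is_derive1_comp _ cos (fun t => t * x + p) _ _ _ (is_derive_cos (t * x + p)) h.
apply: is_derive_eq; rewrite /GRing.scale/=; ring.
Qed.

Lemma is_derive_gauss (R : realType) (c x : R) :
  is_derive x 1 (fun x => expR (- x ^+ 2 / c)) (- (2 * x / c) * expR (- x ^+ 2 / c)).
Proof.
have h : is_derive x 1 (fun x : R => - x ^+ 2 / c) (- (2 * x / c)).
  apply: is_derive_eq; rewrite /GRing.scale/=; ring.
have h2 := @is_derive1_comp _ expR (fun x => - x ^+ 2 / c) _ _ _ (is_derive_expR (- x ^+ 2 / c)) h.
by apply: is_derive_eq; rewrite mulrC.
Qed.

Lemma is_derive_sin_gauss (R : realType) (t c p x : R) :
  is_derive x 1 (fun x => sin (t * x + p) * expR (- x ^+ 2 / c))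
   (t * (cos (t * x + p) * expR (- x ^+ 2 / c)) -
    2 / c * (x * sin (t * x + p) * expR (- x ^+ 2 / c))).
Proof.
have h : is_derive x 1 (fun x => t * x + p) t.
  by apply: is_derive_eq; rewrite /GRing.scale/=; ring.
have h2 := @is_derive1_comp _ sin (fun x => t * x + p) _ _ _ (is_derive_sin (t * x + p)) h.
have h3 := is_derive_gauss c x.
apply: is_derive_eq; rewrite /GRing.scale/=; ring.
Qed.

Lemma cvg_gauss0 (R : realType) (c : R) : 0 < c ->
  (expR (- x ^+ 2 / c) @[x --> +oo] --> 0) /\ (expR (- x ^+ 2 / c) @[x --> -oo] --> 0).
Proof.
move=> c0.
have h1 : expR (- x ^+ 2 / c) @[x --> +oo] --> 0.
  have := @cvg_gauss_fun R.
  move=> h.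
  have k : (fun x : R => expR (- x ^+ 2 / c)) = gauss_fun \o (fun x => (Num.sqrt c)^-1 * x).
    by apply/funext => x; rewrite /gauss_fun/= exprMn exprVn sqr_sqrtr ?ltW//; congr expR; ring.
  rewrite k; apply: cvg_comp h.
  apply: gt0_cvgMry => //.
  by rewrite invr_gt0 sqrtr_gt0.
split => //; apply/cvgNy_compNP.
rewrite (_ : _ \o _ = (fun x : R => expR (- x ^+ 2 / c)))//.
by apply/funext => x /=; rewrite sqrrN.
Qed.

Lemma cvg_sin_gauss0 (R : realType) (t c p : R) : 0 < c ->
  (sin (t * x + p) * expR (- x ^+ 2 / c) @[x --> +oo] --> 0) /\
  (sin (t * x + p) * expR (- x ^+ 2 / c) @[x --> -oo] --> 0).
Proof.
move=> c0; have [h1 h2] := cvg_gauss0 c0.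
have b x : `|sin (t * x + p) * expR (- x ^+ 2 / c)| <= expR (- x ^+ 2 / c).
  by rewrite normrM (ger0_norm (expR_ge0 _)) ler_piMl ?expR_ge0// sin_max.
split; apply: norm_cvg0; [move: h1|move: h2] => h;
  (apply: squeeze_cvgr; [|exact: cvg_cst|exact: h]);
  by apply: nearW => x; rewrite normr_ge0/=.
Qed.

(** Half of the exponent absorbs the factor [|x|], by [1 + y <= expR y] at [y = x ^+ 2 / (2 * c)];
    the other half remains as an integrable majorant. *)
Lemma normr_gauss_le (R : realType) (c x : R) : 0 < c ->
  `|x| * expR (- x ^+ 2 / c) <= (1 + 2 * c) * expR (- x ^+ 2 / (2 * c)).
Proof.
move=> c0.
have -> : - x ^+ 2 / c = - (x ^+ 2 / (2 * c)) - x ^+ 2 / (2 * c) by field; rewrite gt_eqF.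
rewrite -mulNr expRD mulrA ler_wpM2r ?expR_ge0// mulNr expRN ler_pdivrMr ?expR_gt0//.
have h := expR_ge1Dx (x ^+ 2 / (2 * c)).
have k : (1 + 2 * c) * (1 + x ^+ 2 / (2 * c)) <= (1 + 2 * c) * expR (x ^+ 2 / (2 * c)).
  by rewrite ler_wpM2l// addr_ge0// mulr_ge0// ltW.
apply: le_trans k.
have -> : (1 + 2 * c) * (1 + x ^+ 2 / (2 * c)) = 1 + 2 * c + x ^+ 2 / (2 * c) + x ^+ 2.
  by field; rewrite gt_eqF.
rewrite -[x ^+ 2]real_normK ?num_real//.
have : 0 <= `|x| ^+ 2 / (2 * c) by rewrite divr_ge0 ?exprn_ge0// mulr_ge0// ltW.
have := sqr_ge0 (`|x| - 1); rewrite sqrrB1; nra.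
Qed.

(** As a function of [t] the integral [psi] solves psi' = - (c / 2) t psi, by differentiation under
    the integral sign and integration by parts. Hence psi(t) exp(t^2 c / 4) is constant. The phase
    [p] treats cosine and sine at once. *)
Lemma Rintegral_cos_gauss (R : realType) (t c p : R) : 0 < c ->
  (\int[@lebesgue_measure R]_x (cos (t * x + p) * expR (- x ^+ 2 / c)))%R =
  cos p * expR (- t ^+ 2 * c / 4) * (\int[@lebesgue_measure R]_x (expR (- x ^+ 2 / c)))%R.
Proof.
move=> c0.
pose g x := expR (- x ^+ 2 / c).
pose psi t := (\int[@lebesgue_measure R]_x (cos (t * x + p) * g x))%R.
have cg : continuous g by move=> x; have [/derivable1_diffP /differentiable_continuous] := is_derive_gauss c x.
have caff (s : R) : continuous (fun x => s * x + p).
  by move=> x; apply: cvgD; [exact: mulrl_continuous|exact: cvg_cst].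
have csin (s : R) : continuous (fun x => sin (s * x + p)).
  by move=> x; apply: (continuous_comp (caff s x)); exact: continuous_sin.
have ccos (s : R) : continuous (fun x => cos (s * x + p)).
  by move=> x; apply: (continuous_comp (caff s x)); exact: continuous_cos.
have intg (c' : R) : 0 < c' -> (@lebesgue_measure R).-integrable setT
   (EFin \o (fun x => expR (- x ^+ 2 / c'))) by exact: gauss_integrable.
have dom (f h : R -> R) : continuous f -> (forall x, `|f x| <= h x) ->
   (@lebesgue_measure R).-integrable setT (EFin \o h) -> (@lebesgue_measure R).-integrable setT (EFin \o f).
  move=> cf fh ih; apply: le_integrable ih => //.
    by apply/measurable_EFinP; exact: continuous_measurable_fun.
  by move=> x _; rewrite lee_fin (le_trans (fh x))// ler_norm.
have icos s : (@lebesgue_measure R).-integrable setT (EFin \o (fun x => cos (s * x + p) * g x)).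
  apply: (dom _ g) => //; last exact: intg.
    by move=> x; apply: cvgM; [exact: ccos|exact: cg].
  by move=> x; rewrite normrM [X in _ * X]ger0_norm ?expR_ge0// ler_piMl ?expR_ge0// cos_max.
pose G x := (1 + 2 * c) * expR (- x ^+ 2 / (2 * c)).
have iG : (@lebesgue_measure R).-integrable setT (EFin \o G).
  have := integrableZl measurableT (1 + 2 * c) (intg _ (_ : 0 < 2 * c)).
  by apply; rewrite mulr_gt0.
have bsin s x : `|x * sin (s * x + p) * g x| <= G x.
  rewrite (le_trans _ (normr_gauss_le x c0))// normrM [X in _ * X]ger0_norm ?expR_ge0//.
  by rewrite ler_wpM2r ?expR_ge0// normrM ler_piMr ?sin_max.
have isin s : (@lebesgue_measure R).-integrable setT (EFin \o (fun x => x * sin (s * x + p) * g x)).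
  apply: (dom _ G) => //.
  move=> x; apply: cvgM; last exact: cg.
  by apply: cvgM; [exact: cvg_id|exact: csin].
(* Integration by parts: the derivative of [sin (s * x + p) * g x] has integral 0. *)
have stein s : (\int[@lebesgue_measure R]_x (x * sin (s * x + p) * g x))%R = c / 2 * s * psi s.
  have h := @integral_derivative0 R (fun x => sin (s * x + p) * g x)
    (fun x => s * (cos (s * x + p) * g x) - 2 / c * (x * sin (s * x + p) * g x)).
  have [y1 y2] := cvg_sin_gauss0 s p c0.
  have i1 := integrableZl measurableT s (icos s).
  have i2 := integrableZl measurableT (2 / c) (isin s).
  have /(congr1 fine) : (\int[@lebesgue_measure R]_x
    ((s * (cos (s * x + p) * g x) - 2 / c * (x * sin (s * x + p) * g x))%:E) = 0)%E.
    apply: h => //.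
    - exact: (integrableB measurableT i1 i2).
    - move=> x; apply: cvgB; apply: cvgM; [exact: cvg_cst| |exact: cvg_cst|].
        by apply: cvgM; [exact: ccos|exact: cg].
      apply: cvgM; last exact: cg.
      by apply: cvgM; [exact: cvg_id|exact: csin].
    - by move=> x; exact: is_derive_sin_gauss.
  rewrite -[LHS]/(Rintegral _ _ _) RintegralB// RintegralZl// RintegralZl//.
  rewrite -/(psi s) /= => /eqP; rewrite subr_eq0 => /eqP e.
  rewrite -mulrA e; field; exact: lt0r_neq0.
have dpsi (s : R) : is_derive s 1 psi (- (c / 2 * s * psi s)).
  have I0 : `]s - 1, s + 1[%classic s by rewrite /= in_itv/= ltrBlDr ltrDl ltr01.
  have dd x y : derivable ((fun u v => cos (u * v + p) * g v)^~ y) x 1 by have [] := is_derive_cosM y (g y) p x.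
  have de x y : partial1of2 (fun u v => cos (u * v + p) * g v) x y = - (y * sin (x * y + p) * g y).
    by rewrite partial1of2E; have [_ ->] := is_derive_cosM y (g y) p x.
  have b x y : `]s - 1, s + 1[%classic x -> [set: R] y ->
     `|partial1of2 (fun u v => cos (u * v + p) * g v) x y| <= G y.
    by move=> _ _; rewrite de normrN.
  have G0 y : 0 <= G y by rewrite mulr_ge0 ?expR_ge0// addr_ge0// mulr_ge0// ltW.
  have ic x : `]s - 1, s + 1[%classic x -> (@lebesgue_measure R).-integrable setT (EFin \o (fun v => cos (x * v + p) * g v)).
    by move=> _; exact: icos.
  have d1 := @derivable_under_integral R _ _ (@lebesgue_measure R) (fun u v => cos (u * v + p) * g v)
    setT measurableT s _ _ I0 ic (fun x y _ _ => dd x y) G G0 iG b.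
  have d2 := @differentiation_under_integral R _ _ (@lebesgue_measure R) (fun u v => cos (u * v + p) * g v)
    setT measurableT s _ _ I0 ic (fun x y _ _ => dd x y) G G0 iG b.
  apply: DeriveDef => //.
  rewrite -derive1E d2 -stein.
  rewrite (_ : (fun y => _) = (fun y => - (y * sin (s * y + p) * g y))); last exact/funext.
  rewrite -[RHS]mulN1r -RintegralZl//.
  by apply: eq_Rintegral => y _; rewrite mulN1r.
have : psi t * expR (t ^+ 2 * c / 4) = psi 0 * expR (0 ^+ 2 * c / 4).
  apply: (@is_derive_0_is_cst R (fun t => psi t * expR (t ^+ 2 * c / 4))) => s.
  have k : is_derive s 1 (fun s : R => s ^+ 2 * c / 4) (s * c / 2).
    by apply: is_derive_eq; rewrite /GRing.scale/=; field.
  have k2 := @is_derive1_comp _ expR (fun s => s ^+ 2 * c / 4) _ _ _ (is_derive_expR (s ^+ 2 * c / 4)) k.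
  by apply: is_derive_eq; rewrite /GRing.scale/=; ring.
rewrite expr0n/= !mul0r expR0 mulr1 => e.
have k : cos p * (\int[@lebesgue_measure R]_x (expR (- x ^+ 2 / c)))%R = psi 0.
  rewrite -RintegralZl//; last exact: intg.
  by apply: eq_Rintegral => x _; rewrite mul0r add0r.
rewrite mulrAC k -e -[psi t * _ * _]mulrA -expRD -/(psi t) (_ : _ + _ = 0) ?expR0 ?mulr1//; ring.
Qed.

(** * Laws of random variables and moments of the normal law *)

Lemma integral_normal_prob (R : realType) (m s : R) (f : R -> \bar R) :
  measurable_fun setT f -> (forall x, 0 <= f x)%E ->
  (\int[normal_prob m s]_x f x =
   \int[@lebesgue_measure R]_x (f x * (normal_pdf m s x)%:E))%E.
Proof.
move=> mf f0.
rewrite -(Radon_Nikodym_SigmaFinite.change_of_variables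
  (normal_prob_dominates m s))//.
have iRN := Radon_Nikodym_SigmaFinite.f_integrable (normal_prob_dominates m s).
apply: ae_eq_integral => //.
- apply: emeasurable_funM => //; exact: measurable_int iRN.
- apply: emeasurable_funM => //; apply/measurable_EFinP.
  exact: measurable_normal_pdf.
(* The Radon-Nikodym derivative equals the density almost everywhere, since both have the same
   integral over every measurable set. *)
- apply: ae_eqe_mul2l; apply: integral_ae_eq => //.
  + by apply/measurable_EFinP; exact: measurable_normal_pdf.
  + move=> A _ mA; rewrite -Radon_Nikodym_SigmaFinite.f_integral//.
    exact: normal_prob_dominates.
Qed.

Section gaussian_law_integral.
Context (R : realType) (disp : measure_display) (Omega : measurableType disp).
Variables (P : probability Omega R) (X : Omega -> R) (m s : R).
Hypothesis mX : measurable_fun setT X.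
Hypothesis lawX : forall A : set R, measurable A ->
  P (X @^-1` A) = normal_prob m s A.

Lemma ge0_integral_law (f : R -> \bar R) :
  measurable_fun setT f -> (forall x, 0 <= f x)%E ->
  (\int[P]_w f (X w) =
   \int[@lebesgue_measure R]_x (f x * (normal_pdf m s x)%:E))%E.
Proof.
move=> mf f0; rewrite -integral_normal_prob//.
have mX' : @measurable_fun _ _ Omega (measurableTypeR R) setT X by exact: mX.
pose X' : {RV P >-> measurableTypeR R} := HB.pack (X : Omega -> measurableTypeR R)
  (@isMeasurableFun.Build _ _ Omega (measurableTypeR R) X mX').
have -> : (\int[normal_prob m s]_x f x = \int[distribution P X']_x f x)%E.
  apply: (@eq_measure_integral _ (measurableTypeR R) R setT (distribution P X') (normal_prob m s)) => A mA _.
  exact/esym/lawX.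
by rewrite ge0_integral_distribution.
Qed.

Lemma integral_law (f : R -> R) : measurable_fun setT f ->
  (\int[P]_w (f (X w))%:E =
   \int[@lebesgue_measure R]_x (f x * normal_pdf m s x)%:E)%E.
Proof.
move=> mf; rewrite integralE [RHS]integralE.
have mf' : measurable_fun setT (EFin \o f) by exact/measurable_EFinP.
congr (_ - _)%E.
- transitivity (\int[P]_w ((EFin \o f)^\+ (X w)))%E.
    by apply: eq_integral => w _; rewrite !funeposE.
  rewrite ge0_integral_law//; last exact: measurable_funepos.
  apply: eq_integral => x _; rewrite !funeposE/=.
  by rewrite maxe_pMl ?lee_fin ?normal_pdf_ge0// mul0e EFinM.
- transitivity (\int[P]_w ((EFin \o f)^\- (X w)))%E.
    by apply: eq_integral => w _; rewrite !funenegE.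
  rewrite ge0_integral_law//; last exact: measurable_funeneg.
  apply: eq_integral => x _; rewrite !funenegE/=.
  by rewrite maxe_pMl ?lee_fin ?normal_pdf_ge0// mul0e /= -EFinM mulNr.
Qed.

End gaussian_law_integral.

Lemma is_derive_normal_pdf (R : realType) (m s x : R) : s != 0 ->
  is_derive x 1 (normal_pdf m s) (- (x - m) / s ^+ 2 * normal_pdf m s x).
Proof.
move=> s0; rewrite normal_pdfE// /normal_fun.
have h : is_derive x 1 (fun x : R => - (x - m) ^+ 2 / (s ^+ 2 *+ 2)) (- (x - m) / s ^+ 2).
  by apply: is_derive_eq; rewrite /GRing.scale/=; field.
have h2 := @is_derive1_comp _ expR (fun x => - (x - m) ^+ 2 / (s ^+ 2 *+ 2)) _ _ _
  (is_derive_expR _) h.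
by apply: is_derive_eq; rewrite /GRing.scale/= /normal_fun; ring.
Qed.

Lemma sqr_expRN_le (R : realType) (y : R) : 0 <= y -> y * expR (- y) <= expR (- (y / 2)) * 2.
Proof.
move=> y0; have -> : - y = - (y / 2) - y / 2 by lra.
rewrite expRD mulrCA ler_wpM2l ?expR_ge0// expRN ler_pdivrMr ?expR_gt0//.
have := expR_ge1Dx (y / 2); lra.
Qed.

(** Half of the exponent pays for the quadratic factor. What is left is a multiple of the normal
    density of twice the variance, hence [Num.sqrt 2 * s], and that density is known to be
    integrable. *)
Lemma normal_pdf_moment_bound (R : realType) (m s x : R) : s != 0 ->
  (x - m) ^+ 2 * normal_pdf m s x <=
   4 * s ^+ 2 * Num.sqrt 2 * normal_pdf m (Num.sqrt 2 * s) x.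
Proof.
move=> s0; have r2 : Num.sqrt 2 != 0 :> R by rewrite gt_eqF// sqrtr_gt0.
have s20 : 0 < s ^+ 2 by rewrite exprn_even_gt0.
rewrite !normal_pdfE ?mulf_neq0// /normal_fun /normal_peak.
rewrite exprMn sqr_sqrtr//.
have -> : 2 * s ^+ 2 * pi *+ 2 = 2 * (s ^+ 2 * pi *+ 2) by ring.
rewrite [Num.sqrt (2 * _)]sqrtrM// invfM.
set p := (Num.sqrt _)^-1.
have p0 : 0 <= p by rewrite invr_ge0.
set y := (x - m) ^+ 2 / (s ^+ 2 *+ 2).
have y0 : 0 <= y by rewrite divr_ge0 ?sqr_ge0// mulrn_wge0// sqr_ge0.
have -> : - (x - m) ^+ 2 / (s ^+ 2 *+ 2) = - y by rewrite /y mulNr.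
have -> : - (x - m) ^+ 2 / (2 * s ^+ 2 *+ 2) = - (y / 2) by rewrite /y; field.
have -> : (x - m) ^+ 2 = y * (s ^+ 2 *+ 2) by rewrite /y; field.
have -> : 4 * s ^+ 2 * Num.sqrt 2 * ((Num.sqrt 2)^-1 * p * expR (- (y / 2))) =
  (2 * s ^+ 2 * p) * (expR (- (y / 2)) * 2) by field.
have -> : y * (s ^+ 2 *+ 2) * (p * expR (- y)) =
  (2 * s ^+ 2 * p) * (y * expR (- y)) by ring.
apply: ler_wpM2l; last exact: sqr_expRN_le.
by rewrite mulr_ge0// mulr_ge0// ltW.
Qed.

Lemma normal_pdf_moment1_bound (R : realType) (m s x : R) : s != 0 ->
  `|x - m| * normal_pdf m s x <= normal_pdf m s x +
   4 * s ^+ 2 * Num.sqrt 2 * normal_pdf m (Num.sqrt 2 * s) x.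
Proof.
move=> s0; have := normal_pdf_moment_bound m x s0.
have := normal_pdf_ge0 m s x; set p := normal_pdf m s x => p0.
have : `|x - m| <= 1 + (x - m) ^+ 2.
  rewrite -[(x - m) ^+ 2]real_normK ?num_real//.
  by have := sqr_ge0 (`|x - m| - 1); rewrite sqrrB1; nra.
by move=> /(ler_wpM2r p0); rewrite mulrDl mul1r => h1 h2; lra.
Qed.

Lemma cvg_dominated0 (R : realType) (F : set_system R) (FF : ProperFilter F)
  (f g : R -> R) : (forall x, `|f x| <= g x) -> g x @[x --> F] --> 0 ->
  f x @[x --> F] --> 0.
Proof.
move=> fg g0; apply: norm_cvg0; apply: squeeze_cvgr; [|exact: cvg_cst|exact: g0].
by apply: nearW => x; rewrite normr_ge0 fg.
Qed.

Lemma cvg_gauss_shift0 (R : realType) (m c : R) : 0 < c ->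
  (expR (- (x - m) ^+ 2 / c) @[x --> +oo] --> 0) /\
  (expR (- (x - m) ^+ 2 / c) @[x --> -oo] --> 0).
Proof.
move=> c0; have [h1 h2] := cvg_gauss0 c0; split.
  apply: (@cvg_comp _ _ _ (fun x => x - m) (fun x => expR (- x ^+ 2 / c))); last exact: h1.
  exact: cvg_addrr.
apply: (@cvg_comp _ _ _ (fun x => x - m) (fun x => expR (- x ^+ 2 / c))); last exact: h2.
exact: cvg_addrr_Ny.
Qed.

Lemma cvg_normal_pdf0 (R : realType) (m s : R) : s != 0 ->
  (normal_pdf m s x @[x --> +oo] --> 0) /\ (normal_pdf m s x @[x --> -oo] --> 0).
Proof.
move=> s0; have c0 : 0 < s ^+ 2 *+ 2 by rewrite pmulrn_lgt0 // exprn_even_gt0.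
have [h1 h2] := cvg_gauss_shift0 m c0.
rewrite normal_pdfE//; split; rewrite -[X in _ --> X](mulr0 (normal_peak s)).
  by apply: cvgM; [exact: cvg_cst|exact: h1].
by apply: cvgM; [exact: cvg_cst|exact: h2].
Qed.

Section normal_moments.
Context (R : realType) (m s : R).
Hypothesis s0 : s != 0.
Notation mu := (@lebesgue_measure R).
Let p := normal_pdf m s.
Let q := normal_pdf m (Num.sqrt 2 * s).
Let K := 4 * s ^+ 2 * Num.sqrt 2.

Let K0 : 0 <= K.
Proof. by apply: mulr_ge0 => //; apply: mulr_ge0 => //; exact: sqr_ge0. Qed.

Let r20 : Num.sqrt 2 * s != 0.
Proof. by rewrite mulf_neq0// gt_eqF// sqrtr_gt0. Qed.

Let continuous_p : continuous p. Proof. exact: continuous_normal_pdf. Qed.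

Let continuous_xm : continuous (fun x : R => x - m).
Proof. by move=> x; apply: cvgB; [exact: cvg_id|exact: cvg_cst]. Qed.

Let dominated (f h : R -> R) : continuous f -> (forall x, `|f x| <= h x) ->
  mu.-integrable setT (EFin \o h) -> mu.-integrable setT (EFin \o f).
Proof.
move=> cf fh ih; apply: le_integrable ih => //.
  by apply/measurable_EFinP; exact: continuous_measurable_fun.
by move=> x _; rewrite lee_fin (le_trans (fh x))// ler_norm.
Qed.

Let integrable_q : mu.-integrable setT (EFin \o (fun x => K * q x)).
Proof. exact: (integrableZl measurableT K (integrable_normal_pdf m _)). Qed.

Lemma normal_integrable2 : mu.-integrable setT (EFin \o (fun x => (x - m) ^+ 2 * p x)).
Proof.
apply: dominated integrable_q.
  move=> x; apply: cvgM; last exact: continuous_p.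
  by apply: cvgM; exact: continuous_xm.
move=> x; rewrite ger0_norm ?normal_pdf_moment_bound//.
by rewrite mulr_ge0 ?sqr_ge0// normal_pdf_ge0.
Qed.

Lemma normal_integrable1 : mu.-integrable setT (EFin \o (fun x => (x - m) * p x)).
Proof.
have i := integrableD measurableT (integrable_normal_pdf m s) integrable_q.
apply: dominated i.
  by move=> x; apply: cvgM; [exact: continuous_xm|exact: continuous_p].
move=> x; rewrite normrM (ger0_norm (normal_pdf_ge0 _ _ _)).
exact: normal_pdf_moment1_bound.
Qed.

(** The integrand is the derivative of [- s ^+ 2 * p x]. *)
Lemma normal_moment1 : (\int[mu]_x ((x - m) * p x)%:E = 0)%E.
Proof.
have [y1 y2] := cvg_normal_pdf0 m s0.
apply: (@integral_derivative0 R (fun x => - s ^+ 2 * p x) (fun x => (x - m) * p x)).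
- exact: normal_integrable1.
- by move=> x; apply: cvgM; [exact: continuous_xm|exact: continuous_p].
- move=> x; have h := is_derive_normal_pdf m x s0.
  by apply: is_derive_eq; rewrite /GRing.scale/= -/p; field.
- by rewrite -[X in _ --> X](mulr0 (- s ^+ 2)); apply: cvgM; [exact: cvg_cst|exact: y1].
- by rewrite -[X in _ --> X](mulr0 (- s ^+ 2)); apply: cvgM; [exact: cvg_cst|exact: y2].
Qed.

(** The derivative of [s ^+ 2 * ((x - m) * p x)] is [s ^+ 2 * p x - (x - m) ^+ 2 * p x], and [p] has
    mass 1. *)
Lemma normal_moment2 : (\int[mu]_x ((x - m) ^+ 2 * p x)%:E = (s ^+ 2)%:E)%E.
Proof.
have [y1 y2] := cvg_normal_pdf0 m s0.
have [z1 z2] := cvg_normal_pdf0 m r20.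
have i1 := integrableZl measurableT (s ^+ 2) (integrable_normal_pdf m s).
have h : (\int[mu]_x ((s ^+ 2 * p x - (x - m) ^+ 2 * p x)%:E) = 0)%E.
  apply: (@integral_derivative0 R (fun x => s ^+ 2 * ((x - m) * p x))
    (fun x => s ^+ 2 * p x - (x - m) ^+ 2 * p x)).
  - exact: (integrableB measurableT i1 normal_integrable2).
  - move=> x; apply: cvgB; apply: cvgM; try exact: continuous_p.
      exact: cvg_cst.
    by apply: cvgM; exact: continuous_xm.
  - move=> x; have h := is_derive_normal_pdf m x s0.
    by apply: is_derive_eq; rewrite /GRing.scale/= -/p; field.
  - rewrite -[X in _ --> X](mulr0 (s ^+ 2)); apply: cvgM; first exact: cvg_cst.
    apply: (@cvg_dominated0 _ _ _ _ (fun x => p x + K * q x)).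
      move=> x; rewrite normrM (ger0_norm (normal_pdf_ge0 _ _ _)).
      exact: normal_pdf_moment1_bound.
    rewrite -[X in _ --> X]addr0 -[X in _ + X](mulr0 K).
    by apply: cvgD => //; apply: cvgM; [exact: cvg_cst|exact: z1].
  - rewrite -[X in _ --> X](mulr0 (s ^+ 2)); apply: cvgM; first exact: cvg_cst.
    apply: (@cvg_dominated0 _ _ _ _ (fun x => p x + K * q x)).
      move=> x; rewrite normrM (ger0_norm (normal_pdf_ge0 _ _ _)).
      exact: normal_pdf_moment1_bound.
    rewrite -[X in _ --> X]addr0 -[X in _ + X](mulr0 K).
    by apply: cvgD => //; apply: cvgM; [exact: cvg_cst|exact: z2].
move: h; under eq_integral do rewrite EFinB.
rewrite integralB//=; last exact: normal_integrable2.
under [X in (X - _)%E]eq_integral do rewrite EFinM.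
rewrite integralZl//=; last exact: integrable_normal_pdf.
rewrite integral_normal_pdf mule1 => /eqP.
rewrite sube_eq//; first by rewrite add0e => /eqP.
Qed.

End normal_moments.

(** * Centered Gaussian variables *)

(* The parameter [v] is the variance; the mean is zero. *)
Definition centered_gaussian (R : realType) (disp : measure_display)
    (Omega : measurableType disp) (P : probability Omega R) (v : R)
    (X : Omega -> R) : Prop :=
  [/\ measurable_fun setT X, 0 <= v &
    forall A : set R, measurable A -> P (X @^-1` A) = gaussian_law 0 (Num.sqrt v) A].

Section dirac_law_integral.
Context (R : realType) (disp : measure_display) (Omega : measurableType disp).
Variables (P : probability Omega R) (X : Omega -> R) (m : R).
Hypothesis mX : measurable_fun setT X.
Hypothesis lawX : forall A : set R, measurable A -> P (X @^-1` A) = \d_m A.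

Lemma integral_law_dirac (f : R -> R) : measurable_fun setT f ->
  (\int[P]_w (f (X w))%:E = (f m)%:E)%E.
Proof.
move=> mf.
rewrite (ae_eq_integral (fun=> (f m)%:E))//.
- by rewrite integral_cst// [X in (_ * X)%E]probability_setT mule1.
- by apply/measurable_EFinP; exact: measurableT_comp.
- exists (X @^-1` (~` [set m])); split.
  + by rewrite -[_ @^-1` _]setTI; apply: mX => //; apply: measurableC.
  + have /lawX e : measurable (~` [set m]) by exact: measurableC.
    by apply: (etrans e); rewrite diracE memNset//=; apply.
  + by move=> w /= h e; apply: h => _; rewrite e.
Qed.

End dirac_law_integral.

Section gaussian_rv_moments.
Context (R : realType) (disp : measure_display) (Omega : measurableType disp).
Variables (P : probability Omega R) (X : Omega -> R).

Lemma gaussian_rv_moments (m s : R) : measurable_fun setT X ->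
  (forall A : set R, measurable A -> P (X @^-1` A) = gaussian_law m s A) ->
  [/\ P.-integrable setT (EFin \o (fun w => (X w - m) ^+ 2)),
   (\int[P]_w (X w - m)%:E = 0)%E &
   (\int[P]_w ((X w - m) ^+ 2)%:E = (s ^+ 2)%:E)%E].
Proof.
move=> mX lawX.
have mB : measurable_fun setT (fun x : R => x - m) by exact: measurable_funB.
have mS : measurable_fun setT (fun x : R => (x - m) ^+ 2) by exact: measurable_funX.
suff [h1 h2] : (\int[P]_w (X w - m)%:E = 0)%E /\
    (\int[P]_w ((X w - m) ^+ 2)%:E = (s ^+ 2)%:E)%E.
  split => //; apply/integrableP; split.
    by apply/measurable_EFinP; exact: (measurableT_comp mS).
  under eq_integral do rewrite /= ger0_norm ?sqr_ge0//.
  by rewrite h2 ltry.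
have [s0|s0] := eqVneq s 0.
  have lawX' A : measurable A -> P (X @^-1` A) = \d_m A.
    by move=> mA; rewrite lawX// /gaussian_law s0 eqxx.
  rewrite (@integral_law_dirac _ _ _ P X m _ _ (fun x => x - m))//.
  rewrite (@integral_law_dirac _ _ _ P X m _ _ (fun x => (x - m) ^+ 2))//.
  by rewrite subrr s0.
have lawX' A : measurable A -> P (X @^-1` A) = normal_prob m s A.
  by move=> mA; rewrite lawX// /gaussian_law (negbTE s0).
rewrite (@integral_law _ _ _ P X m s _ _ (fun x => x - m))//.
rewrite (@integral_law _ _ _ P X m s _ _ (fun x => (x - m) ^+ 2))//.
by rewrite normal_moment1// normal_moment2.
Qed.

Lemma sqr_integrable (a b : Omega -> R) :
  measurable_fun setT a -> measurable_fun setT b ->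
  P.-integrable setT (EFin \o (fun w => a w ^+ 2)) ->
  P.-integrable setT (EFin \o (fun w => b w ^+ 2)) ->
  P.-integrable setT (EFin \o (fun w => a w * b w)).
Proof.
move=> ma mb ia ib.
have := integrableD measurableT ia ib; apply: le_integrable => //.
  by apply/measurable_EFinP; exact: measurable_funM.
move=> w _ /=; rewrite lee_fin [leRHS]ger0_norm; last by rewrite addr_ge0// sqr_ge0.
have := sqr_ge0 (`|a w| - `|b w|); rewrite normrM sqrrB !real_normK ?num_real//.
have : 0 <= `|a w| * `|b w| by rewrite mulr_ge0.
by rewrite -mulr_natl; lra.
Qed.

Lemma integrable_cst (c : R) : P.-integrable setT (EFin \o (fun=> c)).
Proof.
exact: finite_measure_integrable_cst.
Qed.

Lemma gaussian_rv_sqr_integrable : gaussian_rv P X ->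
  P.-integrable setT (EFin \o (fun w => X w ^+ 2)).
Proof.
move=> [mX [m [s lawX]]].
have [i _ _] := gaussian_rv_moments mX lawX.
have mB : measurable_fun setT (fun w => X w - m) by exact: measurable_funB.
have i1 : P.-integrable setT (EFin \o (fun w => (X w - m) * m)).
  by apply: sqr_integrable => //; exact: integrable_cst.
have i2 := integrable_cst (m ^+ 2).
have := integrableD measurableT (integrableD measurableT i i2)
  (integrableZl measurableT 2 i1).
apply: eq_integrable => // w _ /=; rewrite -EFinM -!EFinD; congr EFin; ring.
Qed.

(** The parameters in [gaussian_rv] are existential. The first two moments determine [m] and
    [s ^+ 2], and the sign of [s] does not affect the law. *)
Lemma gaussian_rv_centered (v : R) : gaussian_rv P X ->
  (\int[P]_w (X w)%:E = 0)%E -> (\int[P]_w (X w ^+ 2)%:E = v%:E)%E ->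
  centered_gaussian P v X.
Proof.
move=> gX; have iX2 := gaussian_rv_sqr_integrable gX.
case: gX => [mX [m [s lawX]]] E0 Ev.
have [_ E1 E2] := gaussian_rv_moments mX lawX.
have iX : P.-integrable setT (EFin \o X).
  have := @sqr_integrable X (fun=> 1) mX (measurable_cst _) iX2 (integrable_cst _).
  by apply: eq_integrable => // w _ /=; rewrite mulr1.
have m0 : m = 0.
  move: E1; under eq_integral do rewrite EFinB.
  rewrite integralB//; last exact: integrable_cst.
  rewrite E0 integral_cst// [X in (_ * X)%E]probability_setT mule1 sub0e => /eqP.
  by rewrite oppe_eq0 => /eqP[].
have vs : v = s ^+ 2.
  move: E2; rewrite m0 (_ : (fun w => _) = (fun w => (X w ^+ 2)%:E)); last first.
    by apply/funext => w; rewrite subr0.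
  by rewrite Ev => -[].
split => //; first by rewrite vs sqr_ge0.
move=> A mA; rewrite (lawX A mA) m0 vs sqrtr_sqr /gaussian_law normr_eq0.
case: ifPn => [//|s0]; rewrite /normal_prob; apply: eq_integral => x _.
rewrite !normal_pdfE ?normr_eq0// /normal_peak /normal_fun.
by rewrite real_normK ?num_real.
Qed.

End gaussian_rv_moments.

Lemma bounded_integrable (R : realType) (disp : measure_display)
    (Omega : measurableType disp) (P : probability Omega R) (f : Omega -> R) (M : R) :
  measurable_fun setT f -> (forall w, `|f w| <= M) ->
  P.-integrable setT (EFin \o f).
Proof.
move=> mf fM; apply: (le_integrable measurableT _ _ (integrable_cst P M)).
  exact/measurable_EFinP.
by move=> w _ /=; rewrite lee_fin (le_trans (fM w))// ler_norm.
Qed.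

Lemma integral_prob_cst (R : realType) (disp : measure_display)
    (Omega : measurableType disp) (P : probability Omega R) (c : R) :
  (\int[P]_w (cst c%:E w) = c%:E)%E.
Proof. by rewrite integral_cst// [X in (_ * X)%E]probability_setT mule1. Qed.

Lemma probability_le_integral (R : realType) (disp : measure_display)
    (Omega : measurableType disp) (P : probability Omega R) (A : set Omega)
    (f : Omega -> R) : measurable A -> measurable_fun setT f ->
  (forall w, 0 <= f w) -> (forall w, A w -> 1 <= f w) ->
  (P A <= \int[P]_w (f w)%:E)%E.
Proof.
move=> mA mf f0 f1.
have <- : (\int[P]_w (\1_A w)%:E = P A)%E by rewrite integral_indic// setIT.
apply: ge0_le_integral => //.
- by apply/measurable_EFinP; exact: measurable_indic.
- exact/measurable_EFinP.
- move=> w _; rewrite lee_fin indicE; case: (boolP (w \in A)) => [|_]; last exact: f0.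
  by move=> /set_mem; exact: f1.
Qed.

Section centered_gaussian_integrals.
Context (R : realType) (disp : measure_display) (Omega : measurableType disp).
Variables (P : probability Omega R) (X : Omega -> R) (v : R).
Hypothesis gX : centered_gaussian P v X.

Lemma centered_gaussian_integral (f : R -> R) : measurable_fun setT f ->
  (\int[P]_w (f (X w))%:E =
   if (v == 0)%R then (f 0%R)%:E
   else \int[@lebesgue_measure R]_x (f x * normal_pdf 0 (Num.sqrt v) x)%:E)%E.
Proof.
move=> mf; have [mX v0 lawX] := gX.
have [e|vn0] := eqVneq v 0.
  apply: integral_law_dirac => // A mA.
  by rewrite lawX// e sqrtr0 /gaussian_law eqxx.
apply: integral_law => // A mA.
by rewrite lawX// /gaussian_law sqrtr_eq0 leNgt lt0r vn0 v0.
Qed.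

Lemma centered_gaussian_cos (t p : R) :
  (\int[P]_w (cos (t * X w + p))%:E = (cos p * expR (- t ^+ 2 * v / 2))%:E)%E.
Proof.
have [mX v0 _] := gX.
have mc : measurable_fun setT (fun x : R => cos (t * x + p)).
  apply: continuous_measurable_fun => x.
  apply: continuous_comp; last exact: continuous_cos.
  by apply: cvgD; [exact: mulrl_continuous|exact: cvg_cst].
rewrite (@centered_gaussian_integral (fun x => cos (t * x + p)))//.
case: eqP => [->|/eqP vn0]; first by rewrite !mulr0 !mul0r expR0 mulr1 add0r.
have vp : 0 < v by rewrite lt0r vn0.
have s0 : Num.sqrt v != 0 by rewrite gt_eqF// sqrtr_gt0.
have c0 : 0 < 2 * v by rewrite mulr_gt0.
have pdfE (x : R) : normal_pdf 0 (Num.sqrt v) x =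
    normal_peak (Num.sqrt v) * expR (- x ^+ 2 / (2 * v)).
  rewrite normal_pdfE// /normal_fun subr0 sqr_sqrtr//; congr (_ * expR (_ / _)).
  by rewrite mulr_natl.
have ig := gauss_integrable c0.
have icos : (@lebesgue_measure R).-integrable setT
    (EFin \o (fun x => cos (t * x + p) * expR (- x ^+ 2 / (2 * v)))).
  apply: le_integrable ig => //.
    apply/measurable_EFinP/measurable_funM => //.
    apply: continuous_measurable_fun => x.
    by have [/derivable1_diffP /differentiable_continuous] := is_derive_gauss (2 * v) x.
  move=> x _; rewrite lee_fin normrM [X in _ * X]ger0_norm ?expR_ge0//.
  by rewrite [leRHS]ger0_norm ?expR_ge0// ler_piMl ?expR_ge0// cos_max.
(* That the density has mass 1 fixes the integral of the Gaussian, so its value never has to be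
   computed. *)
have one : normal_peak (Num.sqrt v) *
   (\int[@lebesgue_measure R]_x (expR (- x ^+ 2 / (2 * v))))%R = 1.
  rewrite -RintegralZl//.
  apply: EFin_inj; rewrite -(integral_normal_pdf 0 (Num.sqrt v)).
  rewrite /Rintegral fineK; last first.
    by apply: integrable_fin_num => //; exact: (integrableZl measurableT _ ig).
  by apply: eq_integral => x _; rewrite pdfE.
transitivity (\int[@lebesgue_measure R]_x ((normal_peak (Num.sqrt v))%:E *
    (cos (t * x + p) * expR (- x ^+ 2 / (2 * v)))%:E))%E.
  by apply: eq_integral => x _; rewrite pdfE -EFinM mulrCA.
rewrite integralZl//.
rewrite -[X in (_ * X)%E]fineK; last exact: integrable_fin_num.
rewrite -[fine _]/(Rintegral _ _ _) Rintegral_cos_gauss// -EFinM; congr EFin.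
by rewrite mulrCA one mulr1; congr (_ * expR _); field.
Qed.

(** Completing the square, the kernel of width [e] times the density of variance [v] is a constant
    [k] times the normal density of mean [m] and variance [w], which has mass 1. *)
Lemma centered_gaussian_kernel (e x : R) : 0 < e ->
  (\int[P]_w (expR (- (X w - x) ^+ 2 / (e ^+ 2 *+ 2)))%:E =
   (e / Num.sqrt (e ^+ 2 + v) * expR (- x ^+ 2 / ((e ^+ 2 + v) *+ 2)))%:E)%E.
Proof.
have [mX v0 _] := gX; move=> e0.
rewrite (@centered_gaussian_integral (fun y => expR (- (y - x) ^+ 2 / (e ^+ 2 *+ 2))));
  last exact: measurable_normal_fun.
case: eqP => [->|/eqP vn0].
  by rewrite addr0 sqrtr_sqr gtr0_norm// divff ?gt_eqF// mul1r sub0r sqrrN.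
have vp : 0 < v by rewrite lt0r vn0.
have e20 : 0 < e ^+ 2 by rewrite exprn_gt0.
have ev : 0 < e ^+ 2 + v by rewrite addr_gt0.
have s0 : Num.sqrt v != 0 by rewrite gt_eqF// sqrtr_gt0.
pose w := e ^+ 2 * v / (e ^+ 2 + v).
have w0 : 0 < w by rewrite divr_gt0// mulr_gt0.
have sw0 : Num.sqrt w != 0 by rewrite gt_eqF// sqrtr_gt0.
pose m := x * v / (e ^+ 2 + v).
pose k := e / Num.sqrt (e ^+ 2 + v) * expR (- x ^+ 2 / ((e ^+ 2 + v) *+ 2)).
have pk : normal_peak (Num.sqrt v) = e / Num.sqrt (e ^+ 2 + v) * normal_peak (Num.sqrt w).
  rewrite /normal_peak !sqr_sqrtr ?ltW//.
  have -> : w * pi *+ 2 = (e ^+ 2 / (e ^+ 2 + v)) * (v * pi *+ 2).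
    by rewrite /w; field; rewrite gt_eqF.
  rewrite [Num.sqrt (_ / _ * _)]sqrtrM ?divr_ge0 ?ltW// sqrtrM ?ltW// sqrtrV ?ltW//.
  rewrite sqrtr_sqr gtr0_norm// invfM mulrA divff ?mul1r//.
  by rewrite mulf_neq0 ?gt_eqF// invr_gt0 sqrtr_gt0.
transitivity (\int[@lebesgue_measure R]_y (k%:E * (normal_pdf m (Num.sqrt w) y)%:E))%E.
  apply: eq_integral => y _; rewrite -EFinM; congr EFin.
  rewrite !normal_pdfE// pk /k mulrACA mulrC -!mulrA; congr (_ * _).
  rewrite mulrCA [RHS]mulrCA; congr (_ * _); congr (_ * _).
  rewrite /normal_fun -!expRD !sqr_sqrtr ?ltW//; congr expR.
  by rewrite /w /m; field; rewrite !gt_eqF.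
rewrite integralZl//; last exact: integrable_normal_pdf.
by rewrite integral_normal_pdf mule1.
Qed.
End centered_gaussian_integrals.

(** * Factorisation of kernels of uncorrelated Gaussian variables *)

Section kernel_factorization.
Context (R : realType) (disp : measure_display) (Omega : measurableType disp).
Variables (P : probability Omega R).

Lemma measurable_cosZ (Y : Omega -> R) (n : R) : measurable_fun setT Y ->
  measurable_fun setT (fun w => cos (n * Y w)).
Proof.
move=> mY; apply: (measurableT_comp (f := cos)).
  by apply: continuous_measurable_fun; exact: continuous_cos.
exact: measurable_funM.
Qed.

Lemma measurable_gaussK (Y : Omega -> R) : measurable_fun setT Y ->
  measurable_fun setT (fun w => expR (- Y w ^+ 2 / 2)).
Proof.
move=> mY; apply: measurableT_comp => //; apply: measurable_funM => //.
by apply: measurableT_comp => //; exact: measurable_funX.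
Qed.

Let gam : probability (measurableTypeR R) R := normal_prob 0 1.

(** A standard normal frequency averages cosines to the Gaussian kernel. The summand 1 keeps the
    integrand nonnegative, as Tonelli's theorem asks in [kernel_of_cos]. *)
Lemma normal_cos (z : R) :
  (\int[gam]_n (1 + cos (n * z))%:E = (1 + expR (- z ^+ 2 / 2))%:E)%E.
Proof.
have gX : @centered_gaussian R _ (measurableTypeR R) gam 1 id.
  split => // A mA; rewrite sqrtr1 /gaussian_law oner_eq0 //.
have := centered_gaussian_cos gX z 0.
rewrite cos0 mul1r mulr1 => h.
have mc : measurable_fun setT (fun n : measurableTypeR R => cos (n * z)).
  have : measurable_fun setT (fun x : R => cos (x * z)).
    apply: continuous_measurable_fun => x.
    by apply: continuous_comp; [exact: mulrr_continuous|exact: continuous_cos].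
  exact.
under eq_integral do rewrite EFinD.
rewrite integralD//; last 2 first.
- exact: (integrable_cst gam 1).
- apply: (@bounded_integrable R _ (measurableTypeR R) gam (fun n => cos (n * z)) 1) => // n.
  exact: cos_max.
rewrite (@integral_prob_cst R _ (measurableTypeR R) gam 1) EFinD; congr (_ + _)%E.
by rewrite -h; apply: eq_integral => n _; rewrite addr0 mulrC.
Qed.

(* Fourier inversion of the Gaussian kernel in the variable [Y], by Tonelli. *)
Lemma kernel_of_cos (h Y : Omega -> R) :
  measurable_fun setT h -> measurable_fun setT Y -> (forall w, 0 <= h w) ->
  (forall n : R, \int[P]_w (h w * (1 + cos (n * Y w)))%:E =
     (\int[P]_w (h w)%:E) * (\int[P]_w (1 + cos (n * Y w))%:E))%E ->
  (\int[P]_w (h w * (1 + expR (- Y w ^+ 2 / 2)))%:E =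
     (\int[P]_w (h w)%:E) * (\int[P]_w (1 + expR (- Y w ^+ 2 / 2))%:E))%E.
Proof.
move=> mh mY h0 hn.
have c0 (x : R) : 0 <= 1 + cos x by rewrite -lerBlDl sub0r cos_geN1.
pose f (z : Omega * measurableTypeR R) := (1 + cos (z.2 * Y z.1))%:E.
pose fh (z : Omega * measurableTypeR R) := (h z.1 * (1 + cos (z.2 * Y z.1)))%:E.
have mc : measurable_fun setT (fun z : Omega * measurableTypeR R => 1 + cos (z.2 * Y z.1)).
  apply: measurable_funD => //; apply: (measurableT_comp (f := cos)).
    by apply: continuous_measurable_fun; exact: continuous_cos.
  apply: measurable_funM; first exact: measurable_snd.
  exact: (measurableT_comp mY).
have mf : measurable_fun setT f by exact/measurable_EFinP.
have mfh : measurable_fun setT fh.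
  by apply/measurable_EFinP/measurable_funM => //; exact: (measurableT_comp mh).
have e1 := @fubini_tonelli _ _ _ _ _ P gam f mf (fun z => c0 _).
have e2 := @fubini_tonelli _ _ _ _ _ P gam fh mfh (fun z => mulr_ge0 (h0 _) (c0 _)).
transitivity (\int[P]_w \int[gam]_n fh (w, n))%E.
  apply: eq_integral => w _; rewrite /fh/= EFinM -normal_cos -ge0_integralZl//.
  - apply/measurable_EFinP; exact: (measurableT_comp mc (measurable_pair1 _)).
  - by rewrite lee_fin.
rewrite e2; transitivity (\int[gam]_n ((\int[P]_w (h w)%:E) * \int[P]_w f (w, n)))%E.
  by apply: eq_integral => n _; rewrite -hn.
rewrite ge0_integralZl//.
- rewrite -e1; congr (_ * _)%E; apply: eq_integral => w _. exact: (normal_cos (Y w)).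
- exact: (@measurable_fun_fubini_tonelli_G _ _ _ _ _ P f mf (fun z => c0 _)).
- by move=> n _; apply: integral_ge0 => w _; rewrite lee_fin.
- by apply: integral_ge0 => w _; rewrite lee_fin.
Qed.

End kernel_factorization.

Section uncorrelated_gaussians.
Context (R : realType) (disp : measure_display) (Omega : measurableType disp).
Variables (P : probability Omega R) (U V : Omega -> R) (a b : R).
Hypothesis gUV : forall s t : R,
  centered_gaussian P (s ^+ 2 * a + t ^+ 2 * b) (fun w => s * U w + t * V w).

Let gU : centered_gaussian P a U.
Proof.
have := gUV 1 0; rewrite expr1n mul1r expr0n mul0r addr0.
by under eq_fun do rewrite mul1r mul0r addr0.
Qed.

Let gV : centered_gaussian P b V.
Proof.
have := gUV 0 1; rewrite expr1n mul1r expr0n mul0r add0r.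
by under eq_fun do rewrite mul1r mul0r add0r.
Qed.

Let mU : measurable_fun setT U. Proof. by case: gU. Qed.
Let mV : measurable_fun setT V. Proof. by case: gV. Qed.

(** The hypothesis [gUV] says that [U] and [V] are jointly Gaussian and uncorrelated. A product of
    cosines is half a sum of cosines of [s * U + t * V] and [s * U - t * V], whose laws it
    provides. *)
Lemma integral_cos_cos (s p t q : R) :
  (\int[P]_w (cos (s * U w + p) * cos (t * V w + q))%:E =
   (cos p * expR (- s ^+ 2 * a / 2) * (cos q * expR (- t ^+ 2 * b / 2)))%:E)%E.
Proof.
have h1 := centered_gaussian_cos (gUV s t) 1 (p + q).
have h2 := centered_gaussian_cos (gUV s (- t)) 1 (p - q).
have mUV s' t' p' : measurable_fun setT (fun w => cos (1 * (s' * U w + t' * V w) + p')).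
  apply: (measurableT_comp (f := cos)).
    by apply: continuous_measurable_fun; exact: continuous_cos.
  apply: measurable_funD => //; apply: measurable_funM => //.
  by apply: measurable_funD; exact: measurable_funM.
have i1 : P.-integrable setT (EFin \o (fun w => cos (1 * (s * U w + t * V w) + (p + q)))).
  by apply: (@bounded_integrable _ _ _ _ _ 1) => // w; exact: cos_max.
have i2 : P.-integrable setT (EFin \o (fun w => cos (1 * (s * U w + (- t) * V w) + (p - q)))).
  by apply: (@bounded_integrable _ _ _ _ _ 1) => // w; exact: cos_max.
transitivity (\int[P]_w ((2^-1)%:E * ((cos (1 * (s * U w + t * V w) + (p + q)))%:E +
    (cos (1 * (s * U w + (- t) * V w) + (p - q)))%:E)))%E.
  apply: eq_integral => w _; rewrite -EFinD -EFinM; congr EFin.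
  have -> : 1 * (s * U w + t * V w) + (p + q) = (s * U w + p) + (t * V w + q) by ring.
  have -> : 1 * (s * U w + - t * V w) + (p - q) = (s * U w + p) - (t * V w + q) by ring.
  move: (s * U w + p) (t * V w + q) => A B.
  by rewrite cosD cosB; field.
rewrite integralZl//; last exact: integrableD.
rewrite integralD// h1 h2 -EFinD -EFinM; congr EFin.
rewrite cosD cosB !sqrrN !expr1n.
have -> : - 1 * (s ^+ 2 * a + t ^+ 2 * b) / 2 = (- s ^+ 2 * a / 2) + (- t ^+ 2 * b / 2).
  by field.
by rewrite expRD; field.
Qed.

Lemma integral_1cos_1cos (s p t q : R) :
  (\int[P]_w ((1 + cos (s * U w + p)) * (1 + cos (t * V w + q)))%:E =
   (\int[P]_w (1 + cos (s * U w + p))%:E) * (\int[P]_w (1 + cos (t * V w + q))%:E))%E.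
Proof.
have mc (Y : Omega -> R) s' p' : measurable_fun setT Y ->
    measurable_fun setT (fun w => cos (s' * Y w + p')).
  move=> mY; apply: (measurableT_comp (f := cos)).
    by apply: continuous_measurable_fun; exact: continuous_cos.
  by apply: measurable_funD => //; exact: measurable_funM.
have i1 (Y : Omega -> R) s' p' : measurable_fun setT Y ->
    P.-integrable setT (EFin \o (fun w => cos (s' * Y w + p'))).
  by move=> mY; apply: (@bounded_integrable _ _ _ _ _ 1) => // [|w];
    [exact: mc|exact: cos_max].
have i2 : P.-integrable setT (EFin \o (fun w => cos (s * U w + p) * cos (t * V w + q))).
  apply: (@bounded_integrable _ _ _ _ _ 1) => [|w].
    by apply: measurable_funM; exact: mc.
  by rewrite normrM mulr_ile1// cos_max.
have E1 (Y : Omega -> R) s' p' c : centered_gaussian P c Y ->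
    (\int[P]_w (1 + cos (s' * Y w + p'))%:E =
     (1 + cos p' * expR (- s' ^+ 2 * c / 2))%:E)%E.
  move=> gY; have mY : measurable_fun setT Y by case: gY.
  under eq_integral do rewrite EFinD.
  rewrite integralD//; [|exact: integrable_cst|exact: i1].
  by rewrite integral_prob_cst (centered_gaussian_cos gY).
rewrite !(E1 _ _ _ _ gU) !(E1 _ _ _ _ gV).
transitivity (\int[P]_w ((1 + cos (s * U w + p))%:E +
    ((cos (t * V w + q))%:E + (cos (s * U w + p) * cos (t * V w + q))%:E)))%E.
  by apply: eq_integral => w _; rewrite -!EFinD; congr EFin; ring.
have i3 : P.-integrable setT (EFin \o (fun w => 1 + cos (s * U w + p))).
  have := integrableD measurableT (integrable_cst P 1) (i1 _ s p mU).
  by apply: eq_integrable.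
rewrite integralD//; last by apply: integrableD => //; exact: i1.
rewrite integralD//; last exact: i1.
rewrite (E1 _ _ _ _ gU) (centered_gaussian_cos gV) integral_cos_cos.
by rewrite -!EFinD -EFinM; congr EFin; ring.
Qed.

(** Cosines are replaced by kernels one variable at a time, first in [V], then in [U]. The summands
    1 disappear at the end: both sides expand, and the constant and linear terms cancel. *)
Lemma integral_kernel_kernel (e x y : R) : 0 < e ->
  (\int[P]_w (expR (- (U w - x) ^+ 2 / (e ^+ 2 *+ 2)) *
              expR (- (V w - y) ^+ 2 / (e ^+ 2 *+ 2)))%:E =
   (e / Num.sqrt (e ^+ 2 + a) * expR (- x ^+ 2 / ((e ^+ 2 + a) *+ 2)) *
   (e / Num.sqrt (e ^+ 2 + b) * expR (- y ^+ 2 / ((e ^+ 2 + b) *+ 2))))%:E)%E.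
Proof.
move=> e0.
pose k (Y : Omega -> R) z w := expR (- (Y w - z) ^+ 2 / (e ^+ 2 *+ 2)).
pose n (Y : Omega -> R) z w := (Y w - z) / e.
have kn Y z w : k Y z w = expR (- n Y z w ^+ 2 / 2).
  by congr expR; rewrite /n; field; rewrite gt_eqF.
have k0 Y z w : 0 <= k Y z w by exact: expR_ge0.
have k1 Y z w : `|k Y z w| <= 1.
  rewrite ger0_norm// -[leRHS]expR0 ler_expR mulNr oppr_le0 divr_ge0 ?sqr_ge0//.
  by rewrite mulrn_wge0// sqr_ge0.
have mn Y z : measurable_fun setT Y -> measurable_fun setT (n Y z).
  by move=> mY; apply: measurable_funM => //; exact: measurable_funB.
have mk Y z : measurable_fun setT Y -> measurable_fun setT (k Y z).
  move=> mY; rewrite (_ : k Y z = fun w => expR (- n Y z w ^+ 2 / 2)).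
    by apply: measurable_gaussK; exact: mn.
  by apply/funext => w; rewrite kn.
have mc (Y : Omega -> R) z s : measurable_fun setT Y ->
    measurable_fun setT (fun w => 1 + cos (s * n Y z w)).
  by move=> mY; apply: measurable_funD => //; apply: measurable_cosZ; exact: mn.
have nE Y z s w : s * n Y z w = s / e * Y w + (- (s / e * z)).
  by rewrite /n; field; rewrite gt_eqF.
have c0 (r : R) : 0 <= 1 + cos r by rewrite -lerBlDl sub0r cos_geN1.
have step1 (s t : R) : (\int[P]_w ((1 + cos (s * n U x w)) * (1 + cos (t * n V y w)))%:E =
   (\int[P]_w (1 + cos (s * n U x w))%:E) * (\int[P]_w (1 + cos (t * n V y w))%:E))%E.
  under eq_integral do rewrite !nE.
  under [X in (_ = X * _)%E]eq_integral do rewrite !nE.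
  under [X in (_ = _ * X)%E]eq_integral do rewrite !nE.
  exact: integral_1cos_1cos.
have step2 (s : R) : (\int[P]_w ((1 + cos (s * n U x w)) * (1 + k V y w))%:E =
   (\int[P]_w (1 + cos (s * n U x w))%:E) * (\int[P]_w (1 + k V y w)%:E))%E.
  have := @kernel_of_cos _ _ _ P (fun w => 1 + cos (s * n U x w)) (n V y)
    (mc _ _ _ mU) (mn _ _ mV) (fun w => c0 _) (step1 s).
  by under eq_integral do rewrite -kn; under [X in (_ = _ * X)%E -> _]eq_integral do rewrite -kn.
have step3 : (\int[P]_w ((1 + k U x w) * (1 + k V y w))%:E =
   (\int[P]_w (1 + k U x w)%:E) * (\int[P]_w (1 + k V y w)%:E))%E.
  have m1k : measurable_fun setT (fun w => 1 + k V y w).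
    by apply: measurable_funD => //; exact: mk.
  have := @kernel_of_cos _ _ _ P (fun w => 1 + k V y w) (n U x) m1k (mn _ _ mU)
    (fun w => addr_ge0 ler01 (k0 _ _ _)).
  rewrite [X in (_ -> _ = X)%E -> _]muleC.
  under [X in (_ -> X = _)%E -> _]eq_integral do rewrite -kn mulrC.
  under [X in (_ -> _ = X * _)%E -> _]eq_integral do rewrite -kn.
  apply => s; rewrite muleC -step2; apply: eq_integral => w _; by rewrite mulrC.
have i1 Y z : measurable_fun setT Y -> P.-integrable setT (EFin \o k Y z).
  by move=> mY; apply: (@bounded_integrable _ _ _ _ _ 1) => //; exact: mk.
have i2 : P.-integrable setT (EFin \o (fun w => k U x w * k V y w)).
  apply: (@bounded_integrable _ _ _ _ _ 1) => [|w].
    by apply: measurable_funM; exact: mk.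
  by rewrite normrM mulr_ile1.
have E1 Y z c : centered_gaussian P c Y -> (\int[P]_w (1 + k Y z w)%:E =
   (1 + e / Num.sqrt (e ^+ 2 + c) * expR (- z ^+ 2 / ((e ^+ 2 + c) *+ 2)))%:E)%E.
  move=> gY; have mY : measurable_fun setT Y by case: gY.
  under eq_integral do rewrite EFinD.
  rewrite integralD//; [|exact: integrable_cst|exact: i1].
  by rewrite integral_prob_cst (centered_gaussian_kernel gY).
move: step3; rewrite (E1 _ _ _ gU) (E1 _ _ _ gV).
set A := e / _ * _; set B := e / Num.sqrt (e ^+ 2 + b) * _.
have -> : (\int[P]_w ((1 + k U x w) * (1 + k V y w))%:E =
  (1 + A + B)%:E + \int[P]_w (k U x w * k V y w)%:E)%E.
  transitivity (\int[P]_w ((1 + k U x w)%:E +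
    ((k V y w)%:E + (k U x w * k V y w)%:E)))%E.
    by apply: eq_integral => w _; rewrite -!EFinD; congr EFin; ring.
  have i3 : P.-integrable setT (EFin \o (fun w => 1 + k U x w)).
    have := integrableD measurableT (integrable_cst P 1) (i1 _ x mU).
    by apply: eq_integrable.
  rewrite integralD//; last by apply: integrableD => //; exact: i1.
  rewrite integralD//; last exact: i1.
  by rewrite (E1 _ _ _ gU) (centered_gaussian_kernel gV)// addeA EFinD.
have /fineK <- : (\int[P]_w (k U x w * k V y w)%:E)%E \is a fin_num.
  exact: (integrable_fin_num measurableT i2).
rewrite -EFinD -EFinM => -[h]; congr EFin.
by move: h; set I := fine _; lra.
Qed.

End uncorrelated_gaussians.

(** * Probabilities of windows and tails *)

Section gaussian_events.
Context (R : realType) (disp : measure_display) (Omega : measurableType disp).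
Variables (P : probability Omega R).

Lemma measurable_near_event (X : Omega -> R) (x e : R) : measurable_fun setT X ->
  measurable [set w | `|X w - x| <= e].
Proof.
move=> mX; have mY : measurable_fun setT (fun w => `|X w - x|).
  by apply: measurableT_comp => //; exact: measurable_funB.
have := mY measurableT `]-oo, e]%classic (measurable_itv _).
by rewrite setTI; congr measurable; apply/seteqP; split => w /=; rewrite in_itv.
Qed.

Lemma measurable_far_event (X : Omega -> R) (u : R) : measurable_fun setT X ->
  measurable [set w | u < `|X w|].
Proof.
move=> mX; have mY : measurable_fun setT (fun w => `|X w|).
  exact: measurableT_comp.
have := mY measurableT `]u, +oo[%classic (measurable_itv _).
by rewrite setTI; congr measurable; apply/seteqP; split => w /=; rewrite in_itv/= andbT.
Qed.

Lemma measurable_far (u : R) : measurable [set y : R | u < `|y|].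
Proof.
have := @normr_measurable R setT measurableT `]u, +oo[%classic (measurable_itv _).
by rewrite setTI; congr measurable; apply/seteqP; split => w /=; rewrite in_itv/= andbT.
Qed.

Lemma kernel_ge (z e : R) : 0 < e -> `|z| <= e ->
  expR (- (1 / 2)) <= expR (- z ^+ 2 / (e ^+ 2 *+ 2)).
Proof.
move=> e0 ze; rewrite ler_expR mulNr lerN2 ler_pdivrMr; last first.
  by rewrite pmulrn_lgt0// exprn_gt0.
rewrite (_ : 1 / 2 * (e ^+ 2 *+ 2) = e ^+ 2); last by field.
by rewrite -[z ^+ 2]real_normK ?num_real// lerXn2r ?nnegrE// ltW.
Qed.

(** The indicator of the window is at most [expR (1 / 2)] times the kernel of width [e], whose mean
    is explicit; and [expR (1 / 2) <= 2]. *)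
Lemma near_event_le (X : Omega -> R) (v x e : R) : centered_gaussian P v X ->
  0 < v -> 0 < e ->
  (P [set w | (`|X w - x| <= e)%R] <= (2 * e / Num.sqrt v)%:E)%E.
Proof.
move=> gX v0 e0; have [mX _ _] := gX.
pose k w := expR (- (X w - x) ^+ 2 / (e ^+ 2 *+ 2)).
have mk : measurable_fun setT k.
  by apply: measurableT_comp (measurable_normal_fun x e) mX.
have := @probability_le_integral R _ _ P [set w | `|X w - x| <= e]
  (fun w => expR (1 / 2) * k w) (measurable_near_event _ _ mX) _ _ _.
move=> /(_ (measurable_funM (measurable_cst _) mk)) /(_ (fun w => mulr_ge0 (expR_ge0 _) (expR_ge0 _))).
have h w : `|X w - x| <= e -> 1 <= expR (1 / 2) * k w.
  move=> /(kernel_ge e0) /(ler_wpM2l (expR_ge0 (1 / 2))).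
  by rewrite -expRD subrr expR0.
move=> /(_ h) {h} /le_trans; apply.
under eq_integral do rewrite EFinM.
rewrite ge0_integralZl//; first last.
- by move=> w _; rewrite lee_fin expR_ge0.
- exact/measurable_EFinP.
rewrite (centered_gaussian_kernel gX)// -EFinM lee_fin.
have h1 : expR (1 / 2) <= 2 :> R.
  have := expR_ge1Dx (- (1 / 2) : R); rewrite expRN.
  have := expR_gt0 (1 / 2 : R); set E := expR _ => E0.
  rewrite -[X in X <= _ -> _]/(1 - 1 / 2).
  have -> : 1 - 1 / 2 = 2^-1 :> R by field.
  by rewrite lef_pV2 ?posrE.
have sv : 0 < Num.sqrt v by rewrite sqrtr_gt0.
have h2 : e / Num.sqrt (e ^+ 2 + v) <= e / Num.sqrt v.
  rewrite ler_pM2l// lef_pV2 ?posrE ?sqrtr_gt0 ?addr_gt0 ?exprn_gt0//.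
  by rewrite ler_sqrt ?lerDr ?sqr_ge0// addr_ge0 ?sqr_ge0// ltW.
have h3 : expR (- x ^+ 2 / ((e ^+ 2 + v) *+ 2)) <= 1.
  rewrite -[leRHS]expR0 ler_expR mulNr oppr_le0 divr_ge0 ?sqr_ge0//.
  by rewrite mulrn_wge0// addr_ge0 ?sqr_ge0// ltW.
have h4 : 0 <= e / Num.sqrt (e ^+ 2 + v) by rewrite divr_ge0 ?sqrtr_ge0// ltW.
rewrite -[leRHS]mulrA; apply: ler_pM => //.
  by rewrite mulr_ge0 ?expR_ge0.
by apply: le_trans h2; rewrite ler_piMr.
Qed.

(** Each of the two indicators costs a factor [expR (1 / 2)], hence [expR 1]. *)
Lemma pair_event_le (U V : Omega -> R) (a b x y e : R) : 0 < e ->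
  (forall s t : R, centered_gaussian P (s ^+ 2 * a + t ^+ 2 * b)
     (fun w => s * U w + t * V w)) ->
  (P ([set w | (`|U w - x| <= e)%R] `&` [set w | (`|V w - y| <= e)%R]) <=
   (expR 1 * (e / Num.sqrt (e ^+ 2 + a) * expR (- x ^+ 2 / ((e ^+ 2 + a) *+ 2)) *
   (e / Num.sqrt (e ^+ 2 + b) * expR (- y ^+ 2 / ((e ^+ 2 + b) *+ 2)))))%:E)%E.
Proof.
move=> e0 gUV.
have mU : measurable_fun setT U.
  by have [+ _ _] := gUV 1 0; under eq_fun do rewrite mul1r mul0r addr0.
have mV : measurable_fun setT V.
  by have [+ _ _] := gUV 0 1; under eq_fun do rewrite mul1r mul0r add0r.
pose k (Y : Omega -> R) z w := expR (- (Y w - z) ^+ 2 / (e ^+ 2 *+ 2)).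
have mk Y z : measurable_fun setT Y -> measurable_fun setT (k Y z).
  by move=> mY; apply: measurableT_comp (measurable_normal_fun z e) mY.
have mA := measurableI _ _ (measurable_near_event x e mU) (measurable_near_event y e mV).
have mf : measurable_fun setT (fun w => expR 1 * (k U x w * k V y w)).
  by apply: measurable_funM => //; apply: measurable_funM; exact: mk.
have f0 w : 0 <= expR 1 * (k U x w * k V y w) by rewrite !mulr_ge0 ?expR_ge0.
apply: le_trans (probability_le_integral P mA mf f0 _) _.
  move=> w [/= /(kernel_ge e0) h1 /(kernel_ge e0) h2].
  have := ler_pM (expR_ge0 _) (expR_ge0 _) h1 h2.
  move=> /(ler_wpM2l (expR_ge0 1)); rewrite -!expRD.
  by rewrite (_ : 1 + _ = 0) ?expR0//; field.
under eq_integral do rewrite EFinM.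
rewrite ge0_integralZl//; first last.
- by move=> w _; rewrite lee_fin mulr_ge0// expR_ge0.
- by apply/measurable_EFinP/measurable_funM; exact: mk.
by rewrite (integral_kernel_kernel gUV)// -EFinM.
Qed.

(** The window has length [2 * e] and lies in [-(M + 1), M + 1]. There a density of variance between
    [v0] and 1 is bounded below by its smallest peak times its strongest decay. *)
Lemma near_event_ge (X : Omega -> R) (v v0 M x e : R) : centered_gaussian P v X ->
  0 < v0 -> v0 <= v -> v <= 1 -> `|x| <= M -> 0 < e -> e <= 1 ->
  ((e * (2 * normal_peak 1 * expR (- (M + 1) ^+ 2 / (v0 *+ 2))))%:E <=
    P [set w | (`|X w - x| <= e)%R])%E.
Proof.
move=> [mX v_ge0 lawX] v00 v0v v1 xM e0 e1.
have vp : 0 < v by exact: lt_le_trans v0v.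
have s0 : Num.sqrt v != 0 by rewrite gt_eqF// sqrtr_gt0.
have -> : [set w | (`|X w - x| <= e)%R] = X @^-1` `[x - e, x + e]%classic.
  by apply/seteqP; split => w /=; rewrite in_itv/= ler_distl.
rewrite lawX// /gaussian_law (negbTE s0) /normal_prob.
set c := normal_peak 1 * expR (- (M + 1) ^+ 2 / (v0 *+ 2)).
have c0 : 0 <= c by rewrite mulr_ge0 ?expR_ge0// normal_peak_ge0.
apply: (@le_trans _ _ (\int[@lebesgue_measure R]_(y in `[(x - e)%R, (x + e)%R]) c%:E)%E).
  rewrite integral_cst//= lebesgue_measure_itv/= lte_fin ltrD2l gtrN// -EFinD -EFinM lee_fin.
  by rewrite /c le_eqVlt; apply/orP; left; apply/eqP; ring.
apply: ge0_le_integral => //.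
- by apply/measurable_EFinP/measurable_funTS; exact: measurable_normal_pdf.
move=> y /=; rewrite in_itv/= => /andP[y1 y2]; rewrite lee_fin normal_pdfE//.
apply: ler_pM; rewrite ?expR_ge0 ?normal_peak_ge0//.
  rewrite /normal_peak lef_pV2 ?posrE ?sqrtr_gt0 ?pmulrn_lgt0 ?mulr_gt0 ?pi_gt0 ?exprn_gt0 ?sqrtr_gt0//.
  rewrite ler_sqrt; last by rewrite mulrn_wge0// mulr_ge0 ?pi_ge0.
  by rewrite ler_pMn2r// ler_pM2r ?pi_gt0// sqr_sqrtr// expr1n.
rewrite /normal_fun subr0 ler_expR !mulNr lerN2 sqr_sqrtr//.
apply: ler_pM; rewrite ?sqr_ge0 ?invr_ge0 ?mulrn_wge0//.
  rewrite -[y ^+ 2]real_normK ?num_real// lerXn2r ?nnegrE//.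
    by rewrite addr_ge0// (le_trans _ xM).
  by rewrite ler_norml; move: xM; rewrite ler_norml => /andP[h1 h2]; apply/andP; split; lra.
by rewrite lef_pV2 ?posrE ?pmulrn_lgt0// ler_pMn2r.
Qed.

(** [expR z] is the power [m.+1] of [expR (z / m.+1%:R)], which exceeds [z / m.+1%:R]. *)
Lemma expRN_le_power (z : R) (m : nat) : 0 < z ->
  expR (- z) <= (m.+1%:R / z) ^+ m.+1.
Proof.
move=> z0; have E : expR z = expR (z / m.+1%:R) ^+ m.+1.
  by rewrite -expRM_natl mulrC divfK.
rewrite expRN E -exprVn lerXn2r ?nnegrE ?invr_ge0 ?expR_ge0//.
  by rewrite divr_ge0// ltW.
rewrite -[leRHS]invrK invf_div lef_pV2 ?posrE ?expR_gt0 ?divr_gt0//.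
by apply: le_trans (expR_ge1Dx _); rewrite lerDr.
Qed.

(** Markov's inequality for [expR (X ^+ 2 / (4 * v))], whose mean is [Num.sqrt 2], gives a Gaussian
    tail. It is weakened to a power with [v] in the numerator: this includes [v = 0] and scales
    simply in the chaining. *)
Lemma far_event_le (X : Omega -> R) (v u : R) (m : nat) : centered_gaussian P v X ->
  0 < u -> (P [set w | (u < `|X w|)%R] <= (2 * (4 * m.+1%:R * v / u ^+ 2) ^+ m.+1)%:E)%E.
Proof.
move=> gX u0; have [mX v_ge0 lawX] := gX.
have u20 : 0 < u ^+ 2 by rewrite exprn_gt0.
have mF : measurable [set y : R | u < `|y|] by exact: measurable_far.
have [v0|vn0] := eqVneq v 0.
  have -> : [set w | u < `|X w|] = X @^-1` [set y | u < `|y|] by [].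
  rewrite lawX ?v0 ?sqrtr0 /gaussian_law ?eqxx//.
  rewrite diracE memNset/= ?normr0; last by rewrite lt_gtF.
  by rewrite mulr0 mul0r expr0n/= mulr0.
have vp : 0 < v by rewrite lt0r vn0.
have s0 : Num.sqrt v != 0 by rewrite gt_eqF// sqrtr_gt0.
have r2 : 0 < Num.sqrt 2 :> R by rewrite sqrtr_gt0.
have s20 : Num.sqrt 2 * Num.sqrt v != 0 by rewrite mulf_neq0// gt_eqF.
pose q := expR (- (u ^+ 2 / (4 * v))).
have mf : measurable_fun setT (fun y : R => q * expR (y ^+ 2 / (4 * v))).
  apply: measurable_funM => //; apply: measurableT_comp => //.
  by apply: measurable_funM => //; exact: measurable_funX.
have mA : measurable [set w | u < `|X w|] by exact: measurable_far_event.
apply: le_trans (probability_le_integral P mA (measurableT_comp mf mX) _ _) _.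
- by move=> w /=; rewrite mulr_ge0// expR_ge0.
- move=> w /= uX; rewrite -expRD -[leLHS]expR0 ler_expR addrC subr_ge0.
  rewrite ler_pM2r ?invr_gt0 ?mulr_gt0// -[X w ^+ 2]real_normK ?num_real//.
  by rewrite lerXn2r ?nnegrE// ltW.
rewrite (centered_gaussian_integral gX mf) (negbTE vn0).
have -> : (\int[@lebesgue_measure R]_x
     (q * expR (x ^+ 2 / (4 * v)) * normal_pdf 0 (Num.sqrt v) x)%:E =
   \int[@lebesgue_measure R]_x ((q * Num.sqrt 2)%:E * (normal_pdf 0 (Num.sqrt 2 * Num.sqrt v) x)%:E))%E.
  apply: eq_integral => x _; rewrite -EFinM; congr EFin.
  rewrite !normal_pdfE// -!mulrA; congr (_ * _).
  have -> : normal_peak (Num.sqrt 2 * Num.sqrt v) = (Num.sqrt 2)^-1 * normal_peak (Num.sqrt v).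
    rewrite /normal_peak exprMn !sqr_sqrtr ?ltW//.
    rewrite -[2 * v * pi *+ 2]mulrnAr -mulrA sqrtrM// invfM; congr (_ * (Num.sqrt _)^-1).
    by rewrite mulrnAr.
  rewrite -[in RHS]mulrA mulVKf ?gt_eqF// mulrCA; congr (_ * _).
  rewrite /normal_fun -expRD subr0 exprMn !sqr_sqrtr ?ltW//; congr expR.
  by field.
rewrite integralZl//; last exact: integrable_normal_pdf.
rewrite integral_normal_pdf mule1 lee_fin mulrC; apply: ler_pM; rewrite ?sqrtr_ge0 ?expR_ge0//.
  by rewrite -[leRHS](@ger0_norm R 2)// -sqrtr_sqr ler_sqrt// expr2; lra.
have z0 : 0 < u ^+ 2 / (4 * v) by rewrite divr_gt0// mulr_gt0.
apply: le_trans (expRN_le_power m z0) _.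
by rewrite le_eqVlt; apply/orP; left; apply/eqP; congr (_ ^+ _); field; rewrite vn0 gt_eqF.
Qed.

End gaussian_events.

(** * Fractional Brownian motion at one and two times *)

Section powR_facts.
Context (R : realType) (H : R).
Hypothesis H01 : 0 < H < 1.

Lemma powR2M (x : R) : 0 <= x -> x `^ (2 * H) = (x `^ H) ^+ 2.
Proof. by move=> x0; rewrite mulrC powRrM powR_mulrn// powR_ge0. Qed.

(** Put [z = s / t], which lies in [a, 1]. Then 1 - z^H <= 1 - z, and 1 - z is at most (1 - a)^(1 -
    H) times (1 - z)^H. That this factor is below 1 ([kappa_lt1]) is what keeps the residual
    variance away from 0. *)
Lemma powR_increment_le (a s t : R) : 0 < a -> a <= s -> s <= t -> t <= 1 ->
  t `^ H - s `^ H <= (1 - a) `^ (1 - H) * (t - s) `^ H.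
Proof.
have [H0 H1] := andP H01; move=> a0 as_ st t1.
have s0 : 0 < s by exact: lt_le_trans as_.
have t0 : 0 < t by exact: lt_le_trans st.
pose z := s / t.
have z0 : 0 < z by rewrite divr_gt0.
have z1 : z <= 1 by rewrite ler_pdivrMr// mul1r.
have az : a <= z by rewrite ler_pdivlMr// (le_trans _ as_)// ler_piMr// ltW.
have sE : s = t * z by rewrite /z mulrCA divff ?mulr1// gt_eqF.
have zH : z <= z `^ H.
  by apply: ger1_powR; [rewrite z0|exact: ltW].
have tsE : t - s = t * (1 - z) by rewrite mulrBr mulr1 -sE.
have -> : s `^ H = t `^ H * z `^ H by rewrite {1}sE powRM// ltW.
rewrite tsE powRM ?subr_ge0//; last exact: ltW.
rewrite -[X in X - _]mulr1 -mulrBr mulrCA.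
rewrite ler_pM2l ?powR_gt0//.
apply: (@le_trans _ _ (1 - z)); first by rewrite lerD2l lerN2.
have [->|zn1] := eqVneq z 1; first by rewrite subrr mulr_ge0 ?powR_ge0.
have z1' : 0 < 1 - z by rewrite subr_gt0 lt_neqAle zn1.
have e : 1 - z = (1 - z) `^ (1 - H) * (1 - z) `^ H.
  by rewrite -powRD ?subrK ?powRr1 ?(gt_eqF z1') ?implybT// ltW.
rewrite {1}e.
rewrite ler_pM2r ?powR_gt0//; apply: ge0_ler_powR; rewrite ?nnegrE ?subr_ge0//.
- exact: ltW.
- exact: le_trans az z1.
- by rewrite lerD2l lerN2.
Qed.

Lemma kappa_lt1 (a : R) : 0 < a -> a <= 1 -> 0 <= (1 - a) `^ (1 - H) < 1.
Proof.
have [H0 H1] := andP H01; move=> a0 a1; rewrite powR_ge0/=.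
have h : (1 - a) `^ (1 - H) < 1 `^ (1 - H).
  by apply: gt0_ltr_powR; rewrite ?nnegrE ?subr_gt0 ?subr_ge0// gtrBl.
by rewrite powR1 in h.
Qed.

(** The right side is four times the covariance determinant of the process at [s] and [t]. For
    [s <= t] it factors as ((p + q)^2 - g^2)(g^2 - (q - p)^2): the first factor is at least a^(2H)
    because [g <= q], the second is bounded below by [powR_increment_le]. This is local
    nondeterminism at two times. *)
Lemma fbm_det_ge (a s t : R) : 0 < a -> a <= s <= 1 -> a <= t <= 1 ->
  let p := s `^ H in let q := t `^ H in let g := `|t - s| `^ H in
  (1 - ((1 - a) `^ (1 - H)) ^+ 2) * a `^ H ^+ 2 * g ^+ 2 <=
   4 * p ^+ 2 * q ^+ 2 - (p ^+ 2 + q ^+ 2 - g ^+ 2) ^+ 2.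
Proof.
move=> a0 sI tI.
wlog st : s t sI tI / s <= t.
  move=> h; have [st|/ltW ts] := leP s t; first exact: h.
  have := h _ _ tI sI ts; rewrite distrC /= => h'; apply: (le_trans h').
  by rewrite le_eqVlt; apply/orP; left; apply/eqP; ring.
have [H0 H1] := andP H01.
case/andP: sI => as_ s1; case/andP: tI => at_ t1.
have a1 : a <= 1 by exact: le_trans s1.
have := powR_increment_le a0 as_ st t1.
have /andP[k0 k1] := kappa_lt1 a0 a1.
rewrite ger0_norm ?subr_ge0//=.
have s0 : 0 <= s by rewrite (le_trans _ as_)// ltW.
have pq : s `^ H <= t `^ H.
  apply: ge0_ler_powR; rewrite ?nnegrE//; first exact: ltW.
  exact: le_trans s0 st.
have ap : a `^ H <= s `^ H.
  by apply: ge0_ler_powR; rewrite ?nnegrE//; exact: ltW.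
have gq : (t - s) `^ H <= t `^ H.
  apply: ge0_ler_powR; rewrite ?nnegrE ?subr_ge0//.
  - exact: ltW.
  - exact: le_trans s0 st.
  - by rewrite gerBl.
move: k0 k1 pq ap gq; set k := (1 - a) `^ _; set p := s `^ H; set q := t `^ H.
have := powR_ge0 a H; have := powR_ge0 (t - s) H.
set A := a `^ H; set g := (t - s) `^ H => g0 A0 k0 k1 pq ap gq inc.
have -> : 4 * p ^+ 2 * q ^+ 2 - (p ^+ 2 + q ^+ 2 - g ^+ 2) ^+ 2 =
  ((p + q) ^+ 2 - g ^+ 2) * (g ^+ 2 - (q - p) ^+ 2) by ring.
have -> : (1 - k ^+ 2) * A ^+ 2 * g ^+ 2 = A ^+ 2 * (g ^+ 2 - (k * g) ^+ 2) by ring.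
apply: ler_pM.
- exact: sqr_ge0.
- by rewrite subr_ge0 lerXn2r ?nnegrE ?mulr_ge0// ler_piMl// ltW.
- nra.
- rewrite lerD2l lerN2 lerXn2r ?nnegrE ?subr_ge0//.
  by rewrite mulr_ge0.
Qed.

End powR_facts.

Section fbm_gaussian.
Context (R : realType) (disp : measure_display) (Omega : measurableType disp).
Variables (P : probability Omega R) (H : R) (X : R -> Omega -> R).
Hypothesis H01 : 0 < H < 1.
Hypothesis fX : real_fbm P H X.

Let gproc (s t c1 c2 : R) : 0 <= s <= 1 -> 0 <= t <= 1 ->
  gaussian_rv P (fun w => c1 * X s w + c2 * X t w).
Proof.
move=> s01 t01; have [gp _ _ _] := fX.
have := gp 2%N (fun i => if i == ord0 then s else t) (fun i => if i == ord0 then c1 else c2).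
rewrite (_ : (fun w => _) = (fun w => c1 * X s w + c2 * X t w)).
  by apply=> i; case: ifP => _; rewrite /= in_itv.
by apply/funext => w; rewrite !big_ord_recl big_ord0 addr0.
Qed.

Let g1 (s : R) : 0 <= s <= 1 -> gaussian_rv P (X s).
Proof.
move=> s01; have := gproc 1 0 s01 s01.
by under eq_fun do rewrite mul1r mul0r addr0.
Qed.

Lemma measurable_fbm (s : R) : 0 <= s <= 1 -> measurable_fun setT (X s).
Proof. by move=> /g1[]. Qed.

Let iXX (s t : R) : 0 <= s <= 1 -> 0 <= t <= 1 ->
  P.-integrable setT (EFin \o (fun w => X s w * X t w)).
Proof.
move=> s01 t01; apply: sqr_integrable; try exact: measurable_fbm.
  by apply: gaussian_rv_sqr_integrable; exact: g1.
by apply: gaussian_rv_sqr_integrable; exact: g1.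
Qed.

Let iX (s : R) : 0 <= s <= 1 -> P.-integrable setT (EFin \o X s).
Proof.
move=> s01.
have := @sqr_integrable _ _ _ P (X s) (fun=> 1) (measurable_fbm s01) (measurable_cst _)
  (gaussian_rv_sqr_integrable (g1 s01)) (integrable_cst _ _).
by apply: eq_integrable => // w _ /=; rewrite mulr1.
Qed.

Let EX (s : R) : 0 <= s <= 1 -> (\int[P]_w (X s w)%:E = 0)%E.
Proof.
by move=> s01; have [_ h _ _] := fX; have := h s; rewrite in_itv/= unlock; exact.
Qed.

Let EXX (s t : R) : 0 <= s <= 1 -> 0 <= t <= 1 -> (\int[P]_w (X s w * X t w)%:E =
  (2^-1 * (`|t| `^ (2 * H) + `|s| `^ (2 * H) - `|t - s| `^ (2 * H)))%:E)%E.
Proof.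
move=> s01 t01; have [_ h c _] := fX.
have := c s t; rewrite !in_itv/= => /(_ s01 t01) <-.
rewrite unlock h ?in_itv// h ?in_itv//= unlock; apply: eq_integral => w _.
by congr EFin; rewrite -[RHS]/((X s w - 0) * (X t w - 0)) !subr0.
Qed.

Lemma fbm_combination (s t c1 c2 : R) : 0 <= s <= 1 -> 0 <= t <= 1 ->
  centered_gaussian P (c1 ^+ 2 * s `^ H ^+ 2 + c2 ^+ 2 * t `^ H ^+ 2 +
     c1 * c2 * (s `^ H ^+ 2 + t `^ H ^+ 2 - `|t - s| `^ H ^+ 2))
   (fun w => c1 * X s w + c2 * X t w).
Proof.
have [H0 H1] := andP H01; move=> s01 t01; apply: gaussian_rv_centered; first exact: gproc.
  under eq_integral do rewrite EFinD (EFinM c1) (EFinM c2).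
  rewrite integralD//; [|exact: (integrableZl measurableT c1 (iX s01))
                        |exact: (integrableZl measurableT c2 (iX t01))].
  by rewrite !integralZl ?EX ?mule0 ?adde0//; exact: iX.
have i1 := integrableZl measurableT (c1 ^+ 2) (iXX s01 s01).
have i2 := integrableZl measurableT (c2 ^+ 2) (iXX t01 t01).
have i3 := integrableZl measurableT (2 * c1 * c2) (iXX s01 t01).
transitivity (\int[P]_w (((c1 ^+ 2)%:E * (X s w * X s w)%:E + (c2 ^+ 2)%:E * (X t w * X t w)%:E)
  + (2 * c1 * c2)%:E * (X s w * X t w)%:E))%E.
  by apply: eq_integral => w _; rewrite -!EFinM -!EFinD; congr EFin; ring.
rewrite integralD//; last exact: integrableD.
rewrite integralD// !integralZl//; try exact: iXX.
rewrite !EXX// !subrr !normr0 powR0 ?mulf_neq0 ?gt_eqF// !subr0.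
have [s0 _] := andP s01; have [t0 _] := andP t01.
rewrite (ger0_norm s0) (ger0_norm t0) -!EFinM -!EFinD !powR2M//; congr EFin; by field.
Qed.

End fbm_gaussian.

(** While [Delta <= rho * tau], the ratio on the right is bounded below. Beyond that, [Delta]
    exceeds twice the shift [C0 * tau], so [|u| >= Delta / 2] and the Gaussian beats the power. *)
Lemma gauss_decay (R : realType) (L C0 : R) (d : nat) : 0 < L -> 0 <= C0 ->
  exists2 C : R, 0 < C & forall tau Delta u : R, 0 < tau -> 0 <= Delta ->
    Delta - C0 * tau <= `|u| ->
    expR (- u ^+ 2 / ((L * tau) ^+ 2 *+ 2)) <= C * (tau / Num.max tau Delta) ^+ d.
Proof.
move=> L0 C00; pose C1 := (8 * L ^+ 2 * d.+1%:R) ^+ d.+1.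
have C10 : 0 <= C1 by rewrite exprn_ge0// !mulr_ge0// ltW.
pose rho := 1 + 2 * C0; have rho1 : 1 <= rho by rewrite lerDl mulr_ge0.
have rho0 : 0 < rho by lra.
exists (rho ^+ d + C1); first by rewrite ltr_pwDl// exprn_gt0.
move=> tau Delta u tau0 D0 uD.
have m0 : 0 < Num.max tau Delta by rewrite lt_max tau0.
have q0 : 0 <= (tau / Num.max tau Delta) ^+ d by rewrite exprn_ge0// divr_ge0// ltW.
have [Dr|rD] := leP Delta (rho * tau).
  apply: (@le_trans _ _ 1).
    rewrite -[leRHS]expR0 ler_expR mulNr oppr_le0 divr_ge0 ?sqr_ge0//.
    by rewrite mulrn_wge0// sqr_ge0.
  apply: (@le_trans _ _ (rho ^+ d * (tau / Num.max tau Delta) ^+ d)); last first.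
    by rewrite ler_wpM2r// lerDl.
  rewrite -exprMn; apply: exprn_ege1.
  by rewrite mulrA ler_pdivlMr// mul1r ge_max Dr andbT ler_peMl// ltW.
have tD : tau < Delta by apply: le_lt_trans rD; rewrite ler_peMl// ltW.
have Dp : 0 < Delta by exact: lt_trans tD.
have -> : Num.max tau Delta = Delta by apply/max_idPr; exact: ltW.
have u2 : (Delta / 2) ^+ 2 <= u ^+ 2.
  rewrite -[u ^+ 2]real_normK ?num_real// lerXn2r ?nnegrE ?divr_ge0//.
  by apply: le_trans uD; move: rD; rewrite /rho; lra.
have LT : 0 < (L * tau) ^+ 2 *+ 2 by rewrite pmulrn_lgt0// exprn_gt0// mulr_gt0.
set y := (Delta / 2) ^+ 2 / ((L * tau) ^+ 2 *+ 2).
have y0 : 0 < y by rewrite divr_gt0// exprn_gt0// divr_gt0.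
apply: (@le_trans _ _ (expR (- y))).
  by rewrite ler_expR mulNr lerN2 ler_pM2r ?invr_gt0.
apply: le_trans (expRN_le_power d y0) _.
have td0 : 0 <= tau / Delta by rewrite divr_ge0// ltW.
have td1 : tau / Delta <= 1 by rewrite ler_pdivrMr// mul1r ltW.
(* The constant [C1] is read off from this identity. *)
have -> : d.+1%:R / y = 8 * L ^+ 2 * d.+1%:R * (tau / Delta) ^+ 2.
  by rewrite /y; field; rewrite !gt_eqF.
rewrite exprMn -/C1; apply: (@le_trans _ _ (C1 * (tau / Delta) ^+ d)).
  rewrite ler_wpM2l// -exprM; apply: ler_wiXn2l => //.
  by rewrite (leq_trans (leqnSn d))// leq_pmull.
by rewrite ler_wpM2r ?exprn_ge0// lerDr exprn_ge0// ltW.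
Qed.

(** Regress [X s] on [X t]: the residual [X s - c * X t] is uncorrelated with [X t]. It contributes
    a factor [e / tau] and the decay in [|x - y|], while [X t] contributes a factor [e]. The power
    [d] serves later, when a single coordinate supplies the decay for the whole vector. *)
Lemma fbm_pair_bound (R : realType) (H a M : R) (d : nat) :
  0 < H < 1 -> 0 < a -> a <= 1 -> 0 <= M ->
  exists2 C : R, 0 < C &
    forall (disp : measure_display) (Omega : measurableType disp)
      (P : probability Omega R) (X : R -> Omega -> R), real_fbm P H X ->
    forall s t x y e : R, a <= s <= 1 -> a <= t <= 1 -> `|x| <= M -> `|y| <= M ->
      0 < e ->
      let tau := Num.sqrt (e ^+ 2 + `|t - s| `^ H ^+ 2) in
      (P ([set w | (`|X s w - x| <= e)%R] `&` [set w | (`|X t w - y| <= e)%R]) <=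
        (C * (e ^+ 2 / tau) * (tau / Num.max tau `|x - y|) ^+ d)%:E)%E.
Proof.
move=> H01 a0 a1 M0; have [H0 H1] := andP H01.
pose A := a `^ H; have A0 : 0 < A by rewrite powR_gt0.
pose k := (1 - a) `^ (1 - H).
have /andP[k0 k1] := kappa_lt1 H01 a0 a1.
have A1 : A <= 1.
  by rewrite -[leRHS](powRr0 a); apply: ger_powR; rewrite ?a0//; exact: ltW.
have k21 : 0 < 1 - k ^+ 2 by rewrite subr_gt0 expr_lt1.
(* [c1 * g ^+ 2] will bound the residual variance below; the 4 comes from [fbm_det_ge], which bounds
   four times the determinant. *)
pose c1 := (1 - k ^+ 2) * A ^+ 2 / 4.
have c10 : 0 < c1 by rewrite divr_gt0// mulr_gt0// exprn_gt0.
have c11 : c1 <= 1.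
  have : (1 - k ^+ 2) * A ^+ 2 <= 1.
    by apply: mulr_ile1; [exact: ltW|exact: sqr_ge0|rewrite gerBl sqr_ge0|rewrite expr_le1// ltW].
  by rewrite /c1; lra.
pose L := 1 + A^-1.
have iA0 : 0 < A^-1 by rewrite invr_gt0.
have L0 : 0 < L by rewrite addr_gt0.
have L1 : 1 <= L by rewrite lerDl ltW.
have [C2 C20 decay] := @gauss_decay R L (M / A) d L0 (divr_ge0 M0 (ltW A0)).
have sc1 : 0 < Num.sqrt c1 by rewrite sqrtr_gt0.
exists (expR 1 * (L / Num.sqrt c1) * (L / A) * C2).
  by rewrite !mulr_gt0 ?expR_gt0 ?invr_gt0.
move=> disp Omega P X fX s t x y e sI tI xM yM e0 /=.
have [as_ s1] := andP sI; have [at_ t1] := andP tI.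
have s01 : 0 <= s <= 1 by rewrite (le_trans _ as_) ?s1// ltW.
have t01 : 0 <= t <= 1 by rewrite (le_trans _ at_) ?t1// ltW.
have := fbm_det_ge H01 a0 sI tI; rewrite /= -/A -/k.
have comb := fbm_combination H01 fX _ _ s01 t01.
have Aq : A <= t `^ H.
  by apply: ge0_ler_powR; rewrite ?nnegrE// ?ltW//; exact: lt_le_trans at_.
have one_pow : 1 `^ H = 1 :> R by rewrite powR1.
have p1 : s `^ H <= 1.
  by rewrite -[leRHS]one_pow; apply: ge0_ler_powR; rewrite ?nnegrE ?ler01//; [exact: ltW|case/andP: s01].
have q1 : t `^ H <= 1.
  by rewrite -[leRHS]one_pow; apply: ge0_ler_powR; rewrite ?nnegrE ?ler01//; [exact: ltW|case/andP: t01].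
have := powR_ge0 s H; have := powR_ge0 `|t - s| H.
move: comb Aq p1 q1; set p := s `^ H; set q := t `^ H; set g := `|t - s| `^ H.
move=> comb Aq p1 q1 g0 p0 det.
have q0 : 0 < q by exact: lt_le_trans Aq.
have qn0 : q != 0 by rewrite gt_eqF.
set tau := Num.sqrt (e ^+ 2 + g ^+ 2).
have tau2 : tau ^+ 2 = e ^+ 2 + g ^+ 2 by rewrite sqr_sqrtr// addr_ge0 ?sqr_ge0.
have tau0 : 0 < tau by rewrite sqrtr_gt0 ltr_pwDl ?sqr_ge0 ?exprn_gt0.
have gtau : g <= tau.
  by rewrite -[leLHS](ger0_norm g0) -sqrtr_sqr ler_wsqrtr// lerDr sqr_ge0.
(* [r] is the covariance, [c] the regression coefficient and [vW] the residual variance. *)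
pose r := (p ^+ 2 + q ^+ 2 - g ^+ 2) / 2.
pose c := r / q ^+ 2.
pose vW := p ^+ 2 - r ^+ 2 / q ^+ 2.
have vWE : 4 * q ^+ 2 * vW = 4 * p ^+ 2 * q ^+ 2 - (p ^+ 2 + q ^+ 2 - g ^+ 2) ^+ 2.
  by rewrite /vW /r; field.
have q20 : 0 < q ^+ 2 by rewrite exprn_gt0.
have q21 : q ^+ 2 <= 1 by rewrite expr_le1// ltW.
have vW0 : c1 * g ^+ 2 <= vW.
  have h : c1 * g ^+ 2 <= q ^+ 2 * vW by rewrite /c1; move: det; rewrite -vWE; lra.
  have : 0 <= c1 * g ^+ 2 by rewrite mulr_ge0 ?sqr_ge0// ltW.
  move=> h0; apply: (le_trans h); rewrite ler_piMl//.
  by rewrite -(pmulr_rge0 _ q20) (le_trans h0 h).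
have vWge0 : 0 <= vW by apply: le_trans vW0; rewrite mulr_ge0 ?sqr_ge0// ltW.
(* The right side is q^2 (1 - c)^2, so this identity bounds both [vW] by [g ^+ 2] and [1 - c] by a
   multiple of [tau]. *)
have vWg : g ^+ 2 - vW = (q ^+ 2 - r) ^+ 2 / q ^+ 2 by rewrite /vW /r; field.
have vW1 : vW <= g ^+ 2 by rewrite -subr_ge0 vWg divr_ge0 ?sqr_ge0// ltW.
have iqA : (q ^+ 2)^-1 <= A^-1 ^+ 2.
  by rewrite exprVn lef_pV2 ?posrE ?exprn_gt0// lerXn2r ?nnegrE// ltW.
have c_le : `|c| <= A^-1.
  rewrite -ler_sqr ?nnegrE ?(ltW iA0)// real_normK ?num_real//.
  apply: le_trans iqA.
  have -> : c ^+ 2 = (p ^+ 2 - vW) / q ^+ 2 by rewrite /c /vW; field.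
  rewrite ler_piMl ?invr_ge0 ?(ltW q20)//.
  have p21 : p ^+ 2 <= 1 by rewrite expr_le1.
  by move: vWge0 p21; lra.
have c1_le : `|1 - c| <= tau / A.
  rewrite -ler_sqr ?nnegrE ?divr_ge0 ?(ltW A0) ?(ltW tau0)// real_normK ?num_real//.
  have -> : (1 - c) ^+ 2 = (g ^+ 2 - vW) / q ^+ 2.
    by rewrite vWg /c; field.
  rewrite exprMn; apply: ler_pM => //.
  - by rewrite subr_ge0.
  - by rewrite invr_ge0 ltW.
  - by rewrite tau2; have := sqr_ge0 e; move: vWge0; lra.
(* The residual deviates from [x'] by at most [(1 + |c|) * e], hence the factor [L]; the window of
   [X t] is widened too, so that both kernels have the same width. *)
pose e' := L * e; have e'0 : 0 < e' by rewrite mulr_gt0.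
pose x' := x - c * y.
have comb' s' t' : centered_gaussian P (s' ^+ 2 * vW + t' ^+ 2 * q ^+ 2)
    (fun w => s' * (X s w - c * X t w) + t' * X t w).
  have := comb s' (t' - s' * c).
  have -> : s' ^+ 2 * p ^+ 2 + (t' - s' * c) ^+ 2 * q ^+ 2 +
    s' * (t' - s' * c) * (p ^+ 2 + q ^+ 2 - g ^+ 2) = s' ^+ 2 * vW + t' ^+ 2 * q ^+ 2.
    by rewrite /vW /c /r; field.
  rewrite (_ : (fun w => _) = (fun w => s' * (X s w - c * X t w) + t' * X t w))//.
  by apply/funext => w; ring.
have mXs := measurable_fbm fX s01; have mXt := measurable_fbm fX t01.
have mU : measurable_fun setT (fun w => X s w - c * X t w).
  by apply: measurable_funB => //; exact: measurable_funM.
apply: (@le_trans _ _ (P ([set w | (`|(X s w - c * X t w) - x'| <= e')%R] `&`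
                         [set w | (`|X t w - y| <= e')%R]))).
  apply: le_measure.
  - by apply: mem_set; apply: measurableI; exact: measurable_near_event.
  - by apply: mem_set; apply: measurableI; exact: measurable_near_event.
  - move=> w [/= h1 h2]; split => /=; last first.
      by apply: (le_trans h2); rewrite /e' ler_peMl// ltW.
    have -> : X s w - c * X t w - x' = (X s w - x) - c * (X t w - y) by rewrite /x'; ring.
    apply: (le_trans (ler_normB _ _)); rewrite /e' /L mulrDl mul1r lerD//.
    by rewrite normrM; apply: ler_pM.
apply: (le_trans (pair_event_le x' y e'0 comb')).
rewrite lee_fin.
have P1 : 0 < e' ^+ 2 + vW by rewrite ltr_pwDl// exprn_gt0.
have P2 : 0 < (L * tau) ^+ 2 by rewrite exprn_gt0// mulr_gt0.
have P3 : 0 < c1 * tau ^+ 2 by rewrite mulr_gt0// exprn_gt0.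
have P4 : 0 < e' ^+ 2 + q ^+ 2 by rewrite addr_gt0// exprn_gt0.
have B1 : e' / Num.sqrt (e' ^+ 2 + vW) <= L / Num.sqrt c1 * (e / tau).
  have -> : L / Num.sqrt c1 * (e / tau) = e' / Num.sqrt (c1 * tau ^+ 2).
    rewrite (@sqrtrM _ c1 (tau ^+ 2) (ltW c10)) sqrtr_sqr (gtr0_norm tau0) /e'.
    by field; rewrite !gt_eqF.
  rewrite ler_pM2l// lef_pV2 ?posrE ?sqrtr_gt0//.
  rewrite ler_wsqrtr// tau2 mulrDr lerD//.
  rewrite /e' exprMn ler_pM2r ?exprn_gt0//; apply: (le_trans c11).
  by rewrite exprn_ege1.
have B2 : expR (- x' ^+ 2 / ((e' ^+ 2 + vW) *+ 2)) <=
    C2 * (tau / Num.max tau `|x - y|) ^+ d.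
  apply: (@le_trans _ _ (expR (- x' ^+ 2 / ((L * tau) ^+ 2 *+ 2)))).
    rewrite ler_expR !mulNr lerN2 ler_wpM2l ?sqr_ge0//.
    rewrite lef_pV2 ?posrE ?pmulrn_lgt0//.
    rewrite ler_pMn2r// /e' !exprMn tau2 mulrDr lerD2l; apply: (le_trans vW1).
    by rewrite ler_peMl ?sqr_ge0// exprn_ege1.
  apply: decay => //.
  (* Passing from [x'] to [x - y] costs [|1 - c| * |y|], at most [M / A * tau]: this is the shift
     that [decay] tolerates. *)
  have -> : x' = (x - y) - (- (1 - c) * y) by rewrite /x'; ring.
  apply: (le_trans _ (lerB_dist _ _)); rewrite lerD2l lerN2 mulNr normrN normrM.
  have -> : M / A * tau = tau / A * M by ring.
  exact: ler_pM.
have B3 : e' / Num.sqrt (e' ^+ 2 + q ^+ 2) * expR (- y ^+ 2 / ((e' ^+ 2 + q ^+ 2) *+ 2)) <= L / A * e.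
  apply: (@le_trans _ _ (e' / Num.sqrt (e' ^+ 2 + q ^+ 2))).
    rewrite ler_piMr ?divr_ge0 ?sqrtr_ge0 ?(ltW e'0)//.
    rewrite -[leRHS]expR0 ler_expR mulNr oppr_le0 divr_ge0 ?sqr_ge0//.
    by rewrite mulrn_wge0// addr_ge0 ?sqr_ge0.
  rewrite /e' -!mulrA ler_pM2l// [leRHS]mulrC ler_pM2l// lef_pV2 ?posrE ?sqrtr_gt0//.
  apply: (le_trans Aq); rewrite -[leLHS](gtr0_norm q0) -sqrtr_sqr ler_wsqrtr//.
  by rewrite lerDr sqr_ge0.
have -> : expR 1 * (L / Num.sqrt c1) * (L / A) * C2 * (e ^+ 2 / tau) *
  (tau / Num.max tau `|x - y|) ^+ d = expR 1 * (L / Num.sqrt c1 * (e / tau) *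
  (C2 * (tau / Num.max tau `|x - y|) ^+ d) * (L / A * e)) by ring.
rewrite ler_pM2l ?expR_gt0//; apply: ler_pM => //.
- by rewrite mulr_ge0 ?expR_ge0// divr_ge0 ?sqrtr_ge0// ltW.
- by rewrite mulr_ge0 ?expR_ge0// divr_ge0 ?sqrtr_ge0// ltW.
- by apply: ler_pM; rewrite ?expR_ge0 ?divr_ge0 ?sqrtr_ge0 ?(ltW e'0).
Qed.

(* The sigma-algebra generated by a process on [[0, 1]] as a measurable type, so
   that the closure properties of measurable sets apply to its events. *)
Definition process_space (R : realType) (Omega : pointedType)
    (disp : measure_display) (T : measurableType disp) (X : R -> Omega -> T) :=
  g_sigma_algebraType
    (\bigcup_(t in `[0, 1]%classic) preimage_set_system setT (X t) (@measurable _ T)).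

Lemma measurable_process_space (R : realType) (disp : measure_display)
    (Omega : measurableType disp) (X : R -> Omega -> R) (t : R) : 0 <= t <= 1 ->
  measurable_fun setT (X t : process_space X -> R).
Proof.
move=> t01 _ A mA; apply: sub_sigma_algebra; exists t; first by rewrite /= in_itv.
by exists A.
Qed.

Lemma process_sigmaE (R : realType) (disp : measure_display)
    (Omega : measurableType disp) (X : R -> Omega -> R) (A : set Omega) :
  process_sigma `[0, 1] X A = @measurable _ (process_space X) A.
Proof. by []. Qed.

Lemma ereal_prod_le (R : realType) (d : nat) (F : 'I_d -> \bar R) (r : 'I_d -> R) :
  (forall i, 0 <= F i)%E -> (forall i, F i <= (r i)%:E)%E ->
  (\prod_(i < d) F i <= (\prod_(i < d) r i)%:E)%E.
Proof.
move=> F0 Fr.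
suff [] : (0 <= \prod_(i < d) F i)%E /\ (\prod_(i < d) F i <= (\prod_(i < d) r i)%:E)%E by [].
apply: (big_ind2 (fun (x : \bar R) (y : R) => (0 <= x)%E /\ (x <= y%:E)%E)) => //.
move=> x1 x2 y1 y2 [h1 h2] [h3 h4]; split; first exact: mule_ge0.
by rewrite EFinM; apply: lee_pmul.
Qed.

Lemma ereal_prod_ge (R : realType) (d : nat) (F : 'I_d -> \bar R) (r : 'I_d -> R) :
  (forall i, 0 <= r i) -> (forall i, (r i)%:E <= F i)%E ->
  ((\prod_(i < d) r i)%:E <= \prod_(i < d) F i)%E.
Proof.
move=> r0 Fr.
suff [] : 0 <= \prod_(i < d) r i /\ ((\prod_(i < d) r i)%:E <= \prod_(i < d) F i)%E by [].
apply: (big_ind2 (fun (x : R) (y : \bar R) => 0 <= x /\ (x%:E <= y)%E)) => //.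
move=> x1 x2 y1 y2 [h1 h2] [h3 h4]; split; first exact: mulr_ge0.
by rewrite EFinM; apply: lee_pmul.
Qed.

(** * Independent coordinates: probabilities of cubes *)

Section fbm_vector.
Context (R : realType) (d : nat) (H a M : R).
Hypothesis H01 : 0 < H < 1.
Hypothesis a0 : 0 < a.
Hypothesis a1 : a <= 1.
Hypothesis M0 : 0 <= M.

Definition cube_event (disp : measure_display) (Omega : measurableType disp)
    (B : R -> Omega -> 'rV[R]_d) (t e : R) (x : 'rV[R]_d) : set Omega :=
  \bigcap_(i : 'I_d) [set w | `|B t w ord0 i - x ord0 i| <= e].

Lemma measurable_cube_event (disp : measure_display) (Omega : measurableType disp)
    (P : probability Omega R) (B : R -> Omega -> 'rV[R]_d) (t e : R) (x : 'rV[R]_d) :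
  fbm P H B -> 0 <= t <= 1 -> measurable (cube_event B t e x).
Proof.
move=> [fB _] t01; apply: fin_bigcap_measurable => // i _.
apply: (@measurable_near_event _ _ _ (fun w => B t w ord0 i)).
exact: (measurable_fbm (fB i) t01).
Qed.

Lemma cube_event_ge : exists2 c : R, 0 < c &
  forall (disp : measure_display) (Omega : measurableType disp)
    (P : probability Omega R) (B : R -> Omega -> 'rV[R]_d), fbm P H B ->
  forall (t e : R) (x : 'rV[R]_d), a <= t <= 1 -> (forall i, `|x ord0 i| <= M) ->
    0 < e -> e <= 1 -> ((c * e ^+ d)%:E <= P (cube_event B t e x))%E.
Proof.
pose c := 2 * normal_peak 1 * expR (- (M + 1) ^+ 2 / (a `^ H ^+ 2 *+ 2)) : R.
have c0 : 0 < c by rewrite !mulr_gt0 ?expR_gt0// normal_peak_gt0.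
have [H0 H1] := andP H01.
exists (c ^+ d); first by rewrite exprn_gt0.
move=> disp Omega P B [fB iB] t e x tI xM e0 e1.
have [at_ t1] := andP tI.
have t0 : 0 <= t by rewrite (le_trans _ at_)// ltW.
have t01 : 0 <= t <= 1 by rewrite t0.
rewrite /cube_event iB; last first.
  move=> i; rewrite process_sigmaE.
  by apply: (@measurable_near_event _ _ (process_space _)); exact: measurable_process_space.
have -> : c ^+ d * e ^+ d = \prod_(i < d) (e * c).
  by rewrite prodr_const card_ord [RHS]exprMn mulrC.
apply: ereal_prod_ge => i; first by rewrite mulr_ge0// ltW.
have g := fbm_combination H01 (fB i) 1 0 t01 t01.
have : centered_gaussian P (t `^ H ^+ 2) (fun w => B t w ord0 i).
  move: g; rewrite !expr1n expr0n mul1r !(mul0r, mulr0) !addr0.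
  by under eq_fun do rewrite mul1r mul0r addr0.
move=> gB; apply: (near_event_ge gB) => //.
- by rewrite exprn_gt0// powR_gt0.
- rewrite lerXn2r ?nnegrE ?powR_ge0//.
  by apply: ge0_ler_powR; rewrite ?nnegrE//; exact: ltW.
- rewrite expr_le1 ?powR_ge0//.
  have -> : 1 = 1 `^ H :> R by rewrite powR1.
  by apply: ge0_ler_powR; rewrite ?nnegrE//; exact: ltW.
Qed.

(** For each coordinate the events at [s] and at [t] both lie in the sigma-algebra of that
    coordinate, so the pair factors. Only the chosen coordinate keeps its decay factor, and the
    [d]-th power in it cancels the [tau ^+ d] gathered in the denominator from all coordinates. *)
Lemma cube_event_pair_le : exists2 C : R, 0 < C &
  forall (disp : measure_display) (Omega : measurableType disp)
    (P : probability Omega R) (B : R -> Omega -> 'rV[R]_d), fbm P H B ->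
  forall (s t e : R) (x y : 'rV[R]_d), a <= s <= 1 -> a <= t <= 1 ->
    (forall i, `|x ord0 i| <= M) -> (forall i, `|y ord0 i| <= M) -> 0 < e ->
    let tau := Num.sqrt (e ^+ 2 + `|t - s| `^ H ^+ 2) in
  forall i : 'I_d,
    (P (cube_event B s e x `&` cube_event B t e y) <=
     (C * (e ^+ d) ^+ 2 / Num.max tau `|x ord0 i - y ord0 i| ^+ d)%:E)%E.
Proof.
have [C C0 pb] := fbm_pair_bound d H01 a0 a1 M0.
exists (C ^+ d); first by rewrite exprn_gt0.
move=> disp Omega P B [fB iB] s t e x y sI tI xM yM e0 tau i0.
have [H0 H1] := andP H01.
have s01 : 0 <= s <= 1 by case/andP: sI => h ->; rewrite (le_trans _ h)// ltW.
have t01 : 0 <= t <= 1 by case/andP: tI => h ->; rewrite (le_trans _ h)// ltW.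
have tau0 : 0 < tau by rewrite sqrtr_gt0 ltr_pwDl ?sqr_ge0 ?exprn_gt0.
rewrite /cube_event -bigcapI iB; last first.
  move=> i; rewrite process_sigmaE.
  apply: (@measurableI _ (process_space _));
    by apply: (@measurable_near_event _ _ (process_space _)); exact: measurable_process_space.
pose q i := tau / Num.max tau `|x ord0 i - y ord0 i|.
have q0 i : 0 <= q i by rewrite divr_ge0 ?le_max ?(ltW tau0).
have q1 i : q i <= 1 by rewrite ler_pdivrMr ?mul1r ?le_max ?lexx// lt_max tau0.
apply: (@le_trans _ _ (\prod_(i < d) (C * (e ^+ 2 / tau) * q i ^+ d))%:E).
  by apply: ereal_prod_le => i //; exact: (pb _ _ _ _ (fB i)).
rewrite lee_fin big_split/= prodr_const card_ord.
apply: (@le_trans _ _ ((C * (e ^+ 2 / tau)) ^+ d * q i0 ^+ d)).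
  have c0 : 0 <= C * (e ^+ 2 / tau).
    by rewrite mulr_ge0 ?(ltW C0)// divr_ge0 ?sqr_ge0// ltW.
  rewrite ler_wpM2l ?(exprn_ge0 _ c0)//.
  rewrite (bigD1 i0)//= ler_piMr ?exprn_ge0//.
  by apply: prodr_ile1 => i _; rewrite exprn_ge0//= exprn_ile1.
rewrite -exprMn /q.
have -> : C * (e ^+ 2 / tau) * (tau / Num.max tau `|x ord0 i0 - y ord0 i0|) =
   C * e ^+ 2 / Num.max tau `|x ord0 i0 - y ord0 i0|.
  by field; rewrite !gt_eqF// lt_max tau0.
by rewrite [X in X <= _]exprMn [X in X * _ <= _]exprMn exprVn (exprAC e 2 d).
Qed.

End fbm_vector.

(** * The second moment method *)

(** Take [l = a / u], where the quadratic is smallest; if [u = 0], a large [l] forces [a = 0]. *)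
Lemma discriminant_le (R : realType) (a b u : R) : 0 <= a -> 0 <= u ->
  (forall l : R, 0 <= l -> 2 * l * a <= b + l ^+ 2 * u) -> a ^+ 2 <= u * b.
Proof.
move=> a0 u0 h.
have b0 : 0 <= b by have := h 0 (lexx _); rewrite mulr0 mul0r expr0n/= mul0r addr0.
have [u_eq0|un0] := eqVneq u 0.
  have [->|an0] := eqVneq a 0; first by rewrite expr0n/= mulr_ge0.
  have ap : 0 < a by rewrite lt0r an0.
  have l0 : 0 <= (b + 1) / a by rewrite divr_ge0// addr_ge0.
  have := h _ l0; rewrite u_eq0 mulr0 addr0.
  have -> : 2 * ((b + 1) / a) * a = 2 * (b + 1) by field.
  lra.
have up : 0 < u by rewrite lt0r un0.
have := h (a / u) (divr_ge0 a0 u0).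
have -> : 2 * (a / u) * a = 2 * (a ^+ 2 / u) by field.
have -> : (a / u) ^+ 2 * u = a ^+ 2 / u by field.
move=> k; have : a ^+ 2 / u <= b by lra.
by rewrite ler_pdivrMr// mulrC.
Qed.

(** Cauchy-Schwarz for the weighted count [z] of the events that occur, in the form 2 l z <= z^2 +
    l^2 on the union; off the union [z] vanishes. Integration leaves a quadratic inequality in
    [l]. *)
Lemma second_moment (R : realType) (disp : measure_display)
    (Omega : measurableType disp) (P : probability Omega R) (I : finType)
    (A : I -> set Omega) (w : I -> R) (p : R) (q : I -> I -> R) :
  (forall i, measurable (A i)) -> (forall i, 0 <= w i) -> 0 <= p ->
  (forall i, w i != 0 -> (p%:E <= P (A i))%E) ->
  (forall i j, w i != 0 -> w j != 0 -> (P (A i `&` A j) <= (q i j)%:E)%E) ->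
  ((\sum_i w i) * p) ^+ 2 <=
    fine (P (\bigcup_i A i)) * \sum_i \sum_j w i * w j * q i j.
Proof.
move=> mA w0 p0 pA qA.
have mU : measurable (\bigcup_i A i) by exact: fin_bigcup_measurable.
have fU : P (\bigcup_i A i) \is a fin_num by exact: fin_num_measure.
apply: discriminant_le.
- by rewrite mulr_ge0// sumr_ge0.
- exact: fine_ge0.
move=> l l0; rewrite -lee_fin.
pose z (t : Omega) := \sum_i w i * \1_(A i) t.
have mind (B : set Omega) (c : R) : measurable B ->
    measurable_fun setT (fun t => (c * \1_B t)%:E).
  by move=> mB; apply/measurable_EFinP; apply: measurable_funM => //; exact: measurable_indic.
have Iind (B : set Omega) (c : R) : measurable B -> 0 <= c ->
    (\int[P]_t (c * \1_B t)%:E = c%:E * P B)%E.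
  move=> mB c0; under eq_integral do rewrite EFinM.
  rewrite ge0_integralZl//; first by rewrite integral_indic// setIT.
  by apply/measurable_EFinP; exact: measurable_indic.
have zz t : z t ^+ 2 = \sum_i \sum_j w i * w j * \1_(A i `&` A j) t.
  rewrite /z expr2 big_distrl/=; apply: eq_bigr => i _.
  by rewrite big_distrr/=; apply: eq_bigr => j _; rewrite indicI/=; ring.
have L1 : (\int[P]_t (\sum_i (2 * l * w i * \1_(A i) t)%:E) =
    \sum_i (2 * l * w i)%:E * P (A i))%E.
  rewrite ge0_integral_sum//=.
  - by apply: eq_bigr => i _; rewrite Iind// !mulr_ge0.
  - by move=> i; exact: mind.
  - by move=> i t _; rewrite lee_fin !mulr_ge0.
have L2 : (\int[P]_t (\sum_i \sum_j (w i * w j * \1_(A i `&` A j) t)%:E +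
     (l ^+ 2 * \1_(\bigcup_i A i) t)%:E) =
    \sum_i \sum_j (w i * w j)%:E * P (A i `&` A j) + (l ^+ 2)%:E * P (\bigcup_i A i))%E.
  have ms i : measurable_fun setT (fun t => \sum_j (w i * w j * \1_(A i `&` A j) t)%:E)%E.
    by apply: emeasurable_sum => j; apply: mind; exact: measurableI.
  have s0 i t : (0 <= \sum_j (w i * w j * \1_(A i `&` A j) t)%:E)%E.
    by apply: sume_ge0 => j _; rewrite lee_fin !mulr_ge0.
  rewrite ge0_integralD//=.
  - rewrite Iind ?sqr_ge0//; congr (_ + _)%E.
    rewrite ge0_integral_sum//=; apply: eq_bigr => i _.
    rewrite ge0_integral_sum//=.
    + by apply: eq_bigr => j _; rewrite Iind ?mulr_ge0//; exact: measurableI.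
    + by move=> j; apply: mind; exact: measurableI.
    + by move=> j t _; rewrite lee_fin !mulr_ge0.
  - by move=> t _; apply: sume_ge0.
  - exact: emeasurable_sum.
  - by move=> t _; rewrite lee_fin mulr_ge0// sqr_ge0.
  - exact: mind.
have le12 : (\sum_i (2 * l * w i)%:E * P (A i) <= \sum_i \sum_j (w i * w j)%:E * P (A i `&` A j) +
    (l ^+ 2)%:E * P (\bigcup_i A i))%E.
  rewrite -L1 -L2; apply: ge0_le_integral => //=.
  - by move=> t _; apply: sume_ge0 => i _; rewrite lee_fin !mulr_ge0.
  - by apply: emeasurable_sum => i; exact: mind.
  - apply: emeasurable_funD; last exact: mind.
    apply: emeasurable_sum => i; apply: emeasurable_sum => j.
    by apply: mind; exact: measurableI.
  - move=> t _; rewrite sumEFin.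
    under [X in (_ <= X + _)%E]eq_bigr do rewrite sumEFin.
    rewrite sumEFin -EFinD lee_fin -zz.
    have -> : \sum_i 2 * l * w i * \1_(A i) t = 2 * l * z t.
      by rewrite /z big_distrr/=; apply: eq_bigr => i _; rewrite mulrA.
    rewrite [\1_(\bigcup_i A i) t]indicE; case: (boolP (t \in _)) => /=.
      by move=> _; have := sqr_ge0 (z t - l); rewrite sqrrB; lra.
    rewrite notin_setE => nt; have -> : z t = 0; last by rewrite !mulr0 expr0n addr0.
    rewrite /z big1// => i _; rewrite indicE memNset ?mulr0// => Ait.
    by apply: nt; exists i.
apply: (@le_trans _ _ (\sum_i (2 * l * w i)%:E * P (A i))%E).
  rewrite mulrA big_distrr/= big_distrl/= -sumEFin; apply: lee_sum => i _.
  have [->|wi0] := eqVneq (w i) 0; first by rewrite !(mulr0, mul0r) mul0e.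
  by rewrite EFinM; apply: lee_wpmul2l; [rewrite lee_fin !mulr_ge0|exact: pA].
apply: (le_trans le12); rewrite EFinD; apply: leeD; last by rewrite [leRHS]EFinM fineK.
rewrite -sumEFin; apply: lee_sum => i _; rewrite -sumEFin; apply: lee_sum => j _.
have [->|wi0] := eqVneq (w i) 0; first by rewrite !(mulr0, mul0r) mul0e.
have [->|wj0] := eqVneq (w j) 0; first by rewrite !(mulr0, mul0r) mul0e.
by rewrite [leRHS]EFinM; apply: lee_wpmul2l; [rewrite lee_fin mulr_ge0|exact: qA].
Qed.

(** * Frostman weights on the line *)

Section hausdorff_content.
Context (R : realType) (T : Type) (dist : T -> T -> R) (beta delta : R).
Hypothesis beta0 : 0 < beta.

Lemma hausdorff_delta_ge0 (G : set T) : (0 <= hausdorff_delta dist beta delta G)%E.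
Proof.
apply: le_ereal_inf_tmp => _ [r _ <-].
by apply: nneseries_ge0 => n _ _; rewrite lee_fin powR_ge0.
Qed.

Lemma hausdorff_delta_le (G G' : set T) : G `<=` G' ->
  (hausdorff_delta dist beta delta G <= hausdorff_delta dist beta delta G')%E.
Proof.
move=> GG'; apply: ereal_inf_le_tmp => _ [r [rd [x Gx]] <-].
by exists r => //; split=> //; exists x; exact: subset_trans Gx.
Qed.

Lemma hausdorff_delta_cons (G G' : set T) (c : T) (r0 : R) : 0 <= r0 <= delta ->
  G `<=` G' `|` oball dist c r0 ->
  (hausdorff_delta dist beta delta G <=
   hausdorff_delta dist beta delta G' + ((2 * r0) `^ beta)%:E)%E.
Proof.
move=> r0d GG'; rewrite -leeBlDr//; apply: le_ereal_inf_tmp => _ [r [rd [x Gx]] <-].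
rewrite leeBlDr//.
pose r' n := if n is m.+1 then r m else r0.
pose x' n := if n is m.+1 then x m else c.
have -> : (\sum_(0 <= n <oo) ((2 * r n) `^ beta)%:E + ((2 * r0) `^ beta)%:E =
           \sum_(0 <= n <oo) ((2 * r' n) `^ beta)%:E)%E.
  rewrite [RHS]nneseries_recl//; last by move=> k _; rewrite lee_fin powR_ge0.
  rewrite addeC; congr (_ + _)%E.
  rewrite -(@nneseries_addn _ (fun n => ((2 * r' n) `^ beta)%:E) 1); last first.
    by move=> k; rewrite lee_fin powR_ge0.
  by apply: eq_eseriesr => n _; rewrite addn1.
apply: ereal_inf_lbound; exists r' => //; split; first by case.
exists x' => z /GG'[/Gx [n _ zn]|zc]; first by exists n.+1.
by exists 0%N.
Qed.

Lemma hausdorff_delta_set0 (x0 : T) : 0 <= delta -> hausdorff_delta dist beta delta set0 = 0%E.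
Proof.
move=> d0; apply/eqP; rewrite eq_le hausdorff_delta_ge0 andbT.
apply: ereal_inf_lbound; exists (fun=> 0); first by split=> [n|]; [rewrite lexx|exists (fun=> x0)].
by rewrite mulr0 powR0 ?gt_eqF// eseries0.
Qed.

End hausdorff_content.

(* On the line the Hausdorff content of [E] up to [x] is a distribution function
   with Hölder increments, so it plays the role of Frostman's measure. *)
Lemma frostman_line (R : realType) (a b beta : R) (E : set R) : 0 < beta -> a <= b ->
  E `<=` `[a, b] -> (0 < hausdorff_measure (@abs_dist R) beta E)%E ->
  exists (g : R -> R) (C : R), [/\ 0 < C, 0 < g b, (forall x, x < a -> g x = 0) &
    forall x y : R, x <= y -> [/\ g x <= g y, g y - g x <= C * (y - x) `^ beta &
       (forall z, x < z -> z <= y -> ~ E z) -> g y = g x]].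
Proof.
move=> beta0 ab Eab mE.
have [delta [delta0 hE]] : exists delta : R, 0 < delta /\
    (0 < hausdorff_delta (@abs_dist R) beta delta E)%E.
  apply: contrapT => /forallNP h; move: mE; rewrite /hausdorff_measure.
  rewrite (_ : lim _ = 0%E) ?ltxx//; apply/cvg_lim => //.
  apply: cvg_near_cst; apply: filterS (nbhs_right_gt (0 : R)) => d d0; apply/eqP; rewrite eq_le hausdorff_delta_ge0 andbT.
  rewrite leNgt; apply/negP => k; by apply: (h d).
pose F x := hausdorff_delta (@abs_dist R) beta delta (E `&` `]-oo, x]).
have F0 x : (0 <= F x)%E by exact: hausdorff_delta_ge0.
have Flt x : x < a -> F x = 0%E.
  move=> xa; rewrite /F (_ : _ `&` _ = set0).
    by apply: hausdorff_delta_set0 => //; exact: ltW.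
  apply/seteqP; split => // z [/Eab/=]; rewrite !in_itv/= => /andP[az _] zx.
  by move: (le_lt_trans zx xa); rewrite ltNge az.
have Fmono x y : x <= y -> (F x <= F y)%E.
  move=> xy; apply: hausdorff_delta_le; apply: setIS => z /=.
  by rewrite !in_itv/= => /le_trans; apply.
have Fstep x y r : x <= y -> y - x < r -> 0 <= r <= delta ->
    (F y <= F x + ((2 * r) `^ beta)%:E)%E.
  move=> xy yxr rd; apply: (@hausdorff_delta_cons _ _ _ _ _ _ _ y) => // z [Ez].
  rewrite /= in_itv/= => zy; have [zx|xz] := leP z x.
    by left; split; rewrite //= in_itv.
  right; rewrite /oball /abs_dist /= ger0_norm ?subr_ge0//.
  by apply: le_lt_trans yxr; rewrite lerD2l lerN2 ltW.
have Ffin x : F x \is a fin_num.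
  rewrite ge0_fin_numE//.
  (* Start just left of [a], where [F] is 0; each step of length [delta / 2] adds a finite
     amount. *)
  have h (n : nat) : (F (a + n%:R * (delta / 2) - delta / 4)%R < +oo)%E.
    elim: n => [|n IH].
      rewrite mul0r addr0 Flt ?ltry// gtrBl divr_gt0//.
    apply: (@le_lt_trans _ _ (F (a + n%:R * (delta / 2) - delta / 4)%R + ((2 * delta) `^ beta)%:E)%E).
      have -> : a + n.+1%:R * (delta / 2) - delta / 4 =
        a + n%:R * (delta / 2) - delta / 4 + delta / 2 by rewrite -natr1; field.
      by apply: Fstep; [lra|lra|rewrite lexx (ltW delta0)].
    by rewrite lte_add_pinfty// ltry.
  pose n := (Num.trunc (`|(x - a + delta) / (delta / 2)|)).+1.
  apply: le_lt_trans (h n); apply: Fmono.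
  have : (x - a + delta) / (delta / 2) < n%:R.
    by apply: (le_lt_trans (ler_norm _)); rewrite /n; apply: real_truncnS_gt; exact: num_real.
  rewrite ltr_pdivrMr ?divr_gt0//; lra.
pose g x := fine (F x).
have gE x : (g x)%:E = F x by rewrite fineK.
have FbE : F b = hausdorff_delta (@abs_dist R) beta delta E.
  rewrite /F (_ : _ `&` _ = E)//; apply/seteqP; split => [z []//|z Ez]; split => //=.
  by have := Eab _ Ez; rewrite /= !in_itv/= => /andP[].
have gb : 0 < g b by rewrite -lte_fin gE FbE.
have gmax x : g x <= g b.
  by rewrite -lee_fin !gE FbE; apply: hausdorff_delta_le => z [].
have g0 x : 0 <= g x by rewrite -lee_fin gE.
have gmono x y : x <= y -> g x <= g y.
  by move=> xy; rewrite -lee_fin !gE; exact: Fmono.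
have d2 : 0 < delta / 2 by rewrite divr_gt0.
have C20 : 0 < g b / (delta / 2) `^ beta by rewrite divr_gt0// powR_gt0.
have C10 : 0 < 4 `^ beta :> R by rewrite powR_gt0.
(* The first summand serves increments over at most [delta / 2], covered by one ball of radius
   [2 * (y - x)]; the second serves longer ones, bounded by the total mass [g b]. *)
exists g, (4 `^ beta + g b / (delta / 2) `^ beta); split => //.
- by rewrite addr_gt0.
- by move=> x xa; rewrite /g Flt.
move=> x y xy; split; first exact: gmono.
- have [->|xny] := eqVneq x y.
    by rewrite !subrr powR0 ?mulr0// gt_eqF.
  have yx : 0 < y - x by rewrite subr_gt0 lt_neqAle xny.
  rewrite mulrDl.
  have h0 : 0 <= (y - x) `^ beta by exact: powR_ge0.
  have [yxd|dyx] := leP (y - x) (delta / 2).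
    apply: (@le_trans _ _ (4 `^ beta * (y - x) `^ beta)); last first.
      by rewrite lerDl mulr_ge0// ltW.
    rewrite -powRM// ?subr_ge0//; rewrite lerBlDl.
    rewrite -lee_fin EFinD !gE.
    have -> : 4 * (y - x) = 2 * (2 * (y - x)) by ring.
    by apply: Fstep => //; [lra|apply/andP; split; lra].
  apply: (@le_trans _ _ (g b / (delta / 2) `^ beta * (y - x) `^ beta)); last first.
    by rewrite lerDr mulr_ge0// ltW.
  apply: (@le_trans _ _ (g b)); first by rewrite (le_trans _ (gmax y))// gerBl.
  rewrite -mulrA ler_peMr ?(ltW gb)// mulrC ler_pdivlMr ?powR_gt0// mul1r.
  by apply: ge0_ler_powR; rewrite ?nnegrE ?(ltW beta0) ?(ltW d2) ?(ltW yx) ?(ltW dyx).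
- move=> nE; apply/eqP; rewrite eq_le (gmono _ _ xy) andbT -lee_fin !gE.
  apply: hausdorff_delta_le => z [Ez]; rewrite /= !in_itv/= => zy; split => //=.
  by rewrite leNgt; apply/negP => xz; exact: (nE z).
Qed.

Lemma half_pow_lt (R : realType) (h : R) : 0 < h -> exists n : nat, 2^-1 ^+ n < h.
Proof.
move=> h0; exists (Num.trunc h^-1).+1.
rewrite exprVn -[ltRHS]invrK ltf_pV2 ?posrE ?invr_gt0 ?exprn_gt0//.
apply: (@lt_le_trans _ _ (Num.trunc h^-1).+1%:R).
  by apply: real_truncnS_gt; exact: num_real.
by rewrite -natrX ler_nat ltnW// ltn_expl.
Qed.

(** The single scale with 2^(-l-1) < u <= 2^(-l) is enough. Summing over all scales with indicators
    makes the scales independent of [u], so that the sum can be exchanged with one over points. *)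
Lemma dyadic_power_le (R : realType) (beta u : R) (L : nat) : 0 < beta ->
  2^-1 ^+ L < u -> u <= 1 ->
  u `^ (- beta) <=
    2 `^ beta * \sum_(l < L) (2^-1 ^+ l) `^ (- beta) * (u <= 2^-1 ^+ l)%R%:R.
Proof.
move=> b0 Lu u1.
have u0 : 0 < u by apply: le_lt_trans Lu; rewrite exprn_ge0.
have L0 : (0 < L)%N.
  by case: L Lu => [|//]; rewrite expr0 => /(le_lt_trans u1); rewrite ltxx.
have ex : exists l, 2^-1 ^+ l.+1 < u by exists L.-1; rewrite prednK.
case: (ex_minnP ex) => l lu lmin.
have lL : (l < L)%N by have := lmin L.-1; rewrite prednK// => /(_ Lu) /leq_ltn_trans; apply; rewrite prednK.
have ul : u <= 2^-1 ^+ l.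
  case: l lu lmin lL => [|l] lu lmin lL; first by rewrite expr0.
  by rewrite leNgt; apply/negP => /lmin; rewrite ltnn.
have t0 (i : nat) : 0 <= (2^-1 ^+ i) `^ (- beta) * (u <= 2^-1 ^+ i)%R%:R :> R.
  by rewrite mulr_ge0// powR_ge0.
apply: (@le_trans _ _ (2 `^ beta * ((2^-1 ^+ l) `^ (- beta) * (u <= 2^-1 ^+ l)%R%:R))); last first.
  rewrite ler_wpM2l ?powR_ge0// (bigD1 (Ordinal lL))//= lerDl.
  by apply: sumr_ge0.
rewrite ul mulr1.
have -> : 2 `^ beta = (2^-1 : R) `^ (- beta).
  by rewrite -[in RHS]powR_inv1// -powRrM mulN1r opprK.
rewrite -powRM ?exprn_ge0// -exprS !powRN lef_pV2 ?posrE ?powR_gt0 ?exprn_gt0//.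
by apply: ge0_ler_powR; rewrite ?nnegrE ?exprn_ge0//; exact: ltW.
Qed.

Lemma geometric_sum_le (R : realType) (z : R) (L : nat) : 0 <= z < 1 ->
  \sum_(l < L) z ^+ l <= (1 - z)^-1.
Proof.
move=> /andP[z0 z1]; have z1' : 0 < 1 - z by rewrite subr_gt0.
rewrite -[leLHS](mulfK (_ : 1 - z != 0)) ?gt_eqF// ler_piMl ?invr_ge0 ?(ltW z1')//.
have := subrX1 z L; rewrite -opprB => /eqP; rewrite -eqr_opp opprK -mulNr opprB => /eqP h.
by rewrite mulrC -h gerBl exprn_ge0.
Qed.

Lemma half_powR_lt1 (R : realType) (s : R) : 0 < s -> 2^-1 `^ s < 1.
Proof.
move=> s0; have h : 2^-1 < 1 :> R by lra.
have := gt0_ltr_powR s0 _ _ h; rewrite powR1; apply; rewrite nnegrE//.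
Qed.

Section frostman_sum.
Context (R : realType) (g : R -> R) (C beta beta1 h x0 : R) (N : nat) (t : 'I_N -> R).
Hypothesis C0 : 0 < C.
Hypothesis beta0 : 0 < beta.
Hypothesis beta01 : beta < beta1.
Hypothesis h0 : 0 < h.
Hypothesis gmono : forall x y : R, x <= y -> g x <= g y.
Hypothesis gholder : forall x y : R, x <= y -> g y - g x <= C * (y - x) `^ beta1.
Let x (j : nat) : R := x0 + j%:R * h.
Let p (j : nat) := g (x j.+1) - g (x j).
Hypothesis tx : forall k : 'I_N, p k != 0 -> x k < t k <= x k.+1.

Let xS j : x j.+1 = x j + h.
Proof. by rewrite /x -natr1; ring. Qed.

Let p0 j : 0 <= p j.
Proof. by rewrite subr_ge0 gmono// xS lerDl ltW. Qed.

(** Cells have length [h <= rho], so every weighted cell whose point is within [rho] of [s] lies in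
    [lo, hi], an interval of length [4 * rho]. *)
Lemma frostman_ball (s rho : R) : h <= rho ->
  \sum_(k < N) p k * (`|s - t k| <= rho)%R%:R <= C * (4 * rho) `^ beta1.
Proof.
move=> hrho; have rho0 : 0 < rho by exact: lt_le_trans hrho.
pose lo := s - 2 * rho; pose hi := s + 2 * rho.
(* Clipping to [lo, hi] leaves the increments over these cells unchanged and all others nonnegative,
   so the sum over all cells can be telescoped. *)
pose G y := g (Num.max lo (Num.min y hi)).
have lohi : lo <= hi by rewrite /lo /hi; lra.
have Gmono y z : y <= z -> G y <= G z.
  by move=> yz; apply: gmono; rewrite ge_max !le_max lexx/= le_min !ge_min yz lexx !orbT.
apply: (@le_trans _ _ (\sum_(0 <= k < N) (G (x k.+1) - G (x k)))).
  rewrite big_mkord; apply: ler_sum => k _.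
  have dG : 0 <= G (x k.+1) - G (x k) by rewrite subr_ge0 Gmono// xS lerDl ltW.
  have [->|pk0] := eqVneq (p k) 0; first by rewrite mul0r.
  case: (boolP (_ <= rho)) => [stk|_]; last by rewrite mulr0.
  have /andP[t1 t2] := tx pk0; rewrite mulr1 /p /G.
  move: stk; rewrite ler_norml => /andP[s1 s2].
  have := xS k => xSk.
  have e1 : Num.max lo (Num.min (x k) hi) = x k.
    have -> : Num.min (x k) hi = x k by apply/min_idPl; rewrite /hi; lra.
    by apply/max_idPr; rewrite /lo; lra.
  have e2 : Num.max lo (Num.min (x k.+1) hi) = x k.+1.
    have -> : Num.min (x k.+1) hi = x k.+1 by apply/min_idPl; rewrite /hi; lra.
    by apply/max_idPr; rewrite /lo; lra.
  by rewrite e1 e2.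
rewrite telescope_sumr//.
have -> : 4 * rho = hi - lo by rewrite /hi /lo; ring.
apply: le_trans (gholder lohi); apply: lerB; apply: gmono.
  by rewrite ge_max lohi ge_min lexx orbT.
by rewrite le_max lexx.
Qed.

(** A dyadic scale 2^(-l) >= h contributes 2^(l beta) times a mass of order 2^(-l beta1); finer
    scales contribute nothing, because the kernel is cut off at [h]. As [beta < beta1], the series
    is geometric. *)
Lemma frostman_energy (s : R) : h <= 1 -> (forall k, `|s - t k| <= 1) ->
  \sum_(k < N) p k * (Num.max `|s - t k| h) `^ (- beta) <=
   2 `^ beta * (C * 4 `^ beta1) * (1 - 2^-1 `^ (beta1 - beta))^-1.
Proof.
move=> h1 st1; have [L Lh] := half_pow_lt h0.
have b10 : 0 < beta1 by exact: lt_trans beta01.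
pose q (l : nat) : R := 2^-1 ^+ l.
have q0 l : 0 < q l by rewrite exprn_gt0.
apply: (@le_trans _ _ (\sum_(k < N) p k * (2 `^ beta * \sum_(l < L)
   (q l) `^ (- beta) * (Num.max `|s - t k| h <= q l)%R%:R))).
  apply: ler_sum => k _; rewrite ler_wpM2l//; apply: dyadic_power_le => //.
    by rewrite (lt_le_trans Lh)// le_max lexx orbT.
  by rewrite ge_max st1.
have -> : \sum_(k < N) p k * (2 `^ beta * \sum_(l < L)
   (q l) `^ (- beta) * (Num.max `|s - t k| h <= q l)%R%:R) =
   2 `^ beta * \sum_(l < L) (q l) `^ (- beta) *
      \sum_(k < N) p k * (Num.max `|s - t k| h <= q l)%R%:R.
  rewrite big_distrr/=.
  under eq_bigr do rewrite mulrCA big_distrr/=.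
  rewrite -big_distrr/= exchange_big/= -big_distrr/=; congr (_ * _).
  apply: eq_bigr => l _; rewrite big_distrr/=; apply: eq_bigr => k _; ring.
rewrite -!mulrA ler_wpM2l ?powR_ge0//.
apply: (@le_trans _ _ (\sum_(l < L) C * 4 `^ beta1 * (2^-1 `^ (beta1 - beta)) ^+ l)).
  apply: ler_sum => l _.
  have -> : C * 4 `^ beta1 * 2^-1 `^ (beta1 - beta) ^+ l =
    (q l) `^ (- beta) * (C * (4 * q l) `^ beta1).
    rewrite powRM ?(ltW (q0 l))//.
    have -> : (2^-1 `^ (beta1 - beta)) ^+ l = (q l) `^ beta1 * (q l) `^ (- beta).
      rewrite -powRD ?(gt_eqF (q0 l)) ?implybT//.
      have h20 : (0 : R) <= 2^-1 by rewrite invr_ge0.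
      by rewrite /q -(powR_mulrn l (powR_ge0 _ _)) -(powR_mulrn l h20) -!powRrM mulrC.
    ring.
  rewrite ler_wpM2l ?powR_ge0//.
  have [hq|qh] := leP h (q l).
    apply: le_trans (frostman_ball s hq); apply: ler_sum => k _.
    by rewrite ler_wpM2l// ge_max hq andbT.
  rewrite big1 ?mulr_ge0 ?powR_ge0 ?(ltW C0)// => k _.
  by rewrite ge_max [h <= _]leNgt qh andbF mulr0.
rewrite -big_distrr/= -mulrA ler_wpM2l ?(ltW C0)// ler_wpM2l ?powR_ge0//.
by apply: geometric_sum_le; rewrite powR_ge0/= half_powR_lt1// subr_gt0.
Qed.

End frostman_sum.

Lemma frostman_weights (R : realType) (a b beta beta1 : R) (E : set R) :
  0 < beta -> beta < beta1 -> a < b -> b - a <= 1 -> E `<=` `[a, b] ->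
  (0 < hausdorff_measure (@abs_dist R) beta1 E)%E ->
  exists (m C : R), [/\ 0 < m, 0 < C & forall n : nat,
    let h := (b - a) / n.+1%:R in
    exists (t p : 'I_n.+2 -> R), [/\ forall k, E (t k), forall k, 0 <= p k,
      \sum_k p k = m &
      \sum_j \sum_k p j * p k * (Num.max `|t j - t k| h) `^ (- beta) <= C]].
Proof.
move=> b0 b01 ab ab1 Eab mE; have b10 : 0 < beta1 by exact: lt_trans b01.
have [g [C [C0 gb ga gP]]] := frostman_line b10 (ltW ab) Eab mE.
pose D := 2 `^ beta * (C * 4 `^ beta1) * (1 - 2^-1 `^ (beta1 - beta))^-1.
have [e0 Ee0] : exists e0, E e0.
  apply: contrapT => /forallNP nE.
  have ab' : a - 1 <= b by lra.
  have [_ _ /(_ (fun z _ _ => nE z)) e] := gP _ _ ab'.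
  by move: gb; rewrite e ga ?ltxx// gtrBl.
have z1 : 2^-1 `^ (beta1 - beta) < 1 :> R by rewrite half_powR_lt1// subr_gt0.
have D0 : 0 < D by rewrite !mulr_gt0 ?powR_gt0// invr_gt0 subr_gt0.
exists (g b), (g b * D); split => //; first by rewrite mulr_gt0.
move=> n h.
have h0 : 0 < h by rewrite divr_gt0// subr_gt0.
have nh : n.+1%:R * h = b - a by rewrite /h mulrC divfK.
have h1 : h <= 1.
  apply: le_trans ab1; rewrite -nh ler_peMl ?(ltW h0)// ler1n//.
(* The grid starts one cell to the left of [a], where [g] is known to vanish, so that the weights
   add up to [g b]; hence [n.+2] cells. *)
pose x (j : nat) : R := (a - h) + j%:R * h.
pose p (j : nat) := g (x j.+1) - g (x j).
have xS j : x j.+1 = x j + h by rewrite /x -natr1; ring.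
(* A cell without points of [E] carries no weight. There the default value [e0] is used, which keeps
   [t k] in [E]. *)
pose t (k : 'I_n.+2) := xget e0 [set z | E z /\ x k < z <= x k.+1].
have tE (k : 'I_n.+2) : E (t k).
  by rewrite /t; case: xgetP => [z _ []|].
have tx (k : 'I_n.+2) : p k != 0 -> x k < t k <= x k.+1.
  move=> pk; rewrite /t; case: xgetP => [z _ []//|nz]; exfalso; move/eqP: pk; apply.
  have xx : x k <= x k.+1 by rewrite xS lerDl ltW.
  have [_ _ hh] := gP _ _ xx; rewrite /p hh ?subrr// => z xz zx Ez.
  by apply: (nz z); split => //; rewrite xz.
have p0 j : 0 <= p j.
  have xx : x j <= x j.+1 by rewrite xS lerDl ltW.
  by have [h2 _ _] := gP _ _ xx; rewrite subr_ge0.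
have ps : \sum_(k < n.+2) p k = g b.
  rewrite -(big_mkord xpredT p) /p telescope_sumr//.
  rewrite [g (x 0%N)]ga ?subr0; last by rewrite /x mul0r addr0 gtrBl.
  by congr g; rewrite /x -natr1 mulrDl nh; ring.
exists t, (fun k : 'I_n.+2 => p k); split => //.
have gm y z : y <= z -> g y <= g z by move=> yz; have [] := gP _ _ yz.
have gh y z : y <= z -> g z - g y <= C * (z - y) `^ beta1 by move=> yz; have [] := gP _ _ yz.
apply: (@le_trans _ _ (\sum_(j < n.+2) p j * D)); last by rewrite -big_distrl/= ps.
apply: ler_sum => j _.
have tt k : `|t j - t k| <= 1.
  have := Eab _ (tE j); have := Eab _ (tE k); rewrite /= !in_itv/=.
  by move=> /andP[k1 k2] /andP[k3 k4]; rewrite ler_norml; apply/andP; split; lra.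
have := ler_wpM2l (p0 j) (frostman_energy C0 b0 b01 h0 gm gh tx h1 tt).
apply: le_trans; rewrite big_distrr/= le_eqVlt; apply/orP; left; apply/eqP.
by apply: eq_bigr => k _; rewrite mulrA.
Qed.

(** * The lower bound *)

Lemma compact_net (T : ptopologicalType) (A : set T) (U : T -> set T) :
  compact A -> (forall x, nbhs x (U x)) -> exists s : seq T,
    (forall x, x \in s -> A x) /\ (forall y, A y -> exists2 x, x \in s & U x y).
Proof.
rewrite compact_cover => cA nU.
have [|x Ax|D DA AD] := cA T A (fun x => (U x)^°).
- by move=> x _; exact: open_interior.
- by exists x => //; exact: nU.
have /finite_seqP[s sE] : finite_set [set` D] by exact: finite_fset.
have sD x : (x \in s) = true <-> [set` D] x by rewrite sE.
exists s; split=> [x /sD /DA|y /AD[x /sD xD yx]]; first exact: set_mem.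
by exists x => //; exact: interior_subset yx.
Qed.

(** The integral of a nonnegative function is a supremum over the simple functions below it.
    Monotonicity in this form applies to the Riesz kernel and to its inner integral without
    establishing their measurability. *)
Lemma ge0_le_integral_any (R : realType) (disp : measure_display)
    (T : measurableType disp) (mu : {measure set T -> \bar R}) (f1 f2 : T -> \bar R) :
  (forall x, 0 <= f1 x)%E -> (forall x, f1 x <= f2 x)%E ->
  (\int[mu]_x f1 x <= \int[mu]_x f2 x)%E.
Proof.
move=> f10 f12; rewrite !ge0_integralTE//; last first.
  by move=> x; exact: le_trans (f12 x).
by apply: ereal_sup_le => _ [h hf <-]; exists h => // x; exact: le_trans (hf x) (f12 x).
Qed.

Lemma integral_ge_partition (R : realType) (disp : measure_display)
    (T : measurableType disp) (mu : probability T R) (n : nat)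
    (Q : nat -> set T) (c : 'I_n -> R) (f : T -> \bar R) :
  trivIset setT Q -> (forall i, measurable (Q i)) -> (forall i, 0 <= c i) ->
  (forall x, 0 <= f x)%E -> (forall (i : 'I_n) x, Q i x -> ((c i)%:E <= f x)%E) ->
  ((\sum_i c i * fine (mu (Q i)))%:E <= \int[mu]_x f x)%E.
Proof.
move=> tQ mQ c0 f0 cf.
have -> : (\sum_i c i * fine (mu (Q i)))%:E =
   (\int[mu]_x (\sum_(i < n) (c i * \1_(Q i) x)%:E))%E.
  rewrite ge0_integral_sum//=.
  - rewrite -sumEFin; apply: eq_bigr => i _.
    have ci := c0 i; under eq_integral do rewrite EFinM.
    rewrite ge0_integralZl//; last by apply/measurable_EFinP; exact: measurable_indic.
    by rewrite integral_indic// setIT EFinM fineK//; exact: fin_num_measure.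
  - by move=> i; apply/measurable_EFinP; apply: measurable_funM => //; exact: measurable_indic.
  - by move=> i x _; rewrite lee_fin mulr_ge0.
apply: ge0_le_integral_any => x.
  by apply: sume_ge0 => i _; rewrite lee_fin mulr_ge0.
have [[i Qix]|nQ] := pselect (exists i : 'I_n, Q i x).
  rewrite (bigD1 i)//= big1 ?adde0.
    by rewrite indicE mem_set// mulr1; exact: cf.
  move=> j ji; rewrite indicE memNset ?mulr0// => Qjx; move/eqP: ji; apply; apply/val_inj.
  by apply: (tQ j i) => //; exists x.
rewrite big1// => i _; rewrite indicE memNset ?mulr0// => Qix.
by apply: nQ; exists i.
Qed.

Lemma euclid_norm_le (R : realType) (d : nat) (x : 'rV[R]_d) (r : R) : 0 <= r ->
  (forall i, `|x ord0 i| <= r) -> euclid_norm x <= d%:R * r.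
Proof.
move=> r0 xr; rewrite -[leRHS]ger0_norm ?mulr_ge0// -sqrtr_sqr ler_wsqrtr//.
apply: (@le_trans _ _ (\sum_(i < d) r ^+ 2)).
  by apply: ler_sum => i _; rewrite -[_ ^+ 2]real_normK ?num_real// lerXn2r ?nnegrE.
rewrite sumr_const card_ord -[leLHS]mulr_natl exprMn ler_wpM2r ?sqr_ge0//.
by rewrite -natrX ler_nat; case: d x xr => // d _ _; rewrite leq_pmulr.
Qed.

Lemma coord_le_euclid_norm (R : realType) (d : nat) (x : 'rV[R]_d) (i : 'I_d) :
  `|x ord0 i| <= euclid_norm x.
Proof.
rewrite -sqrtr_sqr ler_wsqrtr// (bigD1 i)//= lerDl.
by apply: sumr_ge0 => j _; exact: sqr_ge0.
Qed.

Lemma coord_le_norm (R : realType) (d : nat) (x : 'rV[R]_d) (i : 'I_d) :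
  `|x ord0 i| <= `|x|.
Proof.
rewrite -[leRHS]/(mx_norm x) mx_normrE.
exact: (le_bigmax _ (fun k : 'I_1 * 'I_d => `|x k.1 k.2|) (ord0, i)).
Qed.

Lemma norm_coord_exists (R : realType) (d : nat) (x : 'rV[R]_d) : (0 < d)%N ->
  exists i : 'I_d, `|x| = `|x ord0 i|.
Proof.
move=> d0; have [x0|xn0] := eqVneq `|x| 0.
  exists (Ordinal d0); apply/eqP; rewrite eq_le coord_le_norm andbT.
  by rewrite [leLHS]x0.
have [[i j] e] := mx_norm_neq0 xn0.
by exists j; rewrite -[LHS]/(mx_norm x) e/= (ord1 i).
Qed.

Lemma measurable_open_borelRn (R : realType) (d : nat) (A : set 'rV[R]_d) : open A ->
  measurable (A : set (borelRn R d)).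
Proof. by move=> oA; exact: sub_sigma_algebra. Qed.

Lemma measurable_compact_borelRn (R : realType) (d : nat) (A : set 'rV[R]_d) : compact A ->
  measurable (A : set (borelRn R d)).
Proof.
move=> cA; rewrite -[A]setCK; apply: measurableC; apply: measurable_open_borelRn.
by apply: closed_openC; apply: compact_closed => //; exact: norm_hausdorff.
Qed.

(** Small balls around a net of [F] are made disjoint, and the mass of each cell is placed at its
    net point. The energy is then at least a lower sum of the kernel over pairs of cells; cutting
    the distance off at [e] also treats the diagonal. *)
Lemma energy_partition (R : realType) (d : nat) (gam e : R) (F : set 'rV[R]_d)
    (mu : probability (borelRn R d) R) : (0 < d)%N -> 0 < gam -> 0 < e -> compact F ->
  mu.-negligible (~` F) ->
  exists (n : nat) (q : 'I_n -> R) (x : 'I_n -> 'rV[R]_d),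
    [/\ forall k, F (x k), forall k, 0 <= q k, \sum_k q k = 1 &
     ((\sum_k \sum_l q k * q l *
       (3 * d%:R * Num.max `|x k - x l| e) `^ (- gam))%:E <= energy gam mu)%E].
Proof.
move=> d0 gam0 e0 cF nF.
have [s [sF Fs]] := compact_net cF (fun x => nbhsx_ballx x e e0).
have mF := measurable_compact_borelRn cF.
have muF : mu F = 1%E.
  have m0 : mu (~` F) = 0%E by apply/negligibleP => //; exact: measurableC.
  by rewrite -[F]setCK probability_setC ?m0 ?sube0//; exact: measurableC.
have [x0 Fx0] : exists x0, F x0.
  apply: contrapT => /forallNP h; have F0 : F = set0 by apply/seteqP; split => // z /h.
  by move: muF; rewrite F0 measure0 => /eqP; rewrite eq_sym onee_eq0.
pose n := size s.
(* Padding with empty sets indexes the cells by [nat], as [seqDU] expects. *)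
pose G (k : nat) : set (borelRn R d) :=
  if (k < n)%N then F `&` ball (nth x0 s k) e else set0.
have mG k : measurable (G k).
  rewrite /G; case: ifP => // _; apply: measurableI => //.
  by apply: measurable_open_borelRn; exact: ball_open.
pose Q := seqDU G.
have mQ k : measurable (Q k) by exact: seqDU_measurable.
have tQ : trivIset setT Q by exact: trivIset_seqDU.
have QG k : Q k `<=` G k by exact: subset_seqDU.
have Qball (k : 'I_n) u : Q k u -> forall i, `|nth x0 s k ord0 i - u ord0 i| < e.
  move=> /QG; rewrite /G ltn_ord => -[_ h] i.
  apply: le_lt_trans (_ : `|nth x0 s k - u| < e).
    by have := coord_le_norm (nth x0 s k - u) i; rewrite !mxE.
  by move: h; rewrite -ball_normE.
have FG : F = \big[setU/set0]_(k < n) Q k.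
  rewrite -bigsetU_seqDU -bigcup_mkord; apply/seteqP; split => u.
    move=> Fu; have [z zs zu] := Fs _ Fu; exists (index z s); first by rewrite /= index_mem.
    by rewrite /G index_mem zs nth_index.
  by move=> [k /= kn]; rewrite /G kn => -[].
exists n, (fun k : 'I_n => fine (mu (Q k))), (fun k : 'I_n => nth x0 s k); split.
- by move=> k; apply: sF; exact: mem_nth.
- by move=> k; exact: fine_ge0.
- apply: EFin_inj; rewrite -sumEFin -muF.
  have -> : mu F = (\sum_(k < n) mu (Q k))%E.
    rewrite [in LHS]FG measure_semi_additive_ord_I//; first exact: sub_trivIset tQ.
    by apply: bigsetU_measurable.
  by apply: eq_bigr => k _; rewrite fineK//; exact: fin_num_measure.
pose x (k : 'I_n) := nth x0 s k.
pose kap (k l : 'I_n) := (3 * d%:R * Num.max `|x k - x l| e) `^ (- gam).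
have k0 k l : 0 <= kap k l by exact: powR_ge0.
have kern (k l : 'I_n) u v : Q k u -> Q l v -> ((kap k l)%:E <= riesz_kernel gam u v)%E.
  move=> /Qball Qu /Qball Qv; rewrite /riesz_kernel; case: ifPn => [_|uv]; first exact: leey.
  have P1 : 0 < 3 * d%:R * Num.max `|x k - x l| e.
    by rewrite !mulr_gt0 ?ltr0n// lt_max e0 orbT.
  have P2 : 0 < euclid_norm (u - v : 'rV[R]_d).
    apply: (@lt_le_trans _ _ `|(u - v : 'rV[R]_d)|); first by rewrite normr_gt0 subr_eq0.
    have [i ->] := norm_coord_exists (u - v : 'rV[R]_d) d0.
    exact: coord_le_euclid_norm.
  rewrite lee_fin /kap !powRN lef_pV2 ?posrE ?powR_gt0//.
  apply: ge0_ler_powR; rewrite ?nnegrE ?(ltW gam0) ?(ltW P1) ?(ltW P2)//.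
  (* Replacing two points by their net points changes each coordinate of the difference by less than
     [2 * e], which turns the maximum into at most three times itself; the factor [d] compares the
     Euclidean norm with the sup norm. *)
  apply: le_trans (_ : d%:R * (`|x k - x l| + 2 * e) <= _).
    apply: euclid_norm_le; first by rewrite addr_ge0// mulr_ge0// ltW.
        move=> i; rewrite !mxE; have := coord_le_norm (x k - x l) i; rewrite !mxE.
        have -> : u ord0 i - v ord0 i = (x k ord0 i - x l ord0 i) +
          (- (x k ord0 i - u ord0 i) + (x l ord0 i - v ord0 i)) by ring.
        move=> h; apply: (le_trans (ler_normD _ _)); apply: lerD => //.
        apply: (le_trans (ler_normD _ _)); rewrite normrN.
        by have := Qu i; have := Qv i; rewrite /x; lra.
      rewrite (mulrC 3) -mulrA ler_wpM2l//.
      have h1 : `|x k - x l| <= Num.max `|x k - x l| e by rewrite le_max lexx.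
      have h2 : e <= Num.max `|x k - x l| e by rewrite le_max lexx orbT.
      by move: h1 h2; set mm := Num.max _ _; lra.
have -> : \sum_(k < n) \sum_(l < n) fine (mu (Q k)) * fine (mu (Q l)) *
   (3 * d%:R * Num.max `|nth x0 s k - nth x0 s l| e) `^ (- gam) =
   \sum_(l < n) (\sum_(k < n) kap k l * fine (mu (Q k))) * fine (mu (Q l)).
  rewrite exchange_big; apply: eq_bigr => l _; rewrite big_distrl; apply: eq_bigr => k _ /=.
  by rewrite /kap /x mulrC mulrA.
have kge0 u v : (0 <= riesz_kernel gam u v)%E.
  by rewrite /riesz_kernel; case: ifP => // _; rewrite lee_fin powR_ge0.
apply: integral_ge_partition => //.
- by move=> l; apply: sumr_ge0 => k _; rewrite mulr_ge0// fine_ge0.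
- by move=> v; apply: integral_ge0 => u _.
- by move=> l v Qv; apply: integral_ge_partition => // k u Qu; exact: kern.
Qed.

(** * The hitting event: approximation and measurability *)

Lemma exists_pos_le (R : realType) (T : eqType) (s : seq T) (r : T -> R) :
  (forall x, x \in s -> 0 < r x) -> exists2 e : R, 0 < e & forall x, x \in s -> e <= r x.
Proof.
elim: s => [|y s IH] rs; first by exists 1.
have [|e e0 es] := IH; first by move=> x xs; apply: rs; rewrite inE xs orbT.
exists (Num.min e (r y)); first by rewrite lt_min e0 rs// mem_head.
move=> x; rewrite inE => /predU1P[->|/es xe]; first by rewrite ge_min lexx orbT.
by rewrite ge_min xe.
Qed.

(** Around each time the path keeps a fixed distance from the closed set [F], and a finite subcover
    makes this distance uniform. Contrapositively, approximate hits at every precision force a true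
    hit. *)
Lemma compact_gap (R : realType) (d : nat) (E : set R) (F : set 'rV[R]_d)
    (phi : R -> 'rV[R]_d) : compact E -> compact F ->
  (forall t, E t -> forall e : R, 0 < e -> exists2 r : R, 0 < r &
     forall u, E u -> `|t - u| < r -> `|phi u - phi t| < e) ->
  (forall t, E t -> ~ F (phi t)) ->
  exists2 e : R, 0 < e & forall t x, E t -> F x -> e <= `|phi t - x|.
Proof.
move=> cE cF cphi nhit.
have clF : closed F by apply: compact_closed => //; exact: norm_hausdorff.
have h t : exists re : R * R, [/\ 0 < re.1, 0 < re.2 & E t ->
    forall u x, E u -> F x -> `|t - u| < re.1 -> re.2 <= `|phi u - x|].
  have [Et|nEt] := pselect (E t); last by exists (1, 1).
  have : nbhs (phi t) (~` F) by apply: open_nbhs_nbhs; split; [exact: closed_openC|exact: nhit].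
  move=> /nbhs_ballP[e /= e0 eF].
  have [r r0 hr] := cphi t Et (e / 2) (divr_gt0 e0 (ltr0n _ 2)).
  exists (r, e / 2); split => //=; first by rewrite divr_gt0.
  move=> _ u x Eu Fx tu; rewrite leNgt; apply/negP => ux.
  apply: (eF x) => //; rewrite -ball_normE /= -(subrK (phi u) (phi t)) -addrA.
  apply: (le_lt_trans (ler_normD _ _)); rewrite [e]splitr ltrD// distrC.
  exact: hr.
have [re hre] := choice h.
have [|s [sE Es]] := @compact_net _ E (fun t => ball t (re t).1) cE.
  by move=> t; apply: nbhsx_ballx; have [] := hre t.
have [|e e0 es] := @exists_pos_le R _ s (fun t => (re t).2).
  by move=> t _; have [] := hre t.
exists e => // t x Et Fx; have [z zs zt] := Es t Et.
apply: (le_trans (es z zs)); have [_ _] := hre z.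
by apply => //; exact: sE.
Qed.

(** As [a < b], both suprema run over nonempty sets and are nonnegative, so neither exceeds their
    sum [K]. *)
Lemma holder_norm_bounds (R : realType) (d : nat) (a b H K : R) (f : R -> 'rV[R]_d) :
  a < b -> holder_norm `[a, b] H f = K%:E ->
  (forall t i, a <= t <= b -> `|f t ord0 i| <= K) /\
  (forall s t i, a <= s <= b -> a <= t <= b ->
     `|f t ord0 i - f s ord0 i| <= K * `|t - s| `^ H).
Proof.
move=> ab; rewrite /holder_norm; set S1 := ereal_sup _; set S2 := ereal_sup _ => SK.
have aI : `[a, b]%classic a by rewrite /= in_itv/= lexx ltW.
have bI : `[a, b]%classic b by rewrite /= in_itv/= lexx ltW.
have S1ub t : a <= t <= b -> ((euclid_norm (f t))%:E <= S1)%E.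
  by move=> tI; apply: ereal_sup_ubound; exists t => //=; rewrite in_itv.
have S2ub s t : a <= s <= b -> a <= t <= b -> s != t ->
    ((euclid_norm (f t - f s) / `|t - s| `^ H)%:E <= S2)%E.
  by move=> sI tI st; apply: ereal_sup_ubound; exists (s, t) => //=; rewrite !in_itv.
have S10 : (0 <= S1)%E.
  apply: (@le_trans _ _ (euclid_norm (f a))%:E); first by rewrite lee_fin sqrtr_ge0.
  by apply: S1ub; rewrite lexx ltW.
have S20 : (0 <= S2)%E.
  apply: (@le_trans _ _ (euclid_norm (f b - f a) / `|b - a| `^ H)%:E).
    by rewrite lee_fin divr_ge0 ?sqrtr_ge0// powR_ge0.
  by apply: S2ub; rewrite ?lexx ?(ltW ab)// lt_eqF.
have S1K : (S1 <= K%:E)%E by rewrite -SK leeDl.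
have S2K : (S2 <= K%:E)%E by rewrite -SK leeDr.
split => [t i tI|s t i sI tI].
  rewrite (le_trans (coord_le_euclid_norm _ _))//.
  by rewrite -lee_fin (le_trans (S1ub t tI)).
have [->|st] := eqVneq s t.
  rewrite !subrr normr0 mulr_ge0 ?powR_ge0// -lee_fin.
  exact: le_trans S10 S1K.
have ts : 0 < `|t - s| `^ H by rewrite powR_gt0// normr_gt0 subr_eq0 eq_sym.
have := coord_le_euclid_norm (f t - f s) i; rewrite !mxE => h; apply: (le_trans h).
rewrite -ler_pdivrMr// -lee_fin; exact: le_trans (S2ub s t sI tI st) S2K.
Qed.

Section hitting_event.
Context (R : realType) (d : nat) (H a b K : R) (E : set R) (F : set 'rV[R]_d).
Context (disp : measure_display) (Omega : measurableType disp) (P : probability Omega R).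
Variables (B : R -> Omega -> 'rV[R]_d) (f : R -> 'rV[R]_d).
Hypothesis d0 : (0 < d)%N.
Hypothesis H0 : 0 < H.
Hypothesis a0 : 0 < a.
Hypothesis b1 : b <= 1.
Hypothesis K0 : 0 <= K.
Hypothesis cE : compact E.
Hypothesis Eab : E `<=` `[a, b].
Hypothesis cF : compact F.
Hypothesis fB : fbm P H B.
Hypothesis hf : forall s t i, a <= s <= b -> a <= t <= b ->
  `|f t ord0 i - f s ord0 i| <= K * `|t - s| `^ H.

Let hit := [set w | ((fun t => (B t w + f t)%R) @` E) `&` F !=set0].

Let E01 t : E t -> 0 <= t <= 1.
Proof.
move=> /Eab /=; rewrite in_itv/= => /andP[h1 h2].
by rewrite (le_trans (ltW a0) h1)/= (le_trans h2).
Qed.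

Let EI t : E t -> a <= t <= b.
Proof. by move=> /Eab /=; rewrite in_itv. Qed.

Lemma path_continuity w t e : E t -> 0 < e -> exists2 r : R, 0 < r &
  forall u, E u -> `|t - u| < r -> `|(B u w + f u) - (B t w + f t)| < e.
Proof.
move=> Et e0.
have hi (i : 'I_d) : exists r : R, 0 < r /\ forall u, E u -> `|t - u| < r ->
    `|B u w ord0 i - B t w ord0 i| < e / 2.
  have [fBi _] := fB; have [_ _ _ /(_ w) cB] := fBi i.
  move/subspace_continuousP : cB => /(_ t) /=.
  rewrite in_itv/= (E01 Et) => /(_ isT) /cvgrPdist_lt /(_ (e / 2)).
  move=> /(_ (divr_gt0 e0 (ltr0n _ 2))).
  rewrite near_withinE => /nbhs_ballP[r /= r0 hr]; exists r; split => // u Eu tu.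
  by rewrite distrC; apply: hr => //=; rewrite in_itv/= E01.
have [rB hrB] := choice hi.
have [|r r0 rs] := @exists_pos_le R _ (enum 'I_d) rB.
  by move=> i _; have [] := hrB i.
(* Within time [r1] the drift moves by at most [e / 2]; dividing by [K + 1] covers [K = 0]. *)
pose r1 := (e / 2 / (K + 1)) `^ H^-1.
have K1 : 0 < K + 1 by rewrite ltr_wpDl.
have e2 : 0 < e / 2 / (K + 1) by rewrite !divr_gt0.
have r10 : 0 < r1 by rewrite powR_gt0.
exists (Num.min r r1); first by rewrite lt_min r0.
move=> u Eu; rewrite lt_min => /andP[tur tur1].
have [i ->] := norm_coord_exists ((B u w + f u) - (B t w + f t)) d0.
rewrite !mxE.
have -> : B u w ord0 i + f u ord0 i - (B t w ord0 i + f t ord0 i) =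
  (B u w ord0 i - B t w ord0 i) + (f u ord0 i - f t ord0 i) by ring.
apply: (le_lt_trans (ler_normD _ _)); rewrite [e]splitr ltr_leD//.
  have [_ h] := hrB i; apply: h => //; apply: (lt_le_trans tur).
  by apply: rs; rewrite mem_enum.
apply: (le_trans (hf _ (EI Et) (EI Eu))).
apply: (@le_trans _ _ ((K + 1) * r1 `^ H)).
  apply: ler_pM; rewrite ?powR_ge0// ?lerDl//.
  apply: ge0_ler_powR; rewrite ?nnegrE ?normr_ge0 ?(ltW H0) ?(ltW r10)//.
  by rewrite distrC ltW.
by rewrite /r1 -powRrM mulVf ?gt_eqF// powRr1 ?(ltW e2)// mulrC divfK// gt_eqF.
Qed.

Lemma hit_of_approx w :
  (forall n : nat, exists t x, [/\ E t, F x &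
     cube_event B t (n.+1%:R^-1) (x - f t) w]) -> hit w.
Proof.
move=> h; apply: contrapT => nh.
have [|e e0 he] := @compact_gap R d E F (fun t => B t w + f t) cE cF
  (fun t Et e e0 => path_continuity w Et e0).
  move=> t Et Ft; apply: nh; exists (B t w + f t); split => //.
  by exists t.
pose n := Num.trunc e^-1.
have ne : n.+1%:R^-1 < e.
  rewrite -[ltRHS]invrK ltf_pV2 ?posrE ?invr_gt0//.
  by apply: real_truncnS_gt; exact: num_real.
have [t [x [Et Fx cw]]] := h n.
have := he t x Et Fx; rewrite leNgt => /negP; apply.
apply: le_lt_trans ne.
have [i ->] := norm_coord_exists (B t w + f t - x) d0.
have := cw i I; rewrite /= !mxE.
by congr (`|_| <= _); ring.
Qed.

(** At each precision a hit is tested on a finite net of [F] and on finite nets of [E] of every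
    mesh, because the modulus of continuity depends on the path. Only countably many cube events
    occur, and [hit_of_approx] gives the converse inclusion. *)
Lemma measurable_hit : measurable hit.
Proof.
have pos (n : nat) : 0 < n.+1%:R^-1 / 2 :> R by rewrite divr_gt0.
have pos' (n : nat) : 0 < n.+1%:R^-1 :> R by rewrite invr_gt0.
have netE m := @compact_net _ E (fun t => ball t (m.+1%:R^-1 : R)) cE
  (fun t => nbhsx_ballx _ _ (pos' m)).
have netF n := @compact_net _ F (fun x => ball x (n.+1%:R^-1 / 2 : R)) cF
  (fun x => nbhsx_ballx _ _ (pos n)).
have [sE hE] := choice netE; have [sF hF] := choice netF.
have -> : hit = \bigcap_n \bigcup_m \bigcup_(t in [set` sE m]) \bigcup_(x in [set` sF n])
    cube_event B t (n.+1%:R^-1) (x - f t).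
  apply/seteqP; split => w.
    move=> [_ [[t Et <-] Ft]] n _.
    have [x xs xt] := (hF n).2 _ Ft.
    have [r r0 hr] := path_continuity w Et (pos n).
    pose m := Num.trunc r^-1.
    have mr : m.+1%:R^-1 < r.
      rewrite -[ltRHS]invrK ltf_pV2 ?posrE ?invr_gt0//.
      by apply: real_truncnS_gt; exact: num_real.
    have [u us ut] := (hE m).2 _ Et.
    exists m => //; exists u => //; exists x => // i _ /=.
    have Eu : E u by exact: (hE m).1.
    have tu : `|t - u| < r.
      by apply: lt_trans mr; move: ut; rewrite -ball_normE /= distrC.
    have h1 := hr u Eu tu.
    have h2 : `|x - (B t w + f t)| < n.+1%:R^-1 / 2 by move: xt; rewrite -ball_normE.
    have := coord_le_norm (B u w + f u - (B t w + f t)) i.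
    have := coord_le_norm (x - (B t w + f t)) i.
    rewrite !mxE => h3 h4.
    have -> : B u w ord0 i - (x ord0 i - f u ord0 i) =
      (B u w ord0 i + f u ord0 i - (B t w ord0 i + f t ord0 i)) -
      (x ord0 i - (B t w ord0 i + f t ord0 i)) by ring.
    apply: (le_trans (ler_normB _ _)); rewrite [n.+1%:R^-1]splitr.
    by apply: lerD; apply: ltW; [exact: le_lt_trans h1|exact: le_lt_trans h2].
  move=> h; apply: hit_of_approx => n.
  have [m _ [t ts [x xs cw]]] := h n I.
  by exists t, x; split => //; [exact: (hE m).1|exact: (hF n).1].
apply: bigcapT_measurable => n; apply: bigcupT_measurable => m.
apply: fin_bigcup_measurable => // t ts.
apply: fin_bigcup_measurable => // x xs.
by apply: (measurable_cube_event _ _ fB); apply: E01; exact: (hE m).1.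
Qed.

End hitting_event.

(** The exponent is split as d = gam + beta / H. The first part of the power of [L * mx] dominates
    max(rho, e)^gam, the second max(s, h)^beta, because max(s, h)^H <= L mx once e = h^H. *)
Lemma kernel_split (R : realType) (H gam beta L mx rho e s h : R) (d : nat) :
  0 < H -> 0 < beta -> 0 < gam -> d%:R = gam + beta / H -> 0 < L -> 0 < h -> 0 <= s -> e = h `^ H ->
  rho <= L * mx -> e <= L * mx -> s `^ H <= L * mx ->
  (mx ^+ d)^-1 <= L ^+ d * ((Num.max rho e) `^ (- gam) * (Num.max s h) `^ (- beta)).
Proof.
move=> H0 b0 g0 dE L0 h0 s0 eE rm em sm.
have e0 : 0 < e by rewrite eE powR_gt0.
have Lm0 : 0 < L * mx by exact: lt_le_trans em.
have mx0 : 0 < mx by rewrite pmulr_rgt0 in Lm0.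
have m1 : 0 < Num.max rho e by rewrite lt_max e0 orbT.
have m2 : 0 < Num.max s h by rewrite lt_max h0 orbT.
have h1 : (Num.max rho e) `^ gam <= (L * mx) `^ gam.
  by apply: ge0_ler_powR; rewrite ?nnegrE ?(ltW g0) ?(ltW m1) ?(ltW Lm0)// ge_max rm em.
have h2 : (Num.max s h) `^ beta <= (L * mx) `^ (beta / H).
  have bE : beta = H * (beta / H) by rewrite mulrCA divff ?mulr1// gt_eqF.
  rewrite [in leLHS]bE powRrM.
  apply: ge0_ler_powR; rewrite ?nnegrE ?powR_ge0 ?divr_ge0 ?(ltW b0) ?(ltW H0) ?(ltW Lm0)//.
  have [_|_] := leP s h; [by rewrite -eE|exact: sm].
rewrite !powRN -invfM -[X in _ * X^-1]mulrC -[L ^+ d]invrK -invfM lef_pV2 ?posrE; last 2 first.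
- by rewrite exprn_gt0.
- by rewrite mulr_gt0 ?invr_gt0 ?exprn_gt0// mulr_gt0 ?powR_gt0.
rewrite ler_pdivrMl ?exprn_gt0// -exprMn -powR_mulrn ?(ltW Lm0)// dE powRD ?(gt_eqF Lm0) ?implybT//.
by rewrite mulrC; apply: ler_pM; rewrite ?powR_ge0.
Qed.

Lemma hitting_lower_bound (R : realType) (d : nat) (H a b K beta beta1 : R)
    (E : set R) (F : set 'rV[R]_d) :
  (0 < d)%N -> 0 < H < 1 -> 0 < a -> a < b -> b <= 1 -> 0 <= K ->
  compact E -> E `<=` `[a, b] -> compact F ->
  0 < beta -> beta < beta1 -> 0 < d%:R - beta / H ->
  (0 < hausdorff_measure (@abs_dist R) beta1 E)%E ->
  exists2 c : R, 0 < c &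
    forall (disp : measure_display) (Omega : measurableType disp)
      (P : probability Omega R) (B : R -> Omega -> 'rV[R]_d) (f : R -> 'rV[R]_d),
      fbm P H B ->
      (forall t i, a <= t <= b -> `|f t ord0 i| <= K) ->
      (forall s t i, a <= s <= b -> a <= t <= b ->
         `|f t ord0 i - f s ord0 i| <= K * `|t - s| `^ H) ->
      forall (mu : probability (borelRn R d) R) (r : R), mu.-negligible (~` F) ->
        energy (d%:R - beta / H) mu = r%:E ->
        c <= fine (P [set w | ((fun t => (B t w + f t)%R) @` E) `&` F !=set0]) * r.
Proof.
move=> d0 H01 a0 ab b1 K0 cE Eab cF b0 b01 g0 mE; have [H0 H1] := andP H01.
have a1 : a <= 1 by rewrite (le_trans (ltW ab)).
have [MF MF0 hMF] : exists2 M : R, 0 <= M & forall x, F x -> `|x| <= M.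
  have /ex_strict_bound_gt0[M M0 hM] := compact_bounded cF.
  by exists M; [exact: ltW|move=> x /hM /ltW].
pose M := MF + K; have M0 : 0 <= M by rewrite addr_ge0.
have [cl cl0 hcl] := @cube_event_ge R d H a M H01 a0.
have [C C0 hC] := @cube_event_pair_le R d H a M H01 a0 a1 M0.
have bma : b - a <= 1 by lra.
have [m [CE [m0 CE0 hfw]]] := frostman_weights b0 b01 ab bma Eab mE.
pose gam := d%:R - beta / H.
have dE : d%:R = gam + beta / H by rewrite subrK.
pose L := 1 + K; have L0 : 0 < L by rewrite ltr_pwDl.
have dd0 : 0 < 3 * d%:R :> R by rewrite mulr_gt0// ltr0n.
(* The factors are those of the pair bound, of [kernel_split], of the Frostman energy, and of the
   comparison in [energy_partition]. *)
pose D := C * L ^+ d * CE * (3 * d%:R) `^ gam.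
have D0 : 0 < D by rewrite !mulr_gt0 ?exprn_gt0 ?powR_gt0.
exists ((m * cl) ^+ 2 / D); first by rewrite divr_gt0// exprn_gt0// mulr_gt0.
move=> disp Omega P B f fB fK fH mu r nmu Er.
set c := _ / D; have c0 : 0 < c by rewrite divr_gt0// exprn_gt0// mulr_gt0.
pose h (n : nat) := (b - a) / n.+1%:R.
have h0 n : 0 < h n by rewrite divr_gt0// subr_gt0.
have h1 n : h n <= 1.
  by apply: le_trans bma; rewrite ler_pdivrMr// ler_peMr ?subr_ge0 ?(ltW ab)// ler1n.
(* The spatial scale is tied to the time mesh by the self-similarity of the process; [kernel_split]
   relies on this. *)
pose e n := h n `^ H.
have e0 n : 0 < e n by rewrite powR_gt0.
have e1 n : e n <= 1.
  have -> : 1 = 1 `^ H :> R by rewrite powR1.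
  by apply: ge0_ler_powR; rewrite ?nnegrE ?(ltW H0) ?(ltW (h0 n)) ?h1.
have EI t : E t -> a <= t <= b by move=> /Eab /=; rewrite in_itv.
have E1 t : E t -> a <= t <= 1.
  by move=> /EI /andP[-> tb]; exact: le_trans b1.
have E01 t : E t -> 0 <= t <= 1.
  by move=> /E1 /andP[h2 ->]; rewrite (le_trans (ltW a0)).
have step n : exists U : set Omega, [/\ measurable U, c <= fine (P U) * r &
    forall w, U w -> exists t x, [/\ E t, F x & cube_event B t (e n) (x - f t) w]].
  have [t [p [tE p0 ps pE]]] := hfw n.
  have [N [q [x [xF q0 qs qE]]]] := energy_partition d0 g0 (e0 n) cF nmu.
  pose A (i : 'I_n.+2 * 'I_N) := cube_event B (t i.1) (e n) (x i.2 - f (t i.1)).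
  have mA i : measurable (A i) by apply: (measurable_cube_event _ _ fB); exact: E01.
  have xM (i : 'I_n.+2 * 'I_N) l : `|(x i.2 - f (t i.1)) ord0 l| <= M.
    rewrite !mxE (le_trans (ler_normB _ _))// lerD//; last exact: fK (EI _ (tE _)).
    by rewrite (le_trans (coord_le_norm _ _))// hMF.
  pose w (i : 'I_n.+2 * 'I_N) := p i.1 * q i.2.
  have w0 i : 0 <= w i by rewrite mulr_ge0.
  pose Q (i j : 'I_n.+2 * 'I_N) := C * (e n ^+ d) ^+ 2 * (L ^+ d *
    ((Num.max `|x i.2 - x j.2| (e n)) `^ (- gam) *
     (Num.max `|t i.1 - t j.1| (h n)) `^ (- beta))).
  have clp : 0 <= cl * e n ^+ d by rewrite mulr_ge0 ?exprn_ge0// ltW.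
  have Ce0 : 0 <= C * (e n ^+ d) ^+ 2 by rewrite pmulr_rge0// sqr_ge0.
  have AQ i j : (P (A i `&` A j) <= (Q i j)%:E)%E.
    have [l lE] := norm_coord_exists (x i.2 - x j.2) d0.
    apply: (le_trans (hC _ _ _ _ fB _ _ _ _ _ (E1 _ (tE i.1)) (E1 _ (tE j.1))
      (xM i) (xM j) (e0 n) l)).
    rewrite lee_fin /Q; set tau := Num.sqrt _; set Dl := `|_ - _|.
    have sg0 : 0 <= `|t j.1 - t i.1| `^ H by exact: powR_ge0.
    have te : e n <= tau.
      by rewrite -[leLHS](ger0_norm (ltW (e0 n))) -sqrtr_sqr ler_wsqrtr// lerDl sqr_ge0.
    have ts : `|t j.1 - t i.1| `^ H <= tau.
      by rewrite -[leLHS](ger0_norm sg0) -sqrtr_sqr ler_wsqrtr// lerDr sqr_ge0.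
    have h2 : tau <= Num.max tau Dl by rewrite le_max lexx.
    have h3 : Dl <= Num.max tau Dl by rewrite le_max lexx orbT.
    have tau0 : 0 <= tau by exact: sqrtr_ge0.
    (* The drifts at the two times differ by at most [K * tau], so passing from shifted to unshifted
       points costs the factor [L = 1 + K]. *)
    have h4 : `|x i.2 - x j.2| <= Dl + K * tau.
      rewrite lE.
      have -> : (x i.2 - x j.2) ord0 l = ((x i.2 - f (t i.1)) ord0 l - (x j.2 - f (t j.1)) ord0 l)
        - (f (t j.1) ord0 l - f (t i.1) ord0 l) by rewrite !mxE; ring.
      apply: (le_trans (ler_normB _ _)); rewrite lerD2l.
      apply: (le_trans (fH _ _ _ (EI _ (tE i.1)) (EI _ (tE j.1)))).
      by rewrite ler_wpM2l.
    have LM : tau <= L * Num.max tau Dl.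
      by apply: (le_trans h2); rewrite ler_peMl ?lerDl// (le_trans tau0).
    rewrite ler_wpM2l//.
    apply: (@kernel_split R H gam beta L (Num.max tau Dl) `|x i.2 - x j.2| (e n)
      `|t i.1 - t j.1| (h n) d) => //.
    - apply: (le_trans h4); rewrite /L mulrDl mul1r lerD//.
      by rewrite ler_wpM2l.
    - exact: le_trans LM.
    - by rewrite distrC; exact: le_trans LM.
  have := second_moment mA w0 clp
    (fun i _ => hcl _ _ _ _ fB _ _ _ (E1 _ (tE i.1)) (xM i) (e0 n) (e1 n))
    (fun i j _ _ => AQ i j).
  have -> : \sum_i w i = m.
    rewrite -(pair_bigA _ (fun i j => p i * q j))/=.
    under eq_bigr do rewrite -big_distrr/= qs mulr1.
    exact: ps.
  set U := \bigcup_i A i => sm.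
  have mU : measurable U by exact: fin_bigcup_measurable.
  exists U; split => //; last first.
    by move=> v [i _ Aiv]; exists (t i.1), (x i.2).
  have SQ : \sum_i \sum_j w i * w j * Q i j <= C * (e n ^+ d) ^+ 2 * (L ^+ d * (CE * ((3 * d%:R) `^ gam * r))).
    pose S1 := \sum_j \sum_k p j * p k * (Num.max `|t j - t k| (h n)) `^ (- beta).
    pose S2 := \sum_k \sum_l q k * q l * (Num.max `|x k - x l| (e n)) `^ (- gam).
    have -> : \sum_i \sum_j w i * w j * Q i j = C * (e n ^+ d) ^+ 2 * (L ^+ d * (S1 * S2)).
      rewrite -(pair_bigA _ (fun i1 i2 => \sum_j w (i1, i2) * w j * Q (i1, i2) j))/=.
      rewrite /S1 mulrA big_distrl/= big_distrr/=; apply: eq_bigr => i1 _.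
      rewrite /S2 big_distrr/= big_distrr/=; apply: eq_bigr => i2 _.
      rewrite -(pair_bigA _ (fun j1 j2 => w (i1, i2) * w (j1, j2) * Q (i1, i2) (j1, j2)))/=.
      rewrite big_distrl/= big_distrr/=; apply: eq_bigr => j1 _.
      rewrite big_distrr/= big_distrr/=; apply: eq_bigr => j2 _.
      rewrite /w /Q/=; ring.
    rewrite ler_wpM2l// ler_wpM2l ?exprn_ge0 ?(ltW L0)//.
    apply: ler_pM.
    - by apply: sumr_ge0 => j _; apply: sumr_ge0 => k _; rewrite !mulr_ge0 ?powR_ge0.
    - by apply: sumr_ge0 => j _; apply: sumr_ge0 => k _; rewrite !mulr_ge0 ?powR_ge0.
    - exact: pE.
    move: qE; rewrite Er lee_fin => qE.
    rewrite -ler_pdivrMl ?powR_gt0// -powRN; apply: le_trans qE.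
    rewrite /S2 big_distrr/= le_eqVlt; apply/orP; left; apply/eqP.
    apply: eq_bigr => k _; rewrite big_distrr/=; apply: eq_bigr => l _.
    rewrite [in RHS]powRM ?(ltW dd0) ?le_max ?(ltW (e0 n)) ?orbT//.
    by rewrite -/gam; ring.
  have PU0 : 0 <= fine (P U) by exact: fine_ge0.
  have := le_trans sm (ler_wpM2l PU0 SQ).
  have ed0 : 0 < (e n ^+ d) ^+ 2 by rewrite !exprn_gt0.
  have -> : (m * (cl * e n ^+ d)) ^+ 2 = (e n ^+ d) ^+ 2 * (m * cl) ^+ 2 by ring.
  have -> : fine (P U) * (C * (e n ^+ d) ^+ 2 * (L ^+ d * (CE * ((3 * d%:R) `^ gam * r)))) =
    (e n ^+ d) ^+ 2 * (fine (P U) * r * D) by rewrite /D; ring.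
  by rewrite ler_pM2l// /c ler_pdivrMr.
have [U hU] := choice step.
have mU n : measurable (U n) by have [] := hU n.
(* The intersection of the [V N] is the limit superior of the [U n]. Continuity from above keeps its
   probability at least [c / r], and on it approximate hits occur at arbitrarily small scales. *)
pose V N := \bigcup_(n in [set n | (N <= n)%N]) U n.
have mV N : measurable (V N) by apply: bigcup_measurable => n _.
have [_ h2 _] := hU 0%N.
have r0 : 0 < r.
  rewrite ltNge; apply/negP => rn.
  have : fine (P (U 0%N)) * r <= 0 by rewrite mulr_ge0_le0// fine_ge0.
  by move=> /(le_trans h2); rewrite leNgt c0.
have PV N : ((c / r)%:E <= P (V N))%E.
  have [_ hN _] := hU N; apply: (@le_trans _ _ (P (U N))).
    by rewrite -[leRHS]fineK ?fin_num_measure// lee_fin ler_pdivrMr.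
  apply: le_measure; [exact/mem_set/mU|exact/mem_set/mV|].
  by move=> v Uv; exists N => /=.
have mH := measurable_hit d0 H0 a0 b1 K0 cE Eab cF fB fH.
have sub : \bigcap_N V N `<=` [set w | ((fun t => (B t w + f t)%R) @` E) `&` F !=set0].
  move=> w Vw; apply: (hit_of_approx d0 H0 a0 b1 K0 cE Eab cF fB fH) => k.
  pose N1 := (Num.trunc ((b - a) / (k.+1%:R^-1 `^ H^-1))).+1.
  have [n /= Nn Unw] := Vw N1 I.
  have [_ _ /(_ w Unw) [t [x [Et Fx cw]]]] := hU n.
  exists t, x; split => // i _ /=; apply: (le_trans (cw i I)).
  have k0 : 0 < k.+1%:R^-1 `^ H^-1 :> R by rewrite powR_gt0// invr_gt0.
  apply: (@le_trans _ _ ((k.+1%:R^-1 `^ H^-1) `^ H)).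
    apply: ge0_ler_powR; rewrite ?nnegrE ?(ltW H0) ?(ltW (h0 n)) ?(ltW k0)//.
    rewrite /h ler_pdivrMr// mulrC -ler_pdivrMr//.
    apply: ltW; apply: (@lt_le_trans _ _ N1%:R).
      by apply: real_truncnS_gt; exact: num_real.
    by rewrite ler_nat; apply: leqW.
  by rewrite -powRrM mulVf ?gt_eqF// powRr1// invr_ge0.
have lim : ((c / r)%:E <= P (\bigcap_N V N))%E.
  have ndV : nonincreasing_seq V.
    by move=> i j ij; apply/subsetPset => w [n /= jn Un]; exists n => //=; exact: leq_trans jn.
  have := @nonincreasing_cvg_mu _ _ _ P V _ (mV) _ ndV.
  move=> /(_ _ _)/cvg_lim <- //.
  - apply: lime_ge; last exact: nearW.
    apply: ereal_nonincreasing_is_cvgn => i j ij; apply: le_measure; [exact/mem_set/mV|exact/mem_set/mV|].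
    by have /subsetPset := ndV _ _ ij.
  - by rewrite ltey_eq fin_num_measure.
  - exact: bigcapT_measurable.
rewrite -ler_pdivrMr// -lee_fin fineK ?fin_num_measure//.
apply: (le_trans lim); apply: le_measure => //; apply: mem_set => //.
exact: bigcapT_measurable.
Qed.

(** * Chaining *)

Lemma sub_process_space (R : realType) (disp : measure_display)
    (Omega : measurableType disp) (X : R -> Omega -> R) (A : set Omega) :
  (forall t, 0 <= t <= 1 -> measurable_fun setT (X t)) ->
  measurable (A : set (process_space X)) -> measurable A.
Proof.
move=> mX; move: A; apply: smallest_sub; first exact: sigma_algebra_measurable.
move=> _ [t t01 [A mA <-]]; by apply: mX => //; move: t01; rewrite /= in_itv.
Qed.

Section chaining.
Context (R : realType) (disp : measure_display) (Omega : measurableType disp).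
Variables (P : probability Omega R) (H : R) (X : R -> Omega -> R).
Hypothesis H01 : 0 < H < 1.
Hypothesis fX : real_fbm P H X.
Variables (lo hi theta : R) (m : nat).
Hypothesis lo0 : 0 <= lo.
Hypothesis lohi : lo <= hi.
Hypothesis hi1 : hi <= 1.
Hypothesis theta0 : 0 < theta.
Hypothesis Hm : 2 <= H * m.+1%:R.

Let D (k l : nat) : R := lo + (hi - lo) * (l%:R / 2 ^+ k).
(* Half the Hölder exponent: the normalised increments of order [k] then exceed
   [theta * z ^+ k] with a probability that beats the number [2 ^ k] of them. *)
Let z : R := 2^-1 `^ (H / 2).
Let bad (k : nat) : set Omega :=
  \bigcup_(l in [set l | (l < 2 ^ k)%N])
    [set w | theta * z ^+ k < `|X (D k.+1 l.*2.+1) w - X (D k l) w|].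
Let bad0 : set Omega := [set w | theta < `|X hi w - X lo w|].
Definition chaining_bad : set Omega := bad0 `|` \bigcup_k bad k.

Let D01 k l : (l <= 2 ^ k)%N -> 0 <= D k l <= 1.
Proof.
move=> lk; have q0 : 0 <= l%:R / 2 ^+ k :> R by rewrite divr_ge0// exprn_ge0.
have q1 : l%:R / 2 ^+ k <= 1 :> R.
  by rewrite ler_pdivrMr ?exprn_gt0// mul1r -natrX ler_nat.
have d0 : 0 <= hi - lo by rewrite subr_ge0.
rewrite addr_ge0 ?mulr_ge0//=; apply: le_trans hi1.
by rewrite /D -lerBrDl ler_piMr.
Qed.

Let Dmid k l : D k.+1 l.*2.+1 - D k l = (hi - lo) * 2^-1 ^+ k.+1.
Proof.
rewrite /D -muln2 -addn1 natrD natrM exprS exprVn -[2 ^- k.+1]/((2 ^+ k.+1)^-1) exprS.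
by field; rewrite expf_neq0.
Qed.

Let lo01 : 0 <= lo <= 1. Proof. by rewrite lo0 (le_trans lohi). Qed.
Let hi01 : 0 <= hi <= 1. Proof. by rewrite hi1 andbT (le_trans lo0). Qed.

Let bound : R := (4 * m.+1%:R * (hi - lo) `^ H ^+ 2 / theta ^+ 2) ^+ m.+1.

Let bound0 : 0 <= bound.
Proof. by rewrite exprn_ge0// divr_ge0 ?sqr_ge0// !mulr_ge0// powR_ge0. Qed.

Let z0 : 0 < z. Proof. by rewrite powR_gt0. Qed.
Let z1 : z < 1. Proof. by apply: half_powR_lt1; case/andP: H01 => h _; rewrite divr_gt0. Qed.

Let gauss_increment s t : 0 <= s <= 1 -> 0 <= t <= 1 ->
  centered_gaussian P (`|t - s| `^ H ^+ 2) (fun w => X t w - X s w).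
Proof.
move=> s01 t01; have := fbm_combination H01 fX (-1) 1 s01 t01.
rewrite sqrrN !expr1n !mul1r.
have -> : s `^ H ^+ 2 + t `^ H ^+ 2 + -1 * 1 * (s `^ H ^+ 2 + t `^ H ^+ 2 - `|t - s| `^ H ^+ 2) =
  `|t - s| `^ H ^+ 2 by ring.
rewrite (_ : (fun w => _) = (fun w => X t w - X s w))//.
by apply/funext => w; ring.
Qed.

(** Here [Hm] enters: the left side is 2^(-2 H (m + 1)), with exponent at most -4. *)
Let z4 : (z ^+ 4) ^+ m.+1 <= 4^-1 ^+ 2.
Proof.
have [H0 H1] := andP H01.
have -> : (z ^+ 4) ^+ m.+1 = 2^-1 `^ (2 * (H * m.+1%:R)).
  rewrite /z -!powR_mulrn ?powR_ge0// -!powRrM; congr (_ `^ _); by field.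
apply: (@le_trans _ _ (2^-1 `^ 4%:R)); last by rewrite powR_mulrn; lra.
apply: ger_powR; first by apply/andP; split; lra.
by rewrite [4%:R](_ : _ = 2 * 2 :> R) ?ler_pM2l//; ring.
Qed.

Let P_bad0 : (P bad0 <= (2 * bound)%:E)%E.
Proof.
have := far_event_le m (gauss_increment lo01 hi01) theta0.
by rewrite ger0_norm ?subr_ge0.
Qed.

(** At level [k] the variance scales as z^(4k) and the squared threshold as z^(2k). Their ratio,
    raised to the power [m.+1], gains at least 4^(-k) by [z4]. *)
Let P_increment k l : (l < 2 ^ k)%N ->
  (P [set w | (theta * z ^+ k < `|X (D k.+1 l.*2.+1) w - X (D k l) w|)%R] <=
    (2 * bound * 4^-1 ^+ k)%:E)%E.
Proof.
have [H0 H1] := andP H01.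
move=> lk.
have l1 : 0 <= D k l <= 1 by apply: D01; exact: ltnW.
have l2 : 0 <= D k.+1 l.*2.+1 <= 1.
  by apply: D01; rewrite expnS mul2n ltn_double.
have tz : 0 < theta * z ^+ k by rewrite mulr_gt0// exprn_gt0.
apply: (le_trans (far_event_le m (gauss_increment l1 l2) tz)).
rewrite lee_fin -[leRHS]mulrA ler_wpM2l//.
rewrite Dmid ger0_norm ?mulr_ge0 ?subr_ge0 ?exprn_ge0//.
have d0 : 0 <= hi - lo by rewrite subr_ge0.
apply: (@le_trans _ _ ((4 * m.+1%:R * (hi - lo) `^ H ^+ 2 / theta ^+ 2 * (z ^+ 2) ^+ k) ^+ m.+1)).
  have sq0 (x : R) : 0 <= x ^+ 2 by exact: sqr_ge0.
  have e0 : 0 <= (z ^+ 2) ^+ k by apply: exprn_ge0; exact: sq0.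
  rewrite lerXn2r ?nnegrE//.
  - by apply: divr_ge0; [apply: mulr_ge0|exact: sq0]; [apply: mulr_ge0|exact: sq0].
  - by apply: mulr_ge0 => //; apply: divr_ge0; [apply: mulr_ge0|exact: sq0];
      [apply: mulr_ge0|exact: sq0].
  rewrite powRM ?exprn_ge0//.
  have zz : (2^-1 ^+ k.+1) `^ H = (z ^+ 2) ^+ k.+1.
    have -> : z ^+ 2 = 2^-1 `^ H.
      by rewrite -(powR_mulrn 2 (ltW z0)) /z -powRrM; congr (_ `^ _); field.
    have h0 : (0 : R) <= 2^-1 by rewrite invr_ge0.
    by rewrite -(powR_mulrn k.+1 h0) -powRrM mulrC powRrM (powR_mulrn _ (powR_ge0 _ _)).
  rewrite zz [leLHS](_ : _ = 4 * m.+1%:R * (hi - lo) `^ H ^+ 2 / theta ^+ 2 * ((z ^+ 2) ^+ k * z ^+ 4)).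
    apply: ler_wpM2l; last by rewrite ler_piMr// exprn_ile1// ltW.
    by apply: divr_ge0; [apply: mulr_ge0|exact: sq0].
  have zn0 : z != 0 by rewrite gt_eqF.
  have tn0 : theta != 0 by rewrite gt_eqF.
  have zk : (z ^+ 2) ^+ k = (z ^+ k) ^+ 2 by rewrite -!exprM mulnC.
  have un0 : z ^+ k != 0 by rewrite expf_neq0.
  by rewrite (exprS (z ^+ 2)) zk; move: (z ^+ k) un0 => u un0; field; rewrite un0 tn0.
have zm0 : 0 <= (z ^+ 2) ^+ m.+1 by apply: exprn_ge0; exact: sqr_ge0.
have q0 : 0 <= 4^-1 :> R by rewrite invr_ge0.
have zz : (z ^+ 2) ^+ m.+1 <= 4^-1.
  have e : ((z ^+ 2) ^+ m.+1) ^+ 2 = (z ^+ 4) ^+ m.+1.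
    by rewrite exprAC -(exprM z 2 2).
  by rewrite -(@ler_sqr _ _ 4^-1) ?nnegrE// e.
rewrite exprMn -/bound; apply: ler_wpM2l => //.
have -> : ((z ^+ 2) ^+ k) ^+ m.+1 = ((z ^+ 2) ^+ m.+1) ^+ k by rewrite exprAC.
by rewrite lerXn2r ?nnegrE.
Qed.

Let m_increment k l : (l < 2 ^ k)%N ->
  measurable ([set w | theta * z ^+ k < `|X (D k.+1 l.*2.+1) w - X (D k l) w|]
    : set (process_space X)).
Proof.
move=> lk.
apply: (@measurable_far_event _ _ (process_space X)
  (fun w => X (D k.+1 l.*2.+1) w - X (D k l) w)).
apply: measurable_funB; apply: measurable_process_space; apply: D01.
  by rewrite expnS mul2n ltn_double.
exact: ltnW.
Qed.

Lemma measurable_chaining_bad : measurable (chaining_bad : set (process_space X)).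
Proof.
apply: measurableU.
  apply: (@measurable_far_event _ _ (process_space X) (fun w => X hi w - X lo w)).
  by apply: measurable_funB; apply: measurable_process_space.
apply: bigcupT_measurable => k; apply: bigcup_measurable => l; exact: m_increment.
Qed.

(** Level [k] has 2^k increments, each bad with probability at most 2 * bound * 4^(-k). The levels
    add up to [4 * bound], and the increment between the endpoints gives another [2 * bound]. *)
Lemma chaining_bad_le : (P chaining_bad <= (6 * bound)%:E)%E.
Proof.
have mX t : 0 <= t <= 1 -> measurable_fun setT (X t).
  by move=> t01; exact: (measurable_fbm fX t01).
have measurable_increment k l : (l < 2 ^ k)%N ->
    measurable [set w | theta * z ^+ k < `|X (D k.+1 l.*2.+1) w - X (D k l) w|].
  by move=> lk; apply: (sub_process_space mX); exact: m_increment.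
have mb0 : measurable bad0.
  apply: (measurable_far_event (X := fun w => X hi w - X lo w)).
  by apply: measurable_funB; apply: mX.
have mb k : measurable (bad k) by apply: bigcup_measurable => l; exact: measurable_increment.
have Pb k : (P (bad k) <= (2 * bound * 2^-1 ^+ k)%:E)%E.
  rewrite /bad bigcup_mkord.
  apply: (@le_trans _ _ (\sum_(l < 2 ^ k) P [set w | (theta * z ^+ k <
      `|X (D k.+1 l.*2.+1) w - X (D k l) w|)%R])%E).
    apply: (Boole_inequality P (A := fun l => [set w | theta * z ^+ k <
      `|X (D k.+1 l.*2.+1) w - X (D k l) w|])).
    by move=> l lk; exact: measurable_increment.
  apply: (@le_trans _ _ (\sum_(l < 2 ^ k) (2 * bound * 4^-1 ^+ k)%:E)%E).
    by apply: lee_sum => l _; apply: P_increment.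
  rewrite sumEFin lee_fin sumr_const card_ord -(mulr_natr _ (2 ^ k)) natrX -[leLHS]mulrA.
  apply: ler_wpM2l; first by apply: mulr_ge0.
  by rewrite -exprMn (_ : 4^-1 * 2 = 2^-1 :> R)//; field.
apply: (@le_trans _ _ (P bad0 + P (\bigcup_k bad k))%E).
  by apply: measureU2 => //; exact: bigcupT_measurable.
have -> : 6 * bound = 2 * bound + 4 * bound by ring.
rewrite EFinD; apply: leeD => //.
apply: (@le_trans _ _ (\sum_(0 <= k <oo) P (bad k))%E).
  by apply: measure_sigma_subadditive => //; exact: bigcupT_measurable.
apply: lime_le; first by apply: is_cvg_nneseries => n _ _; exact: measure_ge0.
apply: nearW => n.
apply: (@le_trans _ _ (\sum_(0 <= k < n) (2 * bound * 2^-1 ^+ k)%:E)%E).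
  by apply: lee_sum => k _; exact: Pb.
rewrite sumEFin lee_fin -big_distrr/= big_mkord.
have -> : 4 * bound = 2 * bound * 2 by ring.
rewrite ler_wpM2l ?mulr_ge0//.
have := @geometric_sum_le R 2^-1 n.
have -> : (1 - 2^-1)^-1 = 2 :> R by field.
by apply; apply/andP; split; lra.
Qed.

(** A dyadic point of odd index is one increment away from a point of the previous level, one of
    even index already belongs to that level. The thresholds form a geometric series, and path
    continuity extends the bound to every [t]. *)
Lemma chaining_oscillation w t : ~ chaining_bad w -> lo <= t <= hi ->
  `|X t w - X lo w| <= theta * (1 + (1 - z)^-1).
Proof.
move=> nb tI.
have step k l : (l <= 2 ^ k)%N ->
    `|X (D k l) w - X lo w| <= theta * (1 + \sum_(j < k) z ^+ j).
  elim: k l => [|k IH] l lk.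
    rewrite big_ord0 addr0 mulr1; case: l lk => [_|[_|//]].
      by rewrite /D mul0r mulr0 addr0 subrr normr0 ltW.
    rewrite /D expr0 divr1 mulr1 (addrC lo) subrK leNgt; apply/negP => h.
    by apply: nb; left.
  rewrite big_ord_recr/= addrA mulrDr -(odd_double_half l).
  have [lo_|le_] := boolP (odd l).
    have lk2 : (l./2 < 2 ^ k)%N.
      rewrite -ltn_double -[X in (_ < X)%N]mul2n -expnS (leq_trans _ lk)//.
      by rewrite -[leqRHS](odd_double_half l) lo_.
    have -> : X (D k.+1 (true + l./2.*2)) w - X lo w =
      (X (D k l./2) w - X lo w) + (X (D k.+1 l./2.*2.+1) w - X (D k l./2) w).
      by rewrite add1n; ring.
    apply: (le_trans (ler_normD _ _)); rewrite lerD ?IH//; first exact: ltnW.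
    rewrite leNgt; apply/negP => h; apply: nb; right; exists k => //.
    by exists l./2.
  rewrite add0n.
  have -> : D k.+1 l./2.*2 = D k l./2.
    by rewrite /D -muln2 natrM exprS; congr (_ + _ * _); field; rewrite expf_neq0.
  apply: (le_trans (IH _ _)).
    rewrite -leq_double -[leqRHS]mul2n -expnS (leq_trans _ lk)//.
    by rewrite -[leqRHS](odd_double_half l) (negbTE le_).
  by rewrite lerDl mulr_ge0 ?exprn_ge0 ?(ltW z0)// ltW.
have Dbound k l : (l <= 2 ^ k)%N -> `|X (D k l) w - X lo w| <= theta * (1 + (1 - z)^-1).
  move=> lk; apply: (le_trans (step k l lk)); rewrite ler_wpM2l ?(ltW theta0)// lerD2l.
  by apply: geometric_sum_le; rewrite z1 (ltW z0).
have [tl th] := andP tI.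
have t01 : 0 <= t <= 1 by rewrite (le_trans lo0 tl) (le_trans th hi1).
apply/ler_addgt0Pr => eps eps0.
have [_ _ _ /(_ w) cX] := fX.
move/subspace_continuousP : cX => /(_ t) /=.
rewrite in_itv/= t01 => /(_ isT) /cvgrPdist_lt /(_ eps eps0).
rewrite near_withinE => /nbhs_ballP[r /= r0 hr].
have [k kr] := half_pow_lt r0.
have [l [lk ld]] : exists l, (l <= 2 ^ k)%N /\ `|t - D k l| <= 2^-1 ^+ k.
  have [e|ne] := eqVneq lo hi.
    exists 0%N; split => //; rewrite /D e subrr mul0r addr0.
    have -> : t = hi by apply/eqP; rewrite eq_le th -e tl.
    by rewrite subrr normr0 exprn_ge0.
  have d0 : 0 < hi - lo by rewrite subr_gt0 lt_neqAle ne.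
  pose u := (t - lo) / (hi - lo).
  have u0 : 0 <= u by rewrite divr_ge0 ?subr_ge0// ltW.
  have u1 : u <= 1 by rewrite ler_pdivrMr// mul1r lerD2r.
  have k2 : 0 < 2 ^+ k :> R by rewrite exprn_gt0.
  have uk0 : 0 <= u * 2 ^+ k by rewrite mulr_ge0// ltW.
  have /andP[h1 h2] := truncn_itv uk0.
  exists (Num.trunc (u * 2 ^+ k)); split.
    by rewrite -(@ler_nat R) (le_trans h1)// natrX ler_piMl// ltW.
  have -> : t - D k (Num.trunc (u * 2 ^+ k)) =
     (hi - lo) * ((u * 2 ^+ k - (Num.trunc (u * 2 ^+ k))%:R) / 2 ^+ k).
    have tE : t = lo + (hi - lo) * u by rewrite /u mulrCA divff ?mulr1 ?gt_eqF// addrC subrK.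
    by rewrite {1}tE /D; field; rewrite gt_eqF.
  rewrite exprVn ger0_norm; last by rewrite mulr_ge0 ?divr_ge0 ?subr_ge0// ltW.
  rewrite mulrA ler_pdivrMr// mulVf ?gt_eqF//.
  apply: mulr_ile1; rewrite ?subr_ge0//.
  - by rewrite lerBlDr (le_trans hi1)// lerDl.
  - by rewrite lerBlDl natr1 ltW.
have := hr (D k l); rewrite /ball/= => /(_ (le_lt_trans ld kr)).
rewrite in_itv/= => /(_ (D01 lk)) h.
have -> : X t w - X lo w = (X (D k l) w - X lo w) + (X t w - X (D k l) w) by ring.
by apply: (le_trans (ler_normD _ _)); rewrite lerD// ?Dbound// ltW.
Qed.

End chaining.

(** * Being near a point during a short time interval *)

Lemma clamp_interval (R : realType) (a b c h t : R) : a <= b -> 0 < h ->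
  a <= t <= b -> `|c - t| < h ->
  let lo := Num.max a (Num.min b (c - h)) in
  let hi := Num.max a (Num.min b (c + h)) in lo <= t <= hi.
Proof.
move=> ab h0 /andP[at_ tb] ct /=.
have /andP[h1 h2] : - h < c - t < h by rewrite -ltr_norml.
rewrite ge_max at_ ge_min le_max le_min tb /=.
by apply/andP; split; apply/orP; right; lra.
Qed.

(** The centre of a covering interval may lie outside [a, b]. Clamping the endpoints keeps all times
    at least [a], where the variance is bounded below, and does not lengthen the interval. *)
Lemma clamp_interval_bounds (R : realType) (a b c h : R) : a <= b -> 0 < h ->
  let lo := Num.max a (Num.min b (c - h)) in
  let hi := Num.max a (Num.min b (c + h)) in
  [/\ a <= lo, lo <= hi, hi <= b & hi - lo <= 2 * h].
Proof.
move=> ab h0 lo hi.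
have alo : a <= lo by rewrite le_max lexx.
have mlo : Num.min b (c - h) <= lo by rewrite le_max lexx orbT.
have mh : Num.min b (c + h) <= lo + 2 * h.
  have [bc|cb] := leP b (c - h); move: mlo.
    rewrite (min_idPl bc) => blo; rewrite ge_min; apply/orP; left; lra.
  rewrite (min_idPr (ltW cb)) => clo; rewrite ge_min; apply/orP; right; lra.
split => //.
- rewrite ge_max le_max lexx/= le_max le_min !ge_min lexx/=.
  by apply/orP; right; apply/orP; right; lra.
- by rewrite ge_max ab ge_min lexx.
- by rewrite lerBlDl ge_max mh andbT; lra.
Qed.

Section tube.
Context (R : realType) (d : nat) (H a : R) (disp : measure_display)
  (Omega : measurableType disp) (P : probability Omega R) (B : R -> Omega -> 'rV[R]_d).
Hypothesis H01 : 0 < H < 1.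
Hypothesis fB : fbm P H B.
Hypothesis a0 : 0 < a.
Variables (lo hi theta rho : R) (x : 'rV[R]_d).
Hypothesis alo : a <= lo.
Hypothesis lohi : lo <= hi.
Hypothesis hi1 : hi <= 1.
Hypothesis theta0 : 0 < theta.
Hypothesis rho0 : 0 < rho.

Let lo0 : 0 <= lo. Proof. by rewrite (le_trans _ alo)// ltW. Qed.
Let lo01 : 0 <= lo <= 1. Proof. by rewrite lo0 (le_trans lohi). Qed.

Let coordinate_event (i : 'I_d) : set Omega :=
  [set w | `|B lo w ord0 i - x ord0 i| <= rho] `|`
  chaining_bad H (fun t w => B t w ord0 i) lo hi theta.

Definition tube_event : set Omega := \bigcap_i coordinate_event i.

Let m_coordinate_event i :
  measurable (coordinate_event i : set (process_space (fun t w => B t w ord0 i))).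
Proof.
apply: measurableU; last exact: measurable_chaining_bad.
by apply: (@measurable_near_event _ _ (process_space _)); exact: measurable_process_space.
Qed.

Let measurable_coordinate_event i : measurable (coordinate_event i).
Proof.
apply: (@sub_process_space _ _ _ (fun t w => B t w ord0 i)); last first.
  exact: m_coordinate_event.
by move=> t t01; exact: (measurable_fbm (fB.1 i) t01).
Qed.

Lemma measurable_tube_event : measurable tube_event.
Proof. by apply: fin_bigcap_measurable => // i _; exact: measurable_coordinate_event. Qed.

Lemma tube_event_le (m : nat) : 2 <= H * m.+1%:R ->
  (P tube_event <= ((2 * rho / a `^ H +
    6 * (4 * m.+1%:R * (hi - lo) `^ H ^+ 2 / theta ^+ 2) ^+ m.+1) ^+ d)%:E)%E.
Proof.
move=> Hm; have [H0 H1] := andP H01.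
rewrite /tube_event fB.2; last first.
  by move=> i; rewrite process_sigmaE; exact: m_coordinate_event.
rewrite -[X in _ ^+ X](card_ord d) -prodr_const; apply: ereal_prod_le => // i.
have g := fbm_combination H01 (fB.1 i) 1 0 lo01 lo01.
have gB : centered_gaussian P (lo `^ H ^+ 2) (fun w => B lo w ord0 i).
  move: g; rewrite !expr1n expr0n mul1r !(mul0r, mulr0) !addr0.
  by under eq_fun do rewrite mul1r mul0r addr0.
have aH0 : 0 < a `^ H by rewrite powR_gt0.
have aloH : a `^ H <= lo `^ H.
  by apply: ge0_ler_powR; rewrite ?nnegrE ?(ltW H0) ?(ltW a0).
have loH0 : 0 < lo `^ H by exact: lt_le_trans aloH.
have mn : measurable [set w | `|B lo w ord0 i - x ord0 i| <= rho].
  by apply: measurable_near_event; exact: (measurable_fbm (fB.1 i) lo01).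
have mb : measurable (chaining_bad H (fun t w => B t w ord0 i) lo hi theta).
  apply: (@sub_process_space _ _ _ (fun t w => B t w ord0 i)).
    by move=> t t01; exact: (measurable_fbm (fB.1 i) t01).
  exact: measurable_chaining_bad.
apply: (le_trans (measureU2 _ mn mb)); rewrite EFinD; apply: leeD; last first.
  exact: (chaining_bad_le H01 (fB.1 i)).
have v0 : 0 < lo `^ H ^+ 2 by rewrite exprn_gt0.
apply: (le_trans (near_event_le (x ord0 i) gB v0 rho0)).
rewrite lee_fin sqrtr_sqr ger0_norm ?(ltW loH0)//.
by rewrite ler_pM2l ?mulr_gt0// lef_pV2 ?posrE.
Qed.

(** Going back from time [t] to [lo] costs the drift [s] and, off the bad event of the coordinate,
    the oscillation of the chaining. *)
Lemma tube_event_near (f : R -> 'rV[R]_d) (y : 'rV[R]_d) (r s t : R) (w : Omega) :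
  x = y - f lo -> lo <= t <= hi ->
  (forall i, `|f t ord0 i - f lo ord0 i| <= s) ->
  (forall i, `|y ord0 i - (B t w + f t) ord0 i| <= r) ->
  r + s + theta * (1 + (1 - 2^-1 `^ (H / 2))^-1) <= rho ->
  tube_event w.
Proof.
move=> xE tI fs yr rsrho i _.
have [bad|nb] := pselect (chaining_bad H (fun t w => B t w ord0 i) lo hi theta w).
  by right.
left => /=; apply: le_trans rsrho.
have osc := chaining_oscillation H01 (fB.1 i) lo0 lohi hi1 theta0 nb tI.
have := yr i; have := fs i; rewrite xE !mxE.
have -> : B lo w ord0 i - (y ord0 i - f lo ord0 i) =
  - (B t w ord0 i - B lo w ord0 i) + - (y ord0 i - (B t w ord0 i + f t ord0 i)) +
  - (f t ord0 i - f lo ord0 i) by ring.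
move=> h1 h2; apply: (le_trans (ler_normD _ _)).
move: (ler_normD (- (B t w ord0 i - B lo w ord0 i)) (- (y ord0 i - (B t w ord0 i + f t ord0 i)))).
by rewrite !normrN; lra.
Qed.

End tube.

(** * Hausdorff measure and Minkowski dimension *)

Lemma hausdorff_delta_antitone (R : realType) (T : Type) (dist : T -> T -> R)
    (beta delta delta' : R) (G : set T) : delta <= delta' ->
  (hausdorff_delta dist beta delta' G <= hausdorff_delta dist beta delta G)%E.
Proof.
move=> dd; apply: ereal_inf_le_tmp => _ [r [rd Gr] <-]; exists r => //; split=> // n.
by have /andP[-> h] := rd n; exact: le_trans dd.
Qed.

(** The contents increase as [delta] decreases, so their limit at 0 is a supremum. *)
Lemma hausdorff_measure_ge (R : realType) (T : Type) (dist : T -> T -> R)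
    (beta delta : R) (G : set T) : 0 < delta ->
  (hausdorff_delta dist beta delta G <= hausdorff_measure dist beta G)%E.
Proof.
move=> d0; rewrite /hausdorff_measure.
have ninc : {in Interval (BRight (0 : R)) (BLeft delta) &,
    nonincreasing_fun (fun delta => hausdorff_delta dist beta delta G)}.
  by move=> s t _ _; exact: hausdorff_delta_antitone.
have lt0 : (BRight 0 < BLeft delta)%O by rewrite bnd_simp.
rewrite (cvg_lim _ (nonincreasing_at_right_cvge (BLeft delta) lt0 ninc))//.
apply: (@le_trans _ _ (hausdorff_delta dist beta (delta / 2) G)).
  by apply: hausdorff_delta_antitone; lra.
apply: ereal_sup_ubound; exists (delta / 2) => //=.
by rewrite in_itv/=; apply/andP; split; lra.
Qed.

Lemma hausdorff_measure_ge0 (R : realType) (T : Type) (dist : T -> T -> R)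
    (beta : R) (G : set T) : (0 <= hausdorff_measure dist beta G)%E.
Proof. exact: le_trans (hausdorff_delta_ge0 _ _ _ _) (hausdorff_measure_ge _ _ _ (@ltr01 R)). Qed.

Lemma lte_between (R : realType) (x : R) (y : \bar R) : (x%:E < y)%E ->
  exists2 z : R, x < z & (z%:E < y)%E.
Proof.
case: y => [y| |//]; last by exists (x + 1); [rewrite ltrDl|rewrite ltry].
by rewrite lte_fin => xy; exists ((x + y) / 2); rewrite ?lte_fin; lra.
Qed.

Lemma hausdorff_measure_gt0 (R : realType) (T : Type) (dist : T -> T -> R)
    (beta : R) (G : set T) : 0 < beta -> (beta%:E < hausdorff_dim dist G)%E ->
  exists2 beta1, beta < beta1 & (0 < hausdorff_measure dist beta1 G)%E.
Proof.
move=> b0 /lte_between[z bz zd]; exists z => //.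
rewrite lt_neqAle hausdorff_measure_ge0 andbT eq_sym; apply/eqP => h0.
move: zd; rewrite ltNge => /negP; apply; apply: ereal_inf_lbound; exists z => //.
by split => //; exact: lt_trans bz.
Qed.

Lemma upper_minkowski_cover (R : realType) (T : Type) (dist : T -> T -> R)
    (beta : R) (G : set T) : (upper_minkowski_dim dist G < beta%:E)%E ->
  exists2 beta1 : R, beta1 < beta & exists2 delta : R, 0 < delta &
    forall r, 0 < r < delta -> exists n (x : 'I_n -> T),
      G `<=` \bigcup_i oball dist (x i) r /\ n%:R <= r `^ (- beta1).
Proof.
rewrite /upper_minkowski_dim limf_esupE => /ereal_inf_lt[_ [V V0 <-]] supV.
set s := ereal_sup _ in supV.
have [b1 [sb1 b1b]] : exists b1 : R, (s <= b1%:E)%E /\ b1 < beta.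
  case: s supV => [s| |] sb //; last by exists (beta - 1); split; [rewrite leNye|lra].
  by exists s.
(* A covering number is an infimum, and a strict inequality is needed to extract an actual cover;
   the midpoint provides it. *)
pose b2 := (b1 + beta) / 2.
have b12 : b1 < b2 by rewrite /b2; lra.
exists b2; first by rewrite /b2; lra.
have /nbhs_ballP[e /= e0 eV] := V0.
(* [r < 1] makes the denominator [ln r^-1] positive. *)
exists (Num.min e 1); first by rewrite lt_min e0 ltr01.
move=> r /andP[r0]; rewrite lt_min => /andP[re r1].
have Vr : V r.
  by apply: eV; rewrite /ball//= sub0r normrN gtr0_norm.
have L0 : 0 < ln r^-1 by rewrite ln_gt0// invf_gt1.
have gr : (lne (covering_number dist G r) / (ln r^-1)%:E <= b1%:E)%E.
  by apply: le_trans sb1; apply: ereal_sup_ubound; exists r.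
have rb0 : 0 < r `^ (- b2) by rewrite powR_gt0.
suff : (covering_number dist G r < (r `^ (- b2))%:E)%E.
  move=> /ereal_inf_lt[_ [n [x Gx] <-]]; rewrite lte_fin => nb.
  by exists n, x; split => //; exact: ltW.
rewrite ltNge; apply/negP => h.
suff : (b1%:E < lne (covering_number dist G r) / (ln r^-1)%:E)%E by rewrite ltNge gr.
rewrite inver gt_eqF//.
case: (covering_number dist G r) h => [q| |]; rewrite ?leeNy_eq// => h.
  rewrite lee_fin in h; have q0 : 0 < q by exact: lt_le_trans h.
  rewrite lne_EFin// lte_pdivlMr// -EFinM lte_fin.
  apply: (@lt_le_trans _ _ (ln (r `^ (- b2)))); last by rewrite ler_ln.
  have -> : ln (r `^ (- b2)) = b2 * ln r^-1 by rewrite ln_powR lnV ?posrE// mulrN mulNr.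
  by rewrite ltr_pM2r.
by rewrite /= mulyr gtr0_sg ?invr_gt0// mul1e ltry.
Qed.

(** * The upper bound *)

Section hitting_upper.
Context (R : realType) (d : nat) (H a b K beta beta1 delta : R) (E : set R).
Hypothesis d0 : (0 < d)%N.
Hypothesis H01 : 0 < H < 1.
Hypothesis a0 : 0 < a.
Hypothesis ab : a < b.
Hypothesis b1 : b <= 1.
Hypothesis K0 : 0 <= K.
Hypothesis Eab : E `<=` `[a, b].
Hypothesis bb : beta1 < beta.
Hypothesis delta0 : 0 < delta.
Hypothesis coverE : forall h, 0 < h < delta -> exists n (c : 'I_n -> R),
  E `<=` \bigcup_i oball (@abs_dist R) (c i) h /\ n%:R <= h `^ (- beta1).

Let gamma : R := d%:R - beta / H.

Lemma ball_hit_le : exists r0 C : R, [/\ 0 < r0, 0 < C &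
  forall (disp : measure_display) (Omega : measurableType disp)
    (P : probability Omega R) (B : R -> Omega -> 'rV[R]_d) (f : R -> 'rV[R]_d),
    fbm P H B ->
    (forall s t i, a <= s <= b -> a <= t <= b ->
       `|f t ord0 i - f s ord0 i| <= K * `|t - s| `^ H) ->
    forall (y : 'rV[R]_d) (r : R), 0 < r <= r0 ->
    exists G : set Omega, [/\ measurable G, (P G <= (C * r `^ gamma)%:E)%E &
      forall w t, E t -> (forall i, `|y ord0 i - (B t w + f t) ord0 i| <= r) -> G w]].
Proof.
have [H0 H1] := andP H01.
(* Each of the [d] coordinates loses r^(-eps), and [d * eps] is exactly the gap
   [(beta - beta1) / H]. *)
pose eps : R := (beta - beta1) / (H * d%:R).
have dR : 0 < d%:R :> R by rewrite ltr0n.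
have eps0 : 0 < eps by rewrite divr_gt0 ?subr_gt0// mulr_gt0.
(* Large enough both for the chaining ([Hm]) and for its failure to have probability of order
   [theta] ([em]). *)
pose m := Num.trunc (2 / H + eps^-1).
have mge : 2 / H + eps^-1 <= m.+1%:R.
  by apply: ltW; apply: real_truncnS_gt; exact: num_real.
have ei0 : 0 < eps^-1 by rewrite invr_gt0.
have tH0 : 0 < 2 / H by rewrite divr_gt0.
have Hm : 2 <= H * m.+1%:R.
  by rewrite -ler_pdivrMl// (mulrC H^-1); apply: le_trans mge; rewrite lerDl ltW.
have em : 1 <= eps * m.+1%:R.
  by rewrite -ler_pdivrMl// mulr1; apply: le_trans mge; rewrite lerDr ltW.
pose S : R := 1 + (1 - 2^-1 `^ (H / 2))^-1.
have S0 : 0 < S.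
  have h : 2^-1 `^ (H / 2) < 1 :> R by apply: half_powR_lt1; rewrite divr_gt0.
  by rewrite /S addr_gt0// invr_gt0 subr_gt0.
(* In units of [theta]: 1 for the distance to the target, [K * 2] for the drift over one interval,
   [S] for the oscillation. *)
pose L := 1 + K * 2 + S.
have L0 : 0 < L by have := K0; rewrite /L; lra.
pose M : R := (16 * m.+1%:R) ^+ m.+1.
have M0 : 0 < M by rewrite exprn_gt0// mulr_gt0.
have aH0 : 0 < a `^ H by rewrite powR_gt0.
pose C1 := 2 * L / a `^ H + 6 * M.
have C10 : 0 < C1.
  by rewrite /C1 addr_gt0 ?divr_gt0// mulr_gt0.
(* For [r <= r0] the mesh r^(1/H) is below [delta], and [r <= 1]. *)
pose r0 : R := (Num.min delta 1 / 2) `^ H.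
have md0 : 0 < Num.min delta 1 / 2 by rewrite divr_gt0// lt_min delta0 ltr01.
have md1 : Num.min delta 1 / 2 < delta.
  have : Num.min delta 1 <= delta by rewrite ge_min lexx.
  by lra.
have md2 : Num.min delta 1 / 2 <= 1.
  have : Num.min delta 1 <= 1 by rewrite ge_min lexx orbT.
  by lra.
exists r0, (C1 ^+ d); split; [by rewrite powR_gt0|by rewrite exprn_gt0|].
move=> disp Omega P B f fB fH y r /andP[rgt0 rr0].
have r1 : r <= 1.
  apply: (le_trans rr0); have <- : 1 `^ H = 1 :> R by rewrite powR1.
  by apply: ge0_ler_powR; rewrite ?nnegrE ?(ltW H0) ?(ltW md0).
pose h := r `^ H^-1.
have h0 : 0 < h by rewrite powR_gt0.
have hH : h `^ H = r by rewrite /h -powRrM mulVf ?gt_eqF// powRr1// ltW.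
have hd : h < delta.
  apply: le_lt_trans md1.
  have -> : Num.min delta 1 / 2 = r0 `^ H^-1.
    by rewrite /r0 -powRrM mulfV ?gt_eqF// powRr1// ltW.
  by apply: ge0_ler_powR; rewrite ?nnegrE ?invr_ge0 ?(ltW H0) ?(ltW rgt0) ?powR_ge0.
have [n [c [Ec nh]]] := coverE (introT andP (conj h0 hd)).
have hb : h `^ (- beta1) = r `^ (- (beta1 / H)).
  by rewrite /h -powRrM; congr (_ `^ _); ring.
rewrite hb in nh.
pose lo i := Num.max a (Num.min b (c i - h)).
pose hi i := Num.max a (Num.min b (c i + h)).
have lohi i : [/\ a <= lo i, lo i <= hi i, hi i <= b & hi i - lo i <= 2 * h].
  by apply: clamp_interval_bounds => //; exact: ltW.
pose theta := r `^ (1 - eps).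
have theta0 : 0 < theta by rewrite powR_gt0.
have rtheta : r <= theta.
  rewrite -[leLHS](powRr1 (ltW rgt0)); apply: ger_powR; first by rewrite rgt0.
  by lra.
pose rho := L * theta.
have rho0 : 0 < rho by rewrite mulr_gt0.
have diam i : (hi i - lo i) `^ H <= 2 * r.
  have [_ h1 _ h2] := lohi i.
  apply: (@le_trans _ _ ((2 * h) `^ H)).
    by apply: ge0_ler_powR; rewrite ?nnegrE ?subr_ge0 ?(ltW H0) ?mulr_ge0 ?(ltW h0).
  rewrite powRM ?(ltW h0)// hH; apply: ler_wpM2r; first exact: ltW.
  rewrite -[leRHS]powRr1//; apply: ler_powR; [by lra|exact: ltW].
pose T i := tube_event H B (lo i) (hi i) theta rho (y - f (lo i)).
have mT i : measurable (T i).
  have [h1 h2 h3 _] := lohi i.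
  by apply: (measurable_tube_event (P := P) (a := a)) => //; exact: le_trans b1.
have PT i : (P (T i) <= (C1 ^+ d * r `^ (d%:R - (beta - beta1) / H))%:E)%E.
  have [h1 h2 h3 _] := lohi i.
  apply: (le_trans (tube_event_le H01 fB a0 (y - f (lo i)) h1 h2 (le_trans h3 b1) theta0 rho0 Hm)).
  have epsd : (1 - eps) * d%:R = d%:R - (beta - beta1) / H.
    by rewrite /eps; field; rewrite !gt_eqF.
  rewrite lee_fin -epsd powRrM powR_mulrn ?powR_ge0// -exprMn -/theta.
  set q := 4 * _ * _ / _.
  have q0 : 0 <= q.
    have sq0 (x : R) : 0 <= x ^+ 2 by exact: sqr_ge0.
    by apply: divr_ge0; [apply: mulr_ge0|exact: sq0].
  (* Here [q] is at most 16 (m + 1) r^(2 eps). Its power [m.+1] is of order [theta] because 2 eps (m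
     + 1) >= 1 - eps. *)
  have qM : q ^+ m.+1 <= M * theta.
    have th2 : 0 < theta ^+ 2 by rewrite exprn_gt0.
    have qle : q <= 16 * m.+1%:R * r `^ eps ^+ 2.
      have re0 : 0 < r `^ eps by rewrite powR_gt0.
      have rE : r = theta * r `^ eps.
        by rewrite /theta -powRD ?(gt_eqF rgt0) ?implybT// subrK powRr1// ltW.
      have dd : (hi i - lo i) `^ H ^+ 2 <= (2 * r) ^+ 2.
        by rewrite lerXn2r ?nnegrE ?powR_ge0 ?mulr_ge0 ?(ltW rgt0).
      rewrite /q ler_pdivrMr//.
      have -> : 16 * m.+1%:R * r `^ eps ^+ 2 * theta ^+ 2 = 4 * m.+1%:R * (2 * r) ^+ 2.
        by rewrite [in RHS]rE; ring.
      by apply: ler_wpM2l => //; apply: mulr_ge0.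
    apply: (@le_trans _ _ ((16 * m.+1%:R * r `^ eps ^+ 2) ^+ m.+1)).
      by rewrite lerXn2r ?nnegrE// (le_trans q0 qle).
    rewrite exprMn -/M; apply: ler_wpM2l; first exact: ltW.
    rewrite -!powR_mulrn ?powR_ge0// -!powRrM /theta.
    apply: ger_powR; first by rewrite rgt0.
    by lra.
  apply: lerXn2r; rewrite ?nnegrE.
  - apply: addr_ge0; last by apply: mulr_ge0; rewrite ?exprn_ge0.
    by apply: divr_ge0; [apply: mulr_ge0; rewrite // ltW|exact: ltW].
  - by rewrite mulr_ge0// ltW.
  have -> : C1 * theta = 2 * L / a `^ H * theta + 6 * M * theta by rewrite mulrDl.
  apply: lerD.
    by rewrite /rho le_eqVlt; apply/orP; left; apply/eqP; field; rewrite gt_eqF.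
  by rewrite -[leRHS]mulrA; apply: ler_wpM2l.
exists (\big[setU/set0]_(i < n) T i); split.
- exact: bigsetU_measurable.
- apply: (@le_trans _ _ (\sum_(i < n) P (T i))%E).
    suff [] : measurable (\big[setU/set0]_(i < n) T i) /\
      (P (\big[setU/set0]_(i < n) T i) <= \sum_(i < n) P (T i))%E by [].
    apply: (big_rec2 (fun U s => measurable U /\ (P U <= s)%E)) => [|i s U _ [mU PU]].
      by split; rewrite ?measure0.
    split; first exact: measurableU.
    by apply: (le_trans (measureU2 _ (mT i) mU)); apply: leeD.
  apply: (@le_trans _ _ (\sum_(i < n) (C1 ^+ d * r `^ (d%:R - (beta - beta1) / H))%:E)%E).
    by apply: lee_sum => i _; exact: PT.
  rewrite sumEFin lee_fin sumr_const card_ord -(mulr_natr _ n) -mulrA.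
  apply: ler_wpM2l; first by rewrite exprn_ge0// ltW.
  set q := d%:R - (beta - beta1) / H.
  (* The number of intervals, at most r^(-beta1 / H), accounts for the remaining part of the
     exponent. *)
  have -> : gamma = q + - (beta1 / H) by rewrite /gamma /q; ring.
  rewrite (@powRD _ _ q) ?(gt_eqF rgt0) ?implybT//; apply: ler_wpM2l => //; exact: powR_ge0.
- move=> w t Et yr; have [i _ ci] := Ec t Et.
  rewrite (bigD1 i)//=; left.
  have tab : a <= t <= b by have := Eab Et; rewrite /= in_itv.
  have tI : lo i <= t <= hi i by apply: clamp_interval => //; exact: ltW.
  have [h1 h2 h3 h4] := lohi i.
  have [t1 t2] := andP tI.
  have loab : a <= lo i <= b by rewrite h1 (le_trans h2 h3).
  apply: (tube_event_near H01 fB a0 h1 h2 (le_trans h3 b1) theta0 _ tI _ yr (s := K * (2 * r))) => //.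
    move=> j; apply: (le_trans (fH (lo i) t j loab tab)); apply: ler_wpM2l => //.
    rewrite ger0_norm ?subr_ge0//; apply: le_trans (diam i).
    by apply: ge0_ler_powR; rewrite ?nnegrE ?subr_ge0 ?(ltW H0) ?lerD2r.
  have -> : rho = theta + K * (2 * theta) + theta * S by rewrite /rho /L; ring.
  by rewrite lerD2r; apply: lerD => //; apply: ler_wpM2l => //; apply: ler_wpM2l.
Qed.

(** Every cover of [F] with radii at most [r0] bounds the hitting probability by a union bound, so
    the content at [r0] does, and the Hausdorff measure dominates that content. *)
Lemma hitting_upper_bound (F : set 'rV[R]_d) : compact E -> compact F -> 0 < gamma ->
  exists2 C : R, 0 < C &
    forall (disp : measure_display) (Omega : measurableType disp)
      (P : probability Omega R) (B : R -> Omega -> 'rV[R]_d) (f : R -> 'rV[R]_d),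
      fbm P H B ->
      (forall s t i, a <= s <= b -> a <= t <= b ->
         `|f t ord0 i - f s ord0 i| <= K * `|t - s| `^ H) ->
      (P [set w | ((fun t => (B t w + f t)%R) @` E) `&` F !=set0] <=
       C%:E * hausdorff_measure (@euclid_dist R d) gamma F)%E.
Proof.
move=> cE cF g0; have [H0 H1] := andP H01.
have [r0 [C [r00 C0 ball_le]]] := ball_hit_le.
exists C => // disp Omega P B f fB fH; set hit := [set w | _].
have mhit : measurable hit by exact: (measurable_hit d0 H0 a0 b1 K0 cE Eab cF fB fH).
apply: (@le_trans _ _ (C%:E * hausdorff_delta (@euclid_dist R d) gamma r0 F)%E); last first.
  by apply: lee_wpmul2l; [rewrite lee_fin ltW|exact: hausdorff_measure_ge].
rewrite -lee_pdivrMl//; apply: le_ereal_inf_tmp => _ [r [rr [x Fx]] <-].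
rewrite lee_pdivrMl// -nneseriesZl; last by move=> n _; rewrite lee_fin powR_ge0.
have /choice[G hG] (n : nat) : exists G : set Omega, [/\ measurable G,
    (P G <= C%:E * ((2 * r n) `^ gamma)%:E)%E &
    forall w t, E t -> oball (@euclid_dist R d) (x n) (r n) (B t w + f t) -> G w].
  (* [ball_hit_le] concerns positive radii; a ball of radius 0 is empty and is assigned the empty
     event. *)
  have /andP[] := rr n; rewrite le_eqVlt => /predU1P[<- _|rn0 rnr0].
    exists set0; split => //.
      by rewrite measure0 mule_ge0// lee_fin ?powR_ge0// ltW.
    by move=> w t _; rewrite /oball/= ltNge sqrtr_ge0.
  have [|G [mG PG hG]] := ball_le _ _ P B f fB fH (x n) (r n).
    by rewrite rn0.
  exists G; split => //.
    apply: (le_trans PG); rewrite -EFinM lee_fin; apply: ler_wpM2l; first exact: ltW.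
    by apply: ge0_ler_powR; rewrite ?nnegrE ?(ltW g0) ?mulr_ge0 ?(ltW rn0)//; lra.
  move=> w t Et xr; apply: (hG w t Et) => i.
  have := coord_le_euclid_norm (x n - (B t w + f t)) i.
  by rewrite !mxE => h; apply: (le_trans h); apply: ltW.
have mG n : measurable (G n) by have [] := hG n.
apply: (@le_trans _ _ (\sum_(0 <= n <oo) P (G n))%E).
  apply: measure_sigma_subadditive => //.
  move=> w [_ [[t Et <-] Ft]]; have [n _ xn] := Fx _ Ft.
  by exists n => //; have [_ _ hn] := hG n; exact: hn Et xn.
by apply: lee_nneseries => [n _ _|n _]; [exact: measure_ge0|have [] := hG n].
Qed.

End hitting_upper.

(** * Capacity and conclusion *)

Lemma energy_ge0 (R : realType) (d : nat) (gamma : R) (mu : probability (borelRn R d) R) :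
  (0 <= energy gamma mu)%E.
Proof.
apply: integral_ge0 => v _; apply: integral_ge0 => u _; rewrite /riesz_kernel.
by case: ifP => // _; rewrite lee_fin powR_ge0.
Qed.

(** For [p > 0] every admissible energy is at least [c / p], hence so is the infimum, and inversion
    gives the claim. For [p = 0] no admissible energy is finite, and the capacity is 0. *)
Lemma capacity_le (R : realType) (d : nat) (gamma c p : R) (F : set 'rV[R]_d) :
  0 < c -> 0 <= p ->
  (forall (mu : probability (borelRn R d) R) (r : R), mu.-negligible (~` F) ->
     energy gamma mu = r%:E -> c <= p * r) ->
  (c%:E * capacity gamma F <= p%:E)%E.
Proof.
move=> c0; rewrite le_eqVlt => /predU1P[<-|p0] hmu; rewrite /capacity.
  have -> : ereal_inf [set energy gamma mu | mu in
      [set mu : probability (borelRn R d) R | mu.-negligible (~` F)]] = +oo%E.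
    apply/eqP; rewrite -leye_eq; apply: le_ereal_inf_tmp => _ [mu nF <-].
    have := energy_ge0 gamma mu.
    case e : (energy gamma mu) => [r| |]// _.
    by have := hmu mu r nF e; rewrite mul0r leNgt c0.
  by rewrite invey mule0.
set I := ereal_inf _.
have cI : ((c / p)%:E <= I)%E.
  apply: le_ereal_inf_tmp => _ [mu nF <-].
  have := energy_ge0 gamma mu.
  case e : (energy gamma mu) => [r| |] // _; last by rewrite leey.
  by rewrite lee_fin ler_pdivrMr// mulrC; exact: hmu nF e.
have cp0 : 0 < c / p by rewrite divr_gt0.
case: I cI => [i| |]//= cI; last by rewrite invey mule0 lee_fin ltW.
rewrite lee_fin in cI; have i0 : 0 < i by exact: lt_le_trans cI.
rewrite inver gt_eqF// -EFinM lee_fin ler_pdivrMr//.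
by rewrite -ler_pdivrMl// mulrC.
Qed.

Theorem proposition3p2 (R : realType) (d : nat) (H a b : R)
    (E : set R) (F : set 'rV[R]_d) (beta beta' K : R) :
  0 < H < 1 ->
  0 < a -> a < b -> b <= 1 ->
  compact E -> E `<=` `[a, b] -> compact F ->
  (0 < hausdorff_dim (@abs_dist R) E)%E ->
  (hausdorff_dim (@abs_dist R) E <= upper_minkowski_dim (@abs_dist R) E)%E ->
  (upper_minkowski_dim (@abs_dist R) E < (H * d%:R)%:E)%E ->
  0 < beta ->
  (beta%:E < hausdorff_dim (@abs_dist R) E)%E ->
  (upper_minkowski_dim (@abs_dist R) E < beta'%:E)%E ->
  beta' < H * d%:R ->
  exists2 c1 : R, 0 < c1 &
    forall (disp : measure_display) (Omega : measurableType disp)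
      (P : probability Omega R) (B : R -> Omega -> 'rV[R]_d)
      (f : R -> 'rV[R]_d),
      measure_is_complete P ->
      fbm P H B ->
      holder_space `[a, b] H f ->
      holder_norm `[a, b] H f = K%:E ->
      ((c1^-1)%:E * capacity (d%:R - beta / H) F
         <= P [set w | ((fun t => (B t w + f t)%R) @` E) `&` F !=set0]
         <= c1%:E * hausdorff_measure (@euclid_dist R d) (d%:R - beta' / H) F)%E.
Proof.
move=> H01 a0 ab b1 cE Eab cF dim0 dimM MHd beta0 bdim Mb b'Hd.
have [H0 H1] := andP H01.
(* For [d = 0] a positive dimension would have to lie below 0. *)
have d0 : (0 < d)%N.
  rewrite lt0n; apply/eqP => d0.
  by have := lt_trans (lt_le_trans dim0 dimM) MHd; rewrite d0 mulr0 ltxx.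
have gamma0 (x : R) : x < H * d%:R -> 0 < d%:R - x / H.
  by move=> h; rewrite subr_gt0 ltr_pdivrMr// mulrC.
have bHd : beta < H * d%:R.
  by have := lt_trans (lt_le_trans bdim dimM) MHd; rewrite lte_fin.
(* The constant is chosen before [f]. For negative [K] no function has norm [K], and any constant
   will do. *)
have [K0|K0] := leP 0 K; last first.
  exists 1 => // disp Omega P B f _ _ _ /(holder_norm_bounds ab)[fK _].
  have : `|f a ord0 (Ordinal d0)| <= K by apply: fK; rewrite lexx ltW.
  by rewrite leNgt (lt_le_trans K0).
have [betas bbs Hbs] := hausdorff_measure_gt0 beta0 bdim.
have [c c0 lower] := hitting_lower_bound d0 H01 a0 ab b1 K0 cE Eab cF beta0 bbs
  (gamma0 _ bHd) Hbs.
have [beta1 b1b' [delta delta0 cover]] := upper_minkowski_cover Mb.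
have [C C0 upper] := hitting_upper_bound d0 H01 a0 ab b1 K0 Eab b1b' delta0 cover cE cF
  (gamma0 _ b'Hd).
have c1_gt0 : 0 < c^-1 + C by rewrite addr_gt0// invr_gt0.
exists (c^-1 + C) => // disp Omega P B f _ fB _ fK.
have [fb fH] := holder_norm_bounds ab fK.
have mhit := measurable_hit d0 H0 a0 b1 K0 cE Eab cF fB fH.
apply/andP; split.
  rewrite -(fineK (fin_num_measure P _ mhit)).
  apply: capacity_le; rewrite ?invr_gt0 ?fine_ge0// => mu r nF er.
  apply: le_trans (lower _ _ _ _ _ fB fb fH mu r nF er).
  by rewrite -[leRHS]invrK lef_pV2 ?posrE ?invr_gt0// lerDl ltW.
apply: (le_trans (upper _ _ _ _ _ fB fH)).
apply: lee_wpmul2r; first exact: hausdorff_measure_ge0.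
by rewrite lee_fin lerDr invr_ge0 ltW.
Qed.
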